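(* Let $Z=(X^+,X^-)$ be a planar Filippov system with a visible fold-regular point at $(0,0)$ and let $Z_\varepsilon$ be its regularization (see context). Suppose that $X^+$ has a center in $\mathcal V^+$ surrounded by periodic orbits which intersect the switching manifold $\Sigma$. Then, for $\varepsilon$ small enough, the unique orbit of $X^+$ tangent to $\Sigma_\varepsilon=\{(x,\varepsilon)\}$ is a periodic orbit of $Z_\varepsilon$ that is semistable: it is attracting for all the orbits exterior to it, but its interior is foliated by periodic orbits.
   Context: Filippov system: $\mathcal V^+=\{y>0\}$, $\mathcal V^-=\{y<0\}$, $\Sigma=\{y=0\}$. $Z$ equals $X^+=(X_1^+,X_2^+)$ on $\mathcal V^+$ and $X^-=(X_1^-,X_2^-)$ on $\mathcal V^-$; both extend to $\Sigma$ with class at least $C^2$. The origin is a visible fold-regular point: $X_1^+(0,0)>0$, $X_2^+(0,0)=0$, $\partial_xX_2^+(0,0)\neq0$, $X_2^+(x,0)<0$ for $x<0$, $X_2^+(x,0)>0$ for $x>0$ (locally), and $X_2^-(0,0)>0$. Regularization: $Z_\varepsilon=\frac{X^++X^-}2+\varphi(\tfrac y\varepsilon)\frac{X^+-X^-}2$, with $\varphi$ increasing. Here, for an integer $p\ge1$: if $p=1$, $\varphi(v)=-1$ ($v\le-1$), $v$ ($|v|<1$), $1$ ($v\ge1$); if $p\ge2$, $\varphi$ is of class $C^{p-1}$, equal to $-1$ for $v\le-1$ and to $1$ for $v\ge1$, $C^\infty$ for $-1<v<1$, and behaves as $1+O((v-1)^p)$ for $v\le1$ near $1$. Note that $Z_\varepsilon=X^+$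 for $y\ge\varepsilon$. The tangent orbit is the $X^+$-orbit through the point $(x_\varepsilon,\varepsilon)$, $x_\varepsilon=O(\varepsilon)$, with $X_2^+(x_\varepsilon,\varepsilon)=0$.
   Formalization: Added: the fold at the origin is the only point of Σ inside the region of periodic orbits where X^+ is tangent to Σ (otherwise the tangent orbit need not be periodic). Attraction is claimed for exterior orbits starting within a distance d of the tangent orbit, d independent of ε. *)

(* Defs.v *)
From HB Require Import structures.
From mathcomp Require Import all_boot all_order all_algebra.
From mathcomp Require Import all_classical all_reals all_analysis.
Set Implicit Arguments.
Unset Strict Implicit.
Unset Printing Implicit Defensive.
Import Order.TTheory GRing.Theory Num.Theory.
Import numFieldNormedType.Exports.

Local Open Scope classical_set_scope.
Local Open Scope ring_scope.

Section Smoothness.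
Variable R : realType.

(* All iterated partial derivatives of [f] of order at most [k] exist and are
   continuous on [U] ([U] is meant to be open). *)
Fixpoint Ck_on (k : nat) (U : set (R * R)) (f : R * R -> R) : Prop :=
  (forall q, U q -> {for q, continuous f}) /\
  if k is k'.+1 then
    forall v : R * R, v = (1, 0) \/ v = (0, 1) ->
      (forall q, U q -> derivable f q v) /\ Ck_on k' U ('D_v f)
  else True.

Definition Ck_field_on k U (X : R * R -> R * R) : Prop :=
  Ck_on k U (fun q => (X q).1) /\ Ck_on k U (fun q => (X q).2).

Definition Ck1 (k : nat) (f : R -> R) : Prop :=
  (forall j (v : R), (j < k)%N -> derivable (derive1n j f) v 1) /\ continuous (derive1n k f).

End Smoothness.

Section PlanarDynamics.
Variable R : realType.

(* Below, a vector field is a total function [X] together with the set [D] on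
   which it is meaningful: its orbits are required to stay in [D]. *)
Definition solves (D : set (R * R)) (X : R * R -> R * R) (I : set R)
    (g : R -> R * R) : Prop :=
  forall t, I t -> D (g t) /\ is_derive t 1 g (X (g t)).

Definition periodic_orbit D X (G : set (R * R)) : Prop :=
  exists (g : R -> R * R) (T : R),
    [/\ solves D X setT g, 0 < T, forall t, g (t + T) = g t,
        X (g 0) != 0 & G = range g].

(* Points of the complement of [G] whose component is bounded (resp.
   unbounded): the two sides of the Jordan curve [G]. *)
Definition inside (G : set (R * R)) : set (R * R) :=
  [set q | ~ G q /\ bounded_set (connected_component (~` G) q)].

Definition outside (G : set (R * R)) : set (R * R) :=
  [set q | ~ G q /\ ~ bounded_set (connected_component (~` G) q)].

(* [A] is an open connected set made of the equilibrium [c] and of periodic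
   orbits surrounding [c]: [c] is a center and [A `\ c] an annulus of periodic
   orbits around it (not necessarily the largest one). *)
Definition center_with_annulus D X (c : R * R) (A : set (R * R)) : Prop :=
  [/\ X c = 0, open A, connected A, A c &
      forall q, A q -> q <> c ->
        exists G, [/\ periodic_orbit D X G, G q, G `<=` A & inside G c]].

Definition foliated_by_periodic_orbits D X (S : set (R * R)) : Prop :=
  forall q, S q -> exists G, [/\ periodic_orbit D X G, G q & G `<=` S].

Definition tends_to_set (g : R -> R * R) (G : set (R * R)) : Prop :=
  forall e : R, 0 < e -> \forall t \near +oo, exists2 z, G z & `|g t - z| < e.

(* Forward orbits are functions on the whole line that solve the equation for
   [0 <= t]; their values at [t < 0] are irrelevant, and the (two-sided)
   derivative at [0] is no restriction since one may extend linearly. *)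
Definition attracts_outside D X (d : R) (G : set (R * R)) : Prop :=
  forall q, outside G q -> (exists2 z, G z & `|q - z| < d) ->
    (exists g, solves D X [set t | 0 <= t] g /\ g 0 = q) /\
    (forall g, solves D X [set t | 0 <= t] g -> g 0 = q -> tends_to_set g G).

End PlanarDynamics.

Section Filippov.
Variable R : realType.

(* [Xp] (resp. [Xm]) stands for a C^2 extension of the upper (resp. lower)
   vector field to an open neighborhood [Up] (resp. [Um]) of the closed upper
   (resp. lower) half-plane. *)
Definition filippov_system (Up Um : set (R * R)) (Xp Xm : R * R -> R * R) :
    Prop :=
  [/\ open Up, open Um, [set q | 0 <= q.2] `<=` Up, [set q | q.2 <= 0] `<=` Um
    & Ck_field_on 2 Up Xp /\ Ck_field_on 2 Um Xm].

Definition visible_fold_regular (Xp Xm : R * R -> R * R) : Prop :=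
  [/\ 0 < (Xp (0, 0)).1,
      (Xp (0, 0)).2 = 0,
      'D_(1, 0) (fun q => (Xp q).2) (0, 0) != 0,
      \forall x \near (0 : R), (x < 0 -> (Xp (x, 0)).2 < 0) /\
                               (0 < x -> 0 < (Xp (x, 0)).2)
    & 0 < (Xm (0, 0)).2].

Definition transition_function (p : nat) (phi : R -> R) : Prop :=
  [/\ {in `[-1, 1] &, {homo phi : u v / u < v}},
      forall v : R, v <= -1 -> phi v = -1,
      forall v : R, 1 <= v -> phi v = 1,
      p = 1%N -> forall v : R, `|v| < 1 -> phi v = v
    & (2 <= p)%N ->
      [/\ Ck1 p.-1 phi,
          forall n (v : R), `|v| < 1 -> derivable (derive1n n phi) v 1
        & exists C : R, \forall v \near (1 : R)^'-,
            `|phi v - 1| <= C * `|v - 1| ^+ p]].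

Definition regularization (phi : R -> R) (Xp Xm : R * R -> R * R) (e : R) :
    R * R -> R * R :=
  fun q => 2^-1 *: (Xp q + Xm q) + (phi (q.2 / e) / 2) *: (Xp q - Xm q).

(* [Xm] is not needed where [phi = 1], nor [Xp] where [phi = -1]. *)
Definition regularization_domain (Up Um : set (R * R)) (e : R) : set (R * R) :=
  [set q | (- e < q.2 -> Up q) /\ (q.2 < e -> Um q)].

End Filippov.

(* Main.v *)
(** Every point of [A] lies on a periodic orbit surrounding [c], so
    the component of [c] and an unbounded component of the complement of an
    orbit must be on different sides of it; this replaces the Jordan curve
    theorem.  Consequently a straight segment transversal to [Xp] meets each
    orbit at most once, nearby orbits close up after about one period, and the
    interior of an orbit is contained in [A] (otherwise the set of orbits
    surrounding a missing point would be open and closed in [A]).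

    By connectedness of [A] some orbit has minimal height 0; it touches [y = 0]
    only at the fold.  Nearby orbits are labelled by the height at which they
    cross the vertical axis at the fold, larger labels being further inside.
    The orbit through [(xe, e)] stays in [y >= e]: otherwise its lowest point is
    another tangency, and the chord between the two is a transversal crossed
    twice.  In [y >= e] the regularized field is [Xp], hence the periodicity and
    the foliation of the interior.  Where [y < e] the field is
    [(1 + phi) / 2 * Xp + (1 - phi) / 2 * Xm] with [phi < 1] and
    [det (Xp, Xm) > 0] near the fold, so it crosses the orbits of [Xp] inwards:
    the label is a Lyapunov function, and LaSalle's principle gives the
    attraction, since every orbit of smaller label dips below [y = e]. *)

(* Two sides suffice for the following reason. A component of the complement of an orbit accumulates
   at some point of the orbit, the flow carries this point to any other point of the orbit, and a
   transversal there has only two free halves. Which half is inside is then constant along the orbit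
   ([germ_transport]). This orientation turns the sign of a determinant into monotonicity of the
   label, which is a relation, continuous but never differentiated. The working regularity is a
   local Lipschitz condition, since for [p = 1] the transition function is piecewise linear. For the
   regularized field it is established on a compact band of orbits around the tangent one, so
   existence of solutions goes together with their confinement to the band. The delicate moment is
   the descent of a solution through [y = e]: there the two fields coincide and the strict increase
   has not started yet. The box [r0], the slope [K], the half-length [d] of the section and the
   radius of attraction are all fixed before [e]; small [e] only keeps [e] and [K * e] below bounds
   independent of [e]. *)
Require Import Defs.
From HB Require Import structures.
From mathcomp Require Import all_boot all_order all_algebra.
From mathcomp Require Import all_classical all_reals all_analysis.
From mathcomp Require Import ring lra.
Import Order.TTheory GRing.Theory Num.Theory.
Import numFieldNormedType.Exports.

Set Implicit Arguments.
Unset Strict Implicit.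
Unset Printing Implicit Defensive.

Local Open Scope classical_set_scope.
Local Open Scope ring_scope.

(** * Differential inequalities *)

Section RealFunctions.
Variable R : realType.
Implicit Types (f g : R -> R) (a b t : R).

(** The supremum of the initial segments on which [P] holds satisfies [P] by the limit hypothesis,
    and the step hypothesis pushes it further to the right. It serves for bounds that are valid only
    as long as they have not been violated before. *)
Lemma real_induction (P : R -> Prop) a b :
  a <= b -> P a ->
  (forall t, a <= t < b -> (forall s, a <= s <= t -> P s) ->
     exists2 d, 0 < d & forall s, t < s < t + d -> P s) ->
  (forall t, a < t <= b -> (forall s, a <= s < t -> P s) -> P t) ->
  forall t, a <= t <= b -> P t.
Proof.
move=> ab Pa step lim.
pose S := [set t | a <= t <= b /\ forall s, a <= s <= t -> P s].
have Sa : S a.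
  split; first by rewrite lexx.
  by move=> s /le_anti <-.
have Sub : has_ubound S by exists b => t [/andP[]].
have hS : has_sup S by split=> //; exists a.
have asS : a <= sup S by exact: ub_le_sup.
have sSb : sup S <= b by apply: ge_sup => // [|t [/andP[]]//]; exists a.
have below s : a <= s < sup S -> P s.
  move=> /andP[as_ ssS]; have e0 : 0 < sup S - s by rewrite subr_gt0.
  have [t [_ Pt] lt_t] := sup_adherent e0 hS.
  by apply: Pt; rewrite as_ /=; move: lt_t; rewrite subKr => /ltW.
have PsS : P (sup S).
  have [->//|aS] := eqVneq (sup S) a.
  by apply: lim; rewrite ?sSb ?andbT// lt_neqAle eq_sym aS.
have le_sup s : a <= s <= sup S -> P s.
  move=> /andP[as_]; rewrite le_eqVlt => /orP[/eqP->//|ss].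
  by apply: below; rewrite as_.
have [eb|neb] := eqVneq (sup S) b; first by rewrite -eb.
have ltb : sup S < b by rewrite lt_neqAle neb.
have [|d d0 Pd] := step _ _ le_sup; first by rewrite asS.
pose m := Num.min b (sup S + d / 2).
have m1 : sup S < m by rewrite lt_min ltb ltrDl divr_gt0.
have m2 : m < sup S + d by rewrite gt_min; apply/orP; right; rewrite ltrD2l; lra.
have : S m.
  split; first by rewrite (le_trans asS (ltW m1)) ge_min lexx.
  move=> s /andP[as_ sm]; have [sS|Ss] := leP s (sup S).
    by apply: le_sup; rewrite as_.
  by apply: Pd; rewrite Ss (le_lt_trans sm).
by move=> /(ub_le_sup Sub); rewrite leNgt m1.
Qed.

Lemma continuous_within (A : set R) f :
  (forall t, A t -> {for t, continuous f}) -> {within A, continuous f}.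
Proof. by move=> h; apply: continuous_in_subspaceT => t /set_mem /h. Qed.

Lemma is_derive_continuous (V : normedModType R) (f : R -> V) t df :
  is_derive t 1 f df -> {for t, continuous f}.
Proof.
by move=> [h _]; apply: differentiable_continuous; exact/derivable1_diffP.
Qed.

Lemma is_derive_continuous_itv f df a b :
  (forall t, a <= t <= b -> is_derive t 1 f (df t)) ->
  {within `[a, b], continuous f}.
Proof.
move=> h; apply: continuous_within => t /=; rewrite in_itv/= => /h.
exact: is_derive_continuous.
Qed.

Lemma nonincreasing_derive f df a b : a <= b ->
  (forall t, a <= t <= b -> is_derive t 1 f (df t)) ->
  (forall t, a < t < b -> df t <= 0) -> f b <= f a.
Proof.
move=> ab hf hdf; rewrite -subr_le0.
have [->|neq] := eqVneq a b; first by rewrite subrr.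
have {}ab : a < b by rewrite lt_neqAle neq.
have [t|c + ->] := @MVT R f df a b ab _ (is_derive_continuous_itv hf).
  by rewrite in_itv/= => /andP[/ltW at_ /ltW tb]; apply: hf; rewrite at_.
by rewrite in_itv/= => /hdf dc; rewrite mulr_le0_ge0 // subr_ge0 ltW.
Qed.

Lemma is_derive_expRM (C t : R) :
  is_derive t 1 (fun s : R => expR (C * s)) (C * expR (C * t)).
Proof.
have h : is_derive t 1 (fun s : R => C * s) C.
  by rewrite -[X in is_derive _ _ _ X]mulr1; exact: (is_deriveZ C (is_derive_id t 1)).
by rewrite mulrC; exact: (is_derive1_comp (is_derive_expR _) h).
Qed.

(** The growth bound is available only while [D t <= beta], as a Lipschitz constant is valid only in
    a tube. The smallness of the initial value keeps the exponential bound below [beta], so real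
    induction never loses the hypothesis; under it [D t * expR (- C * t)] is nonincreasing. *)
Lemma gronwall (D dD : R -> R) (C beta T : R) :
  0 <= C -> 0 <= D 0 ->
  (forall t, 0 <= t <= T -> is_derive t 1 D (dD t)) ->
  (forall t, 0 <= t <= T -> D t <= beta -> dD t <= C * D t) ->
  D 0 * expR (C * T) < beta ->
  forall t, 0 <= t <= T -> D t <= D 0 * expR (C * t).
Proof.
move=> C0 D0 hD hdD small.
have [T0|T0] := ltP T 0.
  by move=> t /andP[t0 tT]; have := le_lt_trans (le_trans t0 tT) T0; rewrite ltxx.
pose G := fun t => D t * expR ((- C) * t).
pose dG := fun t => D t * (- C * expR (- C * t)) + expR (- C * t) * dD t.
have hG t : 0 <= t <= T -> is_derive t 1 G (dG t).
  move=> /hD hDt; have hE := is_derive_expRM (- C) t.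
  exact: (@is_deriveM R R D _ t 1 _ _ hDt hE).
have equiv t : (D t <= D 0 * expR (C * t)) = (G t <= G 0).
  rewrite /G mulr0 expR0 mulr1 mulNr expRN.
  by rewrite ler_pdivrMr ?expR_gt0.
have bd t : 0 <= t <= T -> D 0 * expR (C * t) < beta.
  move=> /andP[t0 tT]; apply: le_lt_trans small.
  by rewrite ler_wpM2l// ler_expR ler_wpM2l.
apply: real_induction => //; first by rewrite mulr0 expR0 mulr1.
- move=> t /andP[t0 tT] ih.
  have Dt : D t < beta.
    by apply: le_lt_trans (bd t _); [apply: ih; rewrite t0 lexx|rewrite t0 ltW].
  have ct : {for t, continuous D}.
    by apply: (@is_derive_continuous _ _ _ (dD t)); apply: hD; rewrite t0 ltW.
  have : \forall s \near t, D s < beta by exact: cvgr_lt ct _ Dt.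
  move=> /nbhs_ballP[d /= d0 hd]; exists (Num.min d (T - t)).
    by rewrite lt_min d0 subr_gt0.
  move=> s /andP[ts sd]; have sT : s < T.
    by apply: lt_le_trans sd _; rewrite -lerBrDl ge_min lexx orbT.
  have std : s < t + d.
    by apply: lt_le_trans sd _; rewrite lerD2l ge_min lexx.
  rewrite equiv; apply: (@le_trans _ _ (G t)); last first.
    by rewrite -equiv ih// t0 lexx.
  apply: (@nonincreasing_derive G dG) => [|u /andP[tu us]|u /andP[tu us]].
  + exact: ltW.
  + by apply: hG; rewrite (le_trans t0 tu) (le_trans us (ltW sT)).
  + have Du : D u < beta.
      apply: hd; rewrite /ball/= ltr0_norm ?subr_lt0// opprB.
      by rewrite ltrBlDl (lt_trans us).
    have : dD u <= C * D u.
      by apply: hdD (ltW Du); rewrite (le_trans t0 (ltW tu)) (ltW (lt_trans us sT)).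
    rewrite /dG; have := expR_gt0 (- C * u); set E := expR _ => E0 h.
    have -> : D u * (- C * E) + E * dD u = E * (dD u - C * D u) by ring.
    by rewrite mulr_ge0_le0 ?subr_le0// ltW.
- move=> t /andP[t0 tT] ih.
  have ct : {for t, continuous G}.
    by apply: (@is_derive_continuous _ _ _ (dG t)); apply: hG; rewrite (ltW t0).
  rewrite equiv leNgt; apply/negP => lt.
  have : \forall s \near t, G 0 < G s by exact: cvgr_gt ct _ lt.
  move=> /nbhs_ballP[d /= d0 hd].
  pose s := Num.max 0 (t - d / 2).
  have s0 : 0 <= s by rewrite le_max lexx.
  have st : s < t by rewrite gt_max t0 gtrBl divr_gt0.
  have : G 0 < G s.
    apply: hd; rewrite /ball/= gtr0_norm ?subr_gt0// ltrBlDl -ltrBlDr.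
    by rewrite lt_max; apply/orP; right; lra.
  by rewrite ltNge -equiv ih// s0.
Qed.

End RealFunctions.

(** * Stability of planar solutions with respect to the initial point *)

Section PlanarODE.
Variable R : realType.
Implicit Types (t : R) (p q d : R * R) (u v : R -> R * R) (F : R * R -> R * R).

Lemma is_derive_cvgP (V W : normedModType R) (f : V -> W) (a v : V) (df : W) :
  is_derive a v f df <->
  (fun h : R => h^-1 *: (f (h *: v + a) - f a)) @ 0^' --> df.
Proof.
split=> [[h <-]|h]; first exact: h.
by split; [apply/cvg_ex; exists df|exact: cvg_lim].
Qed.

Lemma is_derive_fst u t d : is_derive t 1 u d -> is_derive t 1 (fst \o u) d.1.
Proof.
move=> /is_derive_cvgP h; apply/is_derive_cvgP.
rewrite (_ : (fun _ => _) = fst \o (fun h => h^-1 *: (u (h *: 1 + t) - u t)))//.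
by apply: cvg_comp h _; case: d => d1 d2; exact: cvg_fst.
Qed.

Lemma is_derive_snd u t d : is_derive t 1 u d -> is_derive t 1 (snd \o u) d.2.
Proof.
move=> /is_derive_cvgP h; apply/is_derive_cvgP.
rewrite (_ : (fun _ => _) = snd \o (fun h => h^-1 *: (u (h *: 1 + t) - u t)))//.
by apply: cvg_comp h _; case: d => d1 d2; exact: cvg_snd.
Qed.

Lemma is_derive_prod (f g : R -> R) t (df dg : R) :
  is_derive t 1 f df -> is_derive t 1 g dg ->
  is_derive t 1 (fun s => (f s, g s)) (df, dg).
Proof.
move=> /is_derive_cvgP hf /is_derive_cvgP hg; apply/is_derive_cvgP.
exact: (cvg_pair hf hg).
Qed.

Lemma normE p : `|p| = Num.max `|p.1| `|p.2|.
Proof. by []. Qed.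

Lemma norm_fst_le p : `|p.1| <= `|p|.
Proof. by rewrite normE le_max lexx. Qed.

Lemma norm_snd_le p : `|p.2| <= `|p|.
Proof. by rewrite normE le_max lexx orbT. Qed.

(** The norm on pairs is the maximum of the coordinates; this square of the Euclidean norm is a
    differentiable substitute, between once and twice the square of the former. *)
Definition sqn p : R := p.1 ^+ 2 + p.2 ^+ 2.

Lemma sqn_ge0 p : 0 <= sqn p.
Proof. by rewrite addr_ge0// sqr_ge0. Qed.

Lemma norm_sqn p : `|p| ^+ 2 <= sqn p.
Proof.
rewrite normE /sqn; case: (leP `|p.1| `|p.2|) => _; rewrite real_normK ?num_real//.
  by rewrite lerDr sqr_ge0.
by rewrite lerDl sqr_ge0.
Qed.

Lemma sqn_norm p : sqn p <= 2 * `|p| ^+ 2.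
Proof.
have h (x : R) : `|x| <= `|p| -> x ^+ 2 <= `|p| ^+ 2.
  by move=> h; rewrite -(@real_normK _ x) ?num_real// lerXn2r// nnegrE.
by rewrite mulrDl !mul1r lerD// h// ?norm_fst_le// norm_snd_le.
Qed.

(* The distance is squared so as to be differentiable. *)
Lemma ode_stability F u v (L rho T : R) :
  0 <= L -> 0 < rho ->
  (forall t, 0 <= t <= T -> is_derive t 1 u (F (u t))) ->
  (forall t, 0 <= t <= T -> is_derive t 1 v (F (v t))) ->
  (forall t p, 0 <= t <= T -> `|p - v t| <= rho ->
     `|F p - F (v t)| <= L * `|p - v t|) ->
  sqn (u 0 - v 0) * expR (4 * L * T) < rho ^+ 2 ->
  forall t, 0 <= t <= T -> sqn (u t - v t) <= sqn (u 0 - v 0) * expR (4 * L * t).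
Proof.
move=> L0 r0 hu hv lip small.
pose D := fun t => sqn (u t - v t).
pose w := fun t => F (u t) - F (v t).
pose dD := fun t => 2 * ((u t - v t).1 * (w t).1 + (u t - v t).2 * (w t).2).
apply: (@gronwall R D dD _ (rho ^+ 2)); rewrite ?mulr_ge0 ?sqn_ge0//.
  move=> t tT; have d := is_deriveB (hu t tT) (hv t tT).
  have d1 := is_derive_fst d; have d2 := is_derive_snd d.
  have := is_deriveD (is_deriveM d1 d1) (is_deriveM d2 d2).
  rewrite /GRing.scale/= => h.
  have -> : D = (fst \o (u - v)) * (fst \o (u - v)) + (snd \o (u - v)) * (snd \o (u - v)).
    by apply/funext => s; rewrite /D /sqn !expr2.
  by move: h; congr is_derive; rewrite /dD /w /=; ring.
move=> t tT Dt.
have ball : `|u t - v t| <= rho.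
  rewrite -(@ler_pXn2r _ 2)// ?nnegrE//; last exact: ltW.
  exact: le_trans (norm_sqn _) Dt.
have := lip t _ tT ball; set e := u t - v t; set n := `|e|; rewrite -/(w t) => lw.
(* Each coordinate contributes at most [L * n ^+ 2], and differentiating the squares doubles it:
   hence the rate [4 * L]. *)
have b (x y : R) : `|x| <= n -> `|y| <= L * n -> x * y <= L * n ^+ 2.
  move=> hx hy; apply: le_trans (ler_norm _) _; rewrite normrM expr2.
  by rewrite mulrA [L * n]mulrC -mulrA ler_pM.
have h1 := b e.1 (w t).1 (norm_fst_le _) (le_trans (norm_fst_le _) lw).
have h2 := b e.2 (w t).2 (norm_snd_le _) (le_trans (norm_snd_le _) lw).
have : L * n ^+ 2 <= L * D t by rewrite ler_wpM2l// norm_sqn.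
by rewrite /dD -/e; lra.
Qed.

End PlanarODE.

(** * Lipschitz fields *)

Section Lipschitz.
Variable R : realType.

Lemma near_dist_lt (V : normedModType R) (q : V) (r : R) :
  0 < r -> \forall a \near q, `|a - q| < r.
Proof.
move=> r0; apply/nbhs_ballP; exists r => // a.
by rewrite -ball_normE /= distrC.
Qed.

Lemma near_dist_le (V : normedModType R) (q : V) (r : R) :
  0 < r -> \forall a \near q, `|a - q| <= r.
Proof. by move=> /(near_dist_lt q); apply: filterS => a /ltW. Qed.

(** Local Lipschitz continuity is the regularity shared by [Xp], [Xm] and the regularized field,
    which need not be differentiable on the lines where the transition function has corners. *)
Definition lip_at (V W : normedModType R) (F : V -> W) (q : V) : Prop :=
  exists L r, [/\ 0 <= L, 0 < r &
    forall a b, `|a - q| <= r -> `|b - q| <= r -> `|F a - F b| <= L * `|a - b|].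

Lemma lip_at_continuous (V W : normedModType R) (F : V -> W) q :
  lip_at F q -> {for q, continuous F}.
Proof.
move=> [L [r [L0 r0 h]]]; have L1 : 0 < L + 1 by rewrite ltr_wpDl.
apply/cvgrPdist_lt => e e0; near=> a.
have aq : `|a - q| <= r.
  by near: a; exact: near_dist_le.
have qq : `|q - q| <= r by rewrite subrr normr0 ltW.
apply: le_lt_trans (h q a qq aq) _.
apply: (@le_lt_trans _ _ ((L + 1) * `|q - a|)).
  by rewrite ler_wpM2r// lerDl.
rewrite -ltr_pdivlMl// distrC; near: a; apply: near_dist_lt.
by rewrite mulr_gt0 ?invr_gt0.
Unshelve. all: by end_near. Qed.

(** One parameter [i] tending to infinity provides both constants, the Lipschitz constant [i] and
    the radius [i^-1], so that a single compactness argument suffices. The point [a] may leave [K],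
    as a perturbed solution does. *)
Lemma lip_compact_tube (V W : normedModType R) (F : V -> W) (K : set V) :
  compact K -> (forall q, K q -> lip_at F q) ->
  exists L rho, [/\ 0 <= L, 0 < rho &
    forall p a, K p -> `|a - p| <= rho -> `|F a - F p| <= L * `|a - p|].
Proof.
move=> /compact_near_coveringP cK lipK.
have : \forall i \near +oo, K `<=` (fun p => forall a : V, `|a - p| <= i^-1 ->
    `|F a - F p| <= i * `|a - p|).
  apply: (cK R (pinfty_nbhs R)) => q Kq.
  have [L [r [L0 r0 h]]] := lipK q Kq; near=> p i => /= a ap.
  have pq : `|p - q| <= r / 2.
    by near: p; apply: near_dist_le; rewrite divr_gt0.
  have ir : i^-1 <= r / 2.
    have i0 : 0 < i by near: i; apply: nbhs_pinfty_gt; rewrite num_real.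
    rewrite -[r / 2]invrK lef_pV2 ?posrE ?invr_gt0 ?divr_gt0//.
  have Li : L <= i by near: i; apply: nbhs_pinfty_ge; rewrite num_real.
  apply: le_trans (h a p _ _) _.
  - rewrite -(subrKA p) (splitr r); apply: le_trans (ler_normD _ _) _.
    by rewrite lerD// (le_trans ap).
  - by rewrite (le_trans pq)// ler_pdivrMr// ler_peMr ?ler1n// ltW.
  - by rewrite ler_wpM2r.
move=> h; have [i [i0 hi]] : exists i : R, 0 < i /\ (K `<=` (fun p => forall a : V, `|a - p| <= i^-1 ->
    `|F a - F p| <= i * `|a - p|)).
  near (pinfty_nbhs R) => i; exists i; split; near: i => //.
  by apply: nbhs_pinfty_gt; rewrite num_real.
exists i, i^-1; rewrite invr_gt0 ltW//; split=> // p a Kp; exact: hi.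
Unshelve. all: by end_near. Qed.

(** Pairs at distance at most [rho] are covered by the tube; for the others the bound on [F] over
    [K], divided by [rho], is a Lipschitz constant. *)
Lemma lip_compact (V W : normedModType R) (F : V -> W) (K : set V) :
  compact K -> (forall q, K q -> lip_at F q) ->
  exists2 L, 0 <= L & forall a b, K a -> K b -> `|F a - F b| <= L * `|a - b|.
Proof.
move=> cK lipK; have [L [rho [L0 rho0 h]]] := lip_compact_tube cK lipK.
have : compact (F @` K).
  apply: continuous_compact => //; apply: continuous_in_subspaceT => q /set_mem Kq.
  exact: lip_at_continuous (lipK q Kq).
move=> /compact_bounded[M [Mr hM]]; pose M' := `|M| + 1.
have bd a : K a -> `|F a| <= M'.
  move=> Ka; apply: (hM M'); last by exists a.
  by rewrite (le_lt_trans (ler_norm M))// ltrDl.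
have M'0 : 0 <= M' by rewrite addr_ge0.
have q0 : 0 <= 2 * M' / rho by rewrite divr_ge0 ?mulr_ge0// ltW.
exists (L + 2 * M' / rho) => [|a b Ka Kb]; first by rewrite addr_ge0.
have [near|far] := leP `|a - b| rho.
  by apply: le_trans (h b a Kb near) _; rewrite ler_wpM2r// lerDl.
apply: (@le_trans _ _ (2 * M')).
  by apply: le_trans (ler_normB _ _) _; rewrite mulrDl mul1r lerD// bd.
apply: (@le_trans _ _ (2 * M' / rho * `|a - b|)); last first.
  by rewrite ler_wpM2r// lerDr.
by rewrite mulrAC ler_pdivlMr// ler_wpM2l ?mulr_ge0// ltW.
Qed.

(** The extension at [q] is the infimum over [w] in [K] of [f w] plus [L] times the distance from
    [q] to [w]; an infimum of functions of Lipschitz constant [L] keeps this constant. *)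
Lemma mcshane (V : normedModType R) (f : V -> R) (K : set V) (L : R) :
  K !=set0 -> 0 <= L ->
  (forall a b, K a -> K b -> `|f a - f b| <= L * `|a - b|) ->
  exists2 g : V -> R, forall a b, `|g a - g b| <= L * `|a - b| &
    forall a, K a -> g a = f a.
Proof.
move=> [w0 Kw0] L0 lf.
pose S q := [set f w + L * `|q - w| | w in K].
have S0 q : S q !=set0 by exists (f w0 + L * `|q - w0|); exists w0.
have lb q w w' : K w -> K w' -> f w - L * `|q - w| <= f w' + L * `|q - w'|.
  move=> Kw Kw'; rewrite lerBlDr -addrA -mulrDr -lerBlDl.
  apply: le_trans (ler_norm _) _; apply: le_trans (lf _ _ Kw Kw') _.
  rewrite ler_wpM2l//; rewrite -(subrKA q) [`|q - w'| + _]addrC.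
  by apply: le_trans (ler_normD _ _) _; rewrite [`|w - q|]distrC.
have Slb q : has_lbound (S q).
  by exists (f w0 - L * `|q - w0|) => _ [w Kw <-]; exact: lb.
have half a b : inf (S a) <= inf (S b) + L * `|a - b|.
  rewrite -lerBlDr; apply: lb_le_inf => // _ [w Kw <-].
  rewrite lerBlDr; apply: (@le_trans _ _ (f w + L * `|a - w|)).
    by apply: ge_inf => //; exists w.
  rewrite -addrA lerD2l -mulrDr ler_wpM2l// -(subrKA b) addrC.
  by rewrite [leRHS]addrC (le_trans (ler_normD _ _))// addrC.
exists (fun q => inf (S q)) => [a b|a Ka].
  rewrite ler_norml lerBlDl half andbT lerNl opprB lerBlDl.
  by rewrite [`|a - b|]distrC half.
apply/eqP; rewrite eq_le; apply/andP; split.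
  apply: le_trans (ge_inf (Slb a) _) _; first by exists a => //.
  by rewrite subrr normr0 mulr0 addr0.
apply: lb_le_inf => // _ [w Kw <-].
by have := lb a a w Ka Kw; rewrite subrr normr0 mulr0 subr0.
Qed.

Lemma mcshane_pair (V : normedModType R) (F : V -> R * R) (K : set V) (L : R) :
  K !=set0 -> 0 <= L ->
  (forall a b, K a -> K b -> `|F a - F b| <= L * `|a - b|) ->
  exists2 G : V -> R * R, forall a b, `|G a - G b| <= L * `|a - b| &
    forall a, K a -> G a = F a.
Proof.
move=> K0 L0 lF.
have [a b Ka Kb|g1 l1 e1] := @mcshane _ (fst \o F) K L K0 L0.
  by apply: le_trans (lF a b Ka Kb); exact: (norm_fst_le (F a - F b)).
have [a b Ka Kb|g2 l2 e2] := @mcshane _ (snd \o F) K L K0 L0.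
  by apply: le_trans (lF a b Ka Kb); exact: (norm_snd_le (F a - F b)).
exists (fun a => (g1 a, g2 a)) => [a b|a Ka].
  by rewrite normE ge_max/= l1 l2.
by rewrite e1// e2//=; case: (F a).
Qed.

End Lipschitz.

(** * Local Lipschitz bounds for functions with continuous partial derivatives *)

Section C1.
Variable R : realType.
Implicit Types (f : R * R -> R) (U : set (R * R)).

Lemma is_derive_row f (x y : R) : derivable f (x, y) (1, 0) ->
  is_derive x 1 (fun s => f (s, y)) ('D_(1, 0) f (x, y)).
Proof.
move=> /derivableP /is_derive_cvgP h; apply/is_derive_cvgP.
apply: cvg_trans h; apply: near_eq_cvg; near=> s.
by rewrite /GRing.scale/= /GRing.add/= /add_pair/= /GRing.scale/= mulr0 add0r.
Unshelve. all: by end_near. Qed.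

Lemma is_derive_col f (x y : R) : derivable f (x, y) (0, 1) ->
  is_derive y 1 (fun s => f (x, s)) ('D_(0, 1) f (x, y)).
Proof.
move=> /derivableP /is_derive_cvgP h; apply/is_derive_cvgP.
apply: cvg_trans h; apply: near_eq_cvg; near=> s.
by rewrite /GRing.scale/= /GRing.add/= /add_pair/= /GRing.scale/= mulr0 add0r.
Unshelve. all: by end_near. Qed.


Lemma Ck_onS k U f : Ck_on k.+1 U f -> forall q, U q ->
  [/\ derivable f q (1, 0), derivable f q (0, 1),
      {for q, continuous ('D_(1, 0) f)} & {for q, continuous ('D_(0, 1) f)}].
Proof.
move=> [_ h] q Uq; have [d1 c1] := h (1, 0) (or_introl erefl).
have [d2 c2] := h (0, 1) (or_intror erefl).
have ck g : Ck_on k U g -> {for q, continuous g} by case: k {h c1 c2} => [|k] [+ _]; apply.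
by split; [exact: d1|exact: d2|exact: ck|exact: ck].
Qed.

Lemma mvt_row k U f (a b y : R) : Ck_on k.+1 U f -> a <= b ->
  (forall s, a <= s <= b -> U (s, y)) ->
  exists2 c, a <= c <= b & f (b, y) - f (a, y) = 'D_(1, 0) f (c, y) * (b - a).
Proof.
move=> h ab hU.
have d s : a <= s <= b -> is_derive s 1 (fun s => f (s, y)) ('D_(1, 0) f (s, y)).
  by move=> /hU /(Ck_onS h)[d _ _ _]; exact: is_derive_row.
have [s|c + e] := @MVT_segment R _ (fun s => 'D_(1, 0) f (s, y)) a b ab _ (is_derive_continuous_itv d).
  by rewrite in_itv/= => /andP[/ltW as_ /ltW sb]; apply: d; rewrite as_.
by rewrite in_itv/=; exists c.
Qed.

Lemma mvt_col k U f (x a b : R) : Ck_on k.+1 U f -> a <= b ->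
  (forall s, a <= s <= b -> U (x, s)) ->
  exists2 c, a <= c <= b & f (x, b) - f (x, a) = 'D_(0, 1) f (x, c) * (b - a).
Proof.
move=> h ab hU.
have d s : a <= s <= b -> is_derive s 1 (fun s => f (x, s)) ('D_(0, 1) f (x, s)).
  by move=> /hU /(Ck_onS h)[_ d _ _]; exact: is_derive_col.
have [s|c + e] := @MVT_segment R _ (fun s => 'D_(0, 1) f (x, s)) a b ab _ (is_derive_continuous_itv d).
  by rewrite in_itv/= => /andP[/ltW as_ /ltW sb]; apply: d; rewrite as_.
by rewrite in_itv/=; exists c.
Qed.

Lemma norm_le_pair (p q : R * R) (r : R) :
  (`|p - q| <= r) = (`|p.1 - q.1| <= r) && (`|p.2 - q.2| <= r).
Proof. by rewrite normE ge_max. Qed.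

Lemma near_norm_le (V : normedModType R) (q : V) (P : set V) :
  (\forall a \near q, P a) ->
  exists2 r : R, 0 < r & forall a, `|a - q| <= r -> P a.
Proof.
move=> /nbhs_ballP[r /= r0 h]; exists (r / 2) => [|a aq]; first by rewrite divr_gt0.
apply: h; rewrite -ball_normE /= distrC (le_lt_trans aq)//.
by rewrite ltr_pdivrMr// ltr_pMr// ltr1n.
Qed.

Lemma dist_itv (r s u v q : R) : u <= s <= v -> `|u - q| <= r -> `|v - q| <= r ->
  `|s - q| <= r.
Proof. by rewrite !ler_norml; lra. Qed.

(** The mean value theorem is applied along a horizontal and then a vertical segment. The corner
    between them stays in the ball because balls of the maximum norm are squares. *)
Lemma C1_lip_at k U f q : open U -> Ck_on k.+1 U f -> U q -> lip_at f q.
Proof.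
move=> oU h Uq; have [_ _ c1 c2] := Ck_onS h Uq.
pose D1 := 'D_(1, 0) f; pose D2 := 'D_(0, 1) f.
pose M := `|D1 q| + `|D2 q| + 1.
have M0 : 0 <= M by rewrite !addr_ge0.
have nearM (D : R * R -> R) : `|D q| < M -> {for q, continuous D} ->
    \forall a \near q, `|D a| <= M.
  move=> DM cD; have : \forall a \near q, `|D a| < M.
    exact: (cvgr_lt (f := fun a => `|D a|) `|D q| (cvg_norm cD)).
  by apply: filterS => a /ltW.
have m1 : `|D1 q| < M by rewrite /M -addrA ltrDl ltr_wpDl.
have m2 : `|D2 q| < M by rewrite /M addrAC ltrDr ltr_wpDl.
have nU : \forall a \near q, U a by exact: open_nbhs_nbhs.
have [r r0 hr] := near_norm_le (filterI nU (filterI (nearM _ m1 c1) (nearM _ m2 c2))).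
have row (a b y : R) : `|(a, y) - q| <= r -> `|(b, y) - q| <= r ->
    `|f (b, y) - f (a, y)| <= M * `|b - a|.
  wlog ab : a b / a <= b => [hw|] ha hb.
    have [/hw|/ltW/hw] := leP a b; first exact.
    by move=> /(_ hb ha); rewrite distrC [`|a - b|]distrC.
  have B s : a <= s <= b -> `|(s, y) - q| <= r.
    move: ha hb; rewrite !norm_le_pair/= => /andP[ha ->] /andP[hb _] sab.
    by rewrite (dist_itv sab).
  have [|c /B/hr[_ [hM _]] ->] := mvt_row (y := y) h ab; first by move=> s /B/hr[].
  by rewrite normrM ler_wpM2r.
have col (x a b : R) : `|(x, a) - q| <= r -> `|(x, b) - q| <= r ->
    `|f (x, b) - f (x, a)| <= M * `|b - a|.
  wlog ab : a b / a <= b => [hw|] ha hb.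
    have [/hw|/ltW/hw] := leP a b; first exact.
    by move=> /(_ hb ha); rewrite distrC [`|a - b|]distrC.
  have B s : a <= s <= b -> `|(x, s) - q| <= r.
    move: ha hb; rewrite !norm_le_pair/= => /andP[-> ha] /andP[_ hb] sab.
    by rewrite (dist_itv sab).
  have [|c /B/hr[_ [_ hM]] ->] := mvt_col (x := x) h ab; first by move=> s /B/hr[].
  by rewrite normrM ler_wpM2r.
exists (2 * M), r; split=> // [|[a1 a2] [b1 b2] ha hb]; first by rewrite mulr_ge0.
have hm : `|(b1, a2) - q| <= r.
  by move: ha hb; rewrite !norm_le_pair/= => /andP[_ ->] /andP[-> _].
have h1 := row _ _ _ hm ha; have h2 := col _ _ _ hb hm.
rewrite -(subrKA (f (b1, a2))); apply: le_trans (ler_normD _ _) _.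
have n1 := norm_fst_le ((a1, a2) - (b1, b2)); have n2 := norm_snd_le ((a1, a2) - (b1, b2)).
rewrite mulrDl mul1r mulrDl lerD//.
  by apply: le_trans h1 _; rewrite ler_wpM2l.
by apply: le_trans h2 _; rewrite ler_wpM2l.
Qed.

Lemma lip_at_pair (V : normedModType R) (F : V -> R * R) q :
  lip_at (fun a => (F a).1) q -> lip_at (fun a => (F a).2) q -> lip_at F q.
Proof.
move=> [L1 [r1 [L10 r10 h1]]] [L2 [r2 [L20 r20 h2]]].
exists (L1 + L2), (Num.min r1 r2); rewrite lt_min r10 addr_ge0//; split=> // a b.
rewrite !le_min => /andP[a1 a2] /andP[b1 b2]; rewrite normE ge_max.
by rewrite (le_trans (h1 a b _ _))//= ?(le_trans (h2 a b _ _))//= ler_wpM2r// ?lerDr// lerDl.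
Qed.

End C1.

(** * Existence of solutions *)

Section Picard.
Variable R : realType.
Implicit Types (s t x : R).

Lemma is_derive_derive1 (f : R -> R) t (d : R) :
  derivable f t 1 -> derive1 f t = d -> is_derive t 1 f d.
Proof. by move=> h e; split; rewrite // -derive1E. Qed.

Lemma antiderivative (v : R -> R) : continuous v ->
  exists2 V : R -> R, V 0 = 0 & forall t, 0 <= t -> is_derive t 1 V (v t).
Proof.
move=> cv; pose mu := @lebesgue_measure R.
(* Integrating from -1 makes 0 an interior point, so the derivative at 0 is two-sided. *)
pose I t := (\int[mu]_(x in [set` `[(-1 : R), t]]) (v x))%R.
exists (fun t => I t - I 0) => [|t t0]; first by rewrite subrr.
have tt1 : t < t + 1 by rewrite ltrDl.
have int : mu.-integrable `[-1, t + 1] (EFin \o v).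
  apply: continuous_compact_integrable; first exact: segment_compact.
  exact: continuous_subspaceT.
have t1 : -1 < t by rewrite (lt_le_trans _ t0)// ltrN10.
have [dI eI] := continuous_FTC1_closed tt1 int t1 (cv t).
have hI : is_derive t 1 I (v t) := is_derive_derive1 dI eI.
by rewrite -[v t]subr0; exact: is_deriveB hI (is_derive_cst (I 0) t 1).
Qed.

Lemma antiderivative_pair (v : R -> R * R) (q : R * R) : continuous v ->
  exists2 V : R -> R * R, V 0 = q & forall t, 0 <= t -> is_derive t 1 V (v t).
Proof.
move=> cv; have [t|V1 e1 h1] := @antiderivative (fst \o v).
  by apply: cvg_comp (cv t) _ => /=; case: (v t) => a b; exact: cvg_fst.
have [t|V2 e2 h2] := @antiderivative (snd \o v).
  by apply: cvg_comp (cv t) _ => /=; case: (v t) => a b; exact: cvg_snd.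
exists (fun t => (V1 t + q.1, V2 t + q.2)) => [|t t0].
  by rewrite e1 e2 !add0r; case: q.
rewrite (surjective_pairing (v t)); apply: is_derive_prod.
  rewrite -[(v t).1]addr0; exact: is_deriveD (h1 t t0) (is_derive_cst q.1 t 1).
rewrite -[(v t).2]addr0; exact: is_deriveD (h2 t t0) (is_derive_cst q.2 t 1).
Qed.

(** Applied with rate [2 * L] to the difference of two iterates of an [L]-Lipschitz field, the
    division by the rate gains a factor 1/2: this is the contraction of Picard iteration in the
    weighted norm. *)
Lemma exp_growth (f df : R -> R) (C L t : R) : 0 <= C -> 0 < L -> 0 <= t -> f 0 = 0 ->
  (forall s, 0 <= s -> is_derive s 1 f (df s)) ->
  (forall s, 0 <= s -> df s <= C * expR (L * s)) ->
  f t <= C / L * expR (L * t).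
Proof.
move=> C0 L0 t0 f0 hf hdf.
pose g := fun s => f s - C / L * expR (L * s).
have hg s : 0 <= s <= t -> is_derive s 1 g (df s - C / L * (L * expR (L * s))).
  move=> /andP[s0 _].
  exact: (is_deriveB (hf s s0) (is_deriveZ (C / L) (is_derive_expRM L s))).
rewrite -subr_le0; apply: (@le_trans _ _ (g 0)).
  apply: nonincreasing_derive t0 hg _ => s /andP[/ltW s0 _].
  by rewrite subr_le0 mulrA divfK ?gt_eqF// hdf.
by rewrite /g f0 sub0r oppr_le0 !mulr_ge0 ?expR_ge0// invr_ge0 ltW.
Qed.

Lemma exp_growth_norm (f df : R -> R * R) (C L t : R) :
  0 <= C -> 0 < L -> 0 <= t -> f 0 = 0 ->
  (forall s, 0 <= s -> is_derive s 1 f (df s)) ->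
  (forall s, 0 <= s -> `|df s| <= C * expR (L * s)) ->
  `|f t| <= C / L * expR (L * t).
Proof.
move=> C0 L0 t0 f0 hf hdf.
have comp (g dg : R -> R) : g 0 = 0 -> (forall s, 0 <= s -> is_derive s 1 g (dg s)) ->
    (forall s, 0 <= s -> `|dg s| <= C * expR (L * s)) ->
    `|g t| <= C / L * expR (L * t).
  move=> g0 hg hdg; rewrite ler_norml lerNl; apply/andP; split; last first.
    apply: exp_growth hg _ => // s s0.
    exact: le_trans (ler_norm _) (hdg s s0).
  apply: (@exp_growth (- g) (fun s => - dg s)) => // [|s s0|s s0].
  - by rewrite fctE g0 oppr0.
  - by apply: is_deriveN; exact: hg.
  - by apply: le_trans (ler_norm _) _; rewrite normrN; exact: hdg.
rewrite normE ge_max; apply/andP; split.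
  apply: (@comp (fst \o f) (fst \o df)) => [|s s0|s s0]; first by rewrite /= f0.
    exact: is_derive_fst (hf s s0).
  exact: le_trans (norm_fst_le _) (hdf s s0).
apply: (@comp (snd \o f) (snd \o df)) => [|s s0|s s0]; first by rewrite /= f0.
  exact: is_derive_snd (hf s s0).
exact: le_trans (norm_snd_le _) (hdf s s0).
Qed.

(** The intervals of radius [2 * B / 2 ^+ n] around [a n] are nested, so the supremum of their lower
    ends lies in all of them. *)
Lemma geometric_limit (a : nat -> R) (B : R) :
  (forall n, `|a n.+1 - a n| <= B / 2 ^+ n) ->
  exists l, forall n, `|l - a n| <= 2 * B / 2 ^+ n.
Proof.
move=> h; have B0 : 0 <= B.
  by have := le_trans (normr_ge0 _) (h 0%N); rewrite expr0 divr1.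
pose lo n := a n - 2 * B / 2 ^+ n; pose hi n := a n + 2 * B / 2 ^+ n.
have eS n : 2 * B / 2 ^+ n.+1 = B / 2 ^+ n.
  by rewrite exprS invfM; field; rewrite expf_neq0.
have dbl n : 2 * B / 2 ^+ n = B / 2 ^+ n + B / 2 ^+ n by rewrite -mulrA mulrDl !mul1r.
have loS n : lo n <= lo n.+1.
  by rewrite /lo eS dbl; have := h n; rewrite ler_norml => /andP[h1 h2]; lra.
have hiS n : hi n.+1 <= hi n.
  by rewrite /hi eS dbl; have := h n; rewrite ler_norml => /andP[h1 h2]; lra.
have loM n k : lo n <= lo (n + k)%N.
  by elim: k => [|k ih]; rewrite ?addn0// addnS (le_trans ih).
have hiM n k : hi (n + k)%N <= hi n.
  by elim: k => [|k ih]; rewrite ?addn0// addnS (le_trans _ ih).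
have lohi n m : lo n <= hi m.
  have e0 : 0 <= 2 * B / 2 ^+ (n + m) by rewrite divr_ge0 ?mulr_ge0// exprn_ge0.
  apply: le_trans (loM n m) _; apply: le_trans (hiM m n); rewrite addnC /lo /hi.
  by rewrite [(m + n)%N]addnC; lra.
have S0 : range lo !=set0 by exists (lo 0%N), 0%N.
exists (sup (range lo)) => n; rewrite ler_norml.
have h1 : lo n <= sup (range lo).
  by apply: ub_le_sup; [exists (hi 0%N) => _ [m _ <-]|exists n].
have h2 : sup (range lo) <= hi n by apply: ge_sup => // _ [m _ <-].
by move: h1 h2; rewrite /lo /hi; lra.
Qed.

Lemma geometric_limit_pair (a : nat -> R * R) (B : R) :
  (forall n, `|a n.+1 - a n| <= B / 2 ^+ n) ->
  exists l, forall n, `|l - a n| <= 2 * B / 2 ^+ n.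
Proof.
move=> h.
have [n|l1 h1] := @geometric_limit (fun n => (a n).1) B.
  exact: le_trans (norm_fst_le (a n.+1 - a n)) (h n).
have [n|l2 h2] := @geometric_limit (fun n => (a n).2) B.
  exact: le_trans (norm_snd_le (a n.+1 - a n)) (h n).
by exists (l1, l2) => n; rewrite normE ge_max/= h1 h2.
Qed.

Lemma geometric_le0 (x B : R) : (forall n, x <= B / 2 ^+ n) -> x <= 0.
Proof.
move=> h; rewrite leNgt; apply/negP => x0.
have [n] : exists n : nat, B / x < n%:R.
  by exists (Num.truncn (B / x)).+1; exact: truncnS_gt.
have := h n; rewrite ler_pdivlMr ?exprn_gt0// => hB.
rewrite ltr_pdivrMr// => /(le_lt_trans hB); rewrite mulrC ltr_pM2r//.
by rewrite -natrX ltr_nat ltnNge ltnW// ltn_expl.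
Qed.

(* The weight [expR (2 * L * t)] makes the iteration contract on the whole
   half-line, so that no local solutions have to be glued; freezing negative
   times at 0 makes the derivative at 0 two-sided. *)
Theorem picard (F : R * R -> R * R) (L : R) (q : R * R) :
  0 < L -> (forall a b, `|F a - F b| <= L * `|a - b|) ->
  exists2 u : R -> R * R, u 0 = q &
    forall t, 0 <= t -> is_derive t 1 u (F (u t)).
Proof.
move=> L0 lF.
have cF : continuous F.
  by move=> a; apply: lip_at_continuous; exists L, 1; rewrite ltW//; split=> // x y _ _; exact: lF.
pose cut (t : R) := Num.max t 0.
have cut0 t : 0 <= cut t by rewrite le_max lexx orbT.
have cutE t : 0 <= t -> cut t = t by rewrite /cut => /max_idPl.
have ccut : continuous cut by move=> t; apply: continuous_max; [exact: cvg_id|exact: cvg_cst].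
have [J JP] : {J : (R -> R * R) -> R -> R * R | forall v, continuous v ->
    J v 0 = q /\ forall t, 0 <= t -> is_derive t 1 (J v) (v t)}.
  suff /choice[J hJ] : forall v : R -> R * R, exists V : R -> R * R, continuous v ->
      V 0 = q /\ forall t, 0 <= t -> is_derive t 1 V (v t) by exists J.
  move=> v; have [cv|ncv] := pselect (continuous v); last by exists v.
  by have [V V0 hV] := antiderivative_pair q cv; exists V.

pose it := fix it (n : nat) : R -> R * R :=
  if n is n'.+1 then J (F \o it n' \o cut) else cst q.
have cit n : continuous (F \o it n \o cut) /\ it n 0 = q /\
    exists2 d, forall t, 0 <= t -> is_derive t 1 (it n) (d t) & True.
  have cc n' : (forall t, 0 <= t -> {for t, continuous (it n')}) -> continuous (F \o it n' \o cut).
    move=> h t; apply: (continuous_comp (ccut t)).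
    by apply: continuous_comp; [exact: h|exact: cF].
  elim: n => [|n [cn [_ _]]].
    split; first by apply: cc => t _; exact: cst_continuous.
    by split=> //; exists (cst 0) => // t _; exact: is_derive_cst.
  have [e0 d0] := JP _ cn; split; last by split=> //; exists (F \o it n \o cut).
  by apply: cc => t /d0; exact: is_derive_continuous.
have itS n t : 0 <= t -> is_derive t 1 (it n.+1) (F (it n t)).
  by move=> t0; have [_ /(_ t t0)] := JP _ (cit n).1; rewrite /= cutE.
have it0 n : it n 0 = q := (cit n).2.1.
have hit n : exists2 d, forall t, 0 <= t -> is_derive t 1 (it n) (d t) & True.
  by case: (cit n) => _ [].
have L20 : 0 < 2 * L by rewrite mulr_gt0.
pose A := `|F q| / (2 * L).
have A0 : 0 <= A by rewrite divr_ge0// ltW.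
have pn n : 0 <= A / 2 ^+ n by rewrite divr_ge0// exprn_ge0.
have step n t : 0 <= t -> `|it n.+1 t - it n t| <= A / 2 ^+ n * expR (2 * L * t).
  elim: n t => [|n ih] t t0.
    rewrite expr0 divr1.
    apply: (@exp_growth_norm (it 1%N - it 0%N) (fun s => F (it 0%N s) - 0)) => //.
    - by rewrite fctE !it0 subrr.
    - by move=> s s0; exact: is_deriveB (itS 0%N s s0) (is_derive_cst q s 1).
    - move=> s s0; rewrite subr0 /= /cst ler_peMr//.
      have := expR_ge1Dx (2 * L * s); apply: le_trans; rewrite lerDl.
      by rewrite mulr_ge0// ltW.
  have -> : A / 2 ^+ n.+1 = L * (A / 2 ^+ n) / (2 * L).
    rewrite exprS; field.
    by rewrite expf_neq0// gt_eqF.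
  apply: (@exp_growth_norm (it n.+2 - it n.+1) (fun s => F (it n.+1 s) - F (it n s))) => //.
  - by rewrite mulr_ge0// ltW.
  - by change (it n.+2 0 - it n.+1 0 = 0); rewrite (it0 n.+2) (it0 n.+1) subrr.
  - by move=> s s0; exact: is_deriveB (itS n.+1 s s0) (itS n s s0).
  - by move=> s s0; rewrite -mulrA (le_trans (lF _ _))// ler_wpM2l ?ih// ltW.
have /choice[w hw] : forall t, exists l, forall n,
    `|l - it n (cut t)| <= 2 * (A * expR (2 * L * cut t)) / 2 ^+ n.
  move=> t; apply: geometric_limit_pair => n.
  by rewrite mulrAC step.
have cw : continuous w.
  move=> t; apply/cvgrPdist_lt => e e0.
  pose M := A * expR (2 * L * (cut t + 1)).
  have M0 : 0 <= M by rewrite mulr_ge0// expR_ge0.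
  have [n hn] : exists n : nat, 2 * M / 2 ^+ n < e / 3.
    apply: contrapT => /forallNP h.
    have : e / 3 <= 0.
      by apply: (@geometric_le0 _ (2 * M)) => n; rewrite leNgt; apply/negP; exact: h.
    by rewrite leNgt divr_gt0.
  have close s : cut s <= cut t + 1 -> `|w s - it n (cut s)| < e / 3.
    move=> hs; apply: le_lt_trans (hw s n) _; apply: le_lt_trans hn.
    rewrite ler_wpM2r ?invr_ge0 ?exprn_ge0// ler_wpM2l// ler_wpM2l// ler_expR.
    by rewrite ler_wpM2l// ltW.
  have cn : {for t, continuous (it n \o cut)}.
    apply: continuous_comp; first exact: ccut.
    by have [d hd _] := hit n; exact: is_derive_continuous (hd _ (cut0 t)).
  near=> s.
  have h1 : `|w s - it n (cut s)| < e / 3.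
    apply: close; apply: ltW; near: s.
    by apply: (cvgr_lt (cut t) (ccut t)); rewrite ltrDl.
  have h2 : `|w t - it n (cut t)| < e / 3 by apply: close; rewrite lerDl.
  have h3 : `|it n (cut t) - it n (cut s)| < e / 3.
    by near: s; move/cvgrPdist_lt: cn; apply; rewrite divr_gt0.
  rewrite -(subrKA (it n (cut t))) -[X in _ + X](subrKA (it n (cut s))).
  apply: le_lt_trans (ler_normD _ _) _.
  have := ler_normD (it n (cut t) - it n (cut s)) (it n (cut s) - w s).
  by rewrite [`|it n (cut s) - w s|]distrC; lra.
have cFw : continuous (F \o w) by move=> t; apply: continuous_comp; [exact: cw|exact: cF].
have [V V0 hV] := antiderivative_pair q cFw.
(* The limit [w] is so far only continuous. The antiderivative [V] of [F \o w] is within a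
   geometrically small distance of the iterates too, hence equals [w], and this makes [w]
   differentiable with derivative [F \o w]. *)
have Vw t : 0 <= t -> V t = w t.
  move=> t0; apply/eqP; rewrite -subr_eq0 -normr_le0.
  apply: (@geometric_le0 _ (2 * A * expR (2 * L * t))) => n.
  have h1 : `|V t - it n.+1 t| <= L * (2 * A / 2 ^+ n) / (2 * L) * expR (2 * L * t).
    apply: (@exp_growth_norm (V - it n.+1) (fun s => F (w s) - F (it n s))) => //.
    - by rewrite !mulr_ge0// ?invr_ge0 ?exprn_ge0// ltW.
    - by change (V 0 - it n.+1 0 = 0); rewrite (it0 n.+1) V0 subrr.
    - by move=> s s0; exact: is_deriveB (hV s s0) (itS n s s0).
    - move=> s s0; rewrite -mulrA (le_trans (lF _ _))// ler_wpM2l//; first exact: ltW.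
      by have := hw s n; rewrite cutE// mulrA mulrAC.
  have h2 := hw t n.+1; rewrite cutE// in h2.
  rewrite -(subrKA (it n.+1 t)); apply: le_trans (ler_normD _ _) _.
  rewrite [`|_ - w t|]distrC; apply: le_trans (lerD h1 h2) _.
  rewrite le_eqVlt; apply/orP; left; apply/eqP; rewrite exprS; field.
  by rewrite expf_neq0// gt_eqF.
exists V => // t t0; rewrite (Vw t t0); exact: hV.
Unshelve. all: by end_near. Qed.

End Picard.

(** * The flow of a center *)

Section Flow.
Variable R : realType.
Implicit Types (s t T : R) (p q : R * R) (u v : R -> R * R) (F X : R * R -> R * R).

Lemma is_derive_comp_pair u (h : R -> R) t (dh : R) (du : R * R) :
  is_derive (h t) 1 u du -> is_derive t 1 h dh ->
  is_derive t 1 (u \o h) (du.1 * dh, du.2 * dh).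
Proof.
move=> hu hh; rewrite (_ : u \o h = fun s => ((fst \o u \o h) s, (snd \o u \o h) s)).
  by apply: is_derive_prod; apply: is_derive1_comp hh; [exact: is_derive_fst|exact: is_derive_snd].
by apply/funext => s /=; rewrite -surjective_pairing.
Qed.

Lemma is_derive_shiftr u t s (d : R * R) :
  is_derive (t + s) 1 u d -> is_derive t 1 (fun x => u (x + s)) d.
Proof.
move=> h; have hh : is_derive t 1 (fun x => x + s) 1.
  by rewrite -[X in is_derive _ _ _ X]addr0; exact: is_deriveD (is_derive_id t 1) (is_derive_cst s t 1).
by have := @is_derive_comp_pair u (fun x => x + s) t 1 d h hh; rewrite !mulr1 -surjective_pairing.
Qed.

Lemma is_derive_reflect u t (d : R * R) :
  is_derive (- t) 1 u d -> is_derive t 1 (fun x => u (- x)) (- d).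
Proof.
move=> h; have hh : is_derive t 1 (fun x : R => - x) (- 1).
  exact: is_deriveN (is_derive_id t 1).
have := @is_derive_comp_pair u (fun x => - x) t (-1) d h hh; rewrite !mulrN1.
by rewrite (_ : (- d.1, - d.2) = - d)//; case: d {h}.
Qed.

Lemma sqn_eq0 p : sqn p <= 0 -> p = 0.
Proof.
move=> h; apply/eqP; rewrite -normr_eq0 -sqrf_eq0 eq_le sqr_ge0 andbT.
exact: le_trans (norm_sqn p) h.
Qed.

(** The Lipschitz condition is required along the reference solution [v] only; compactness of its
    arc gives a tube, and [ode_stability] keeps every nearby solution in it. *)
Lemma ode_dependence F v T : 0 <= T ->
  (forall t, 0 <= t <= T -> is_derive t 1 v (F (v t))) ->
  (forall t, 0 <= t <= T -> lip_at F (v t)) ->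
  exists C rho, [/\ 0 <= C, 0 < rho & forall u,
    (forall t, 0 <= t <= T -> is_derive t 1 u (F (u t))) ->
    `|u 0 - v 0| <= rho ->
    forall t, 0 <= t <= T -> `|u t - v t| <= C * `|u 0 - v 0|].
Proof.
move=> T0 hv lip.
have cK : compact (v @` `[0, T]).
  apply: continuous_compact; last exact: segment_compact.
  apply: continuous_in_subspaceT => t /set_mem/=; rewrite in_itv/= => /hv.
  exact: is_derive_continuous.
have [_ [t + <-]|L [r [L0 r0 tube]]] := lip_compact_tube (F := F) cK.
  by rewrite /= in_itv/= => /lip.
pose E := expR (4 * L * T).
have E1 : 1 <= E by have := expR_ge1Dx (4 * L * T); apply: le_trans; rewrite lerDl !mulr_ge0.
have E0 : 0 < E by exact: expR_gt0.
(* With [d] the initial distance, the squared error is at most [2 * d ^+ 2 * E], hence at most half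
   the square of [2 * E * d] as [1 <= E]; the spare half gives the strict inequality required by
   [ode_stability]. *)
exists (2 * E), (r / (2 * E)); split; [by rewrite mulr_ge0// ltW|by rewrite divr_gt0// mulr_gt0|].
move=> u hu; set d := `|u 0 - v 0| => hd.
have dE : 2 * E * d <= r by move: hd; rewrite ler_pdivlMr ?mulr_gt0// mulrC.
have d0 : 0 <= d := normr_ge0 _.
have sq : sqn (u 0 - v 0) * E <= (2 * E * d) ^+ 2 / 2.
  apply: (@le_trans _ _ (2 * d ^+ 2 * E)); first by rewrite ler_wpM2r ?sqn_norm// ltW.
  rewrite (_ : (2 * E * d) ^+ 2 / 2 = 2 * d ^+ 2 * E * E); last by field.
  by rewrite ler_peMr// !mulr_ge0// ?exprn_ge0// ltW.
move=> t tT; have := @ode_stability R F u v L r T L0 r0 hu hv _ _ t tT.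
rewrite -/E => h; rewrite -(@ler_pXn2r _ 2)// ?nnegrE//; last first.
  by rewrite !mulr_ge0// ltW.
apply: le_trans (norm_sqn _) _.
apply: (@le_trans _ _ (sqn (u 0 - v 0) * E)); last first.
  by apply: le_trans sq _; rewrite ler_pdivrMr// ler_peMr ?sqr_ge0// ler1n.
apply: le_trans (h _ _) _.
- move=> s p sT; apply: tube; exists s => //=; by rewrite in_itv.
- apply: le_lt_trans sq _; rewrite ltr_pdivrMr//.
  apply: (@le_lt_trans _ _ (r ^+ 2)).
    by rewrite lerXn2r// nnegrE ?(ltW r0)// !mulr_ge0// ltW.
  by rewrite ltr_pMr ?exprn_gt0// ltr1n.
- rewrite ler_wpM2l ?sqn_ge0// ler_expR ler_wpM2l ?mulr_ge0//.
  by case/andP: tT.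
Qed.

Lemma ode_unique F u v T :
  (forall t, 0 <= t <= T -> is_derive t 1 u (F (u t))) ->
  (forall t, 0 <= t <= T -> is_derive t 1 v (F (v t))) ->
  (forall t, 0 <= t <= T -> lip_at F (v t)) -> u 0 = v 0 ->
  forall t, 0 <= t <= T -> u t = v t.
Proof.
move=> hu hv lip e t /andP[t0 tT].
have [C [r [C0 r0 h]]] := ode_dependence (le_trans t0 tT) hv lip.
have := h u hu; rewrite e subrr normr0 mulr0 => /(_ (ltW r0) t).
by rewrite t0 tT normr_le0 subr_eq0 => /(_ isT) /eqP.
Qed.

Lemma lip_at_opp (V : normedModType R) (F : V -> R * R) (q : V) : lip_at F q -> lip_at (fun p : V => - F p) q.
Proof.
move=> [L [r [L0 r0 h]]]; exists L, r; split=> // a b ha hb.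
by rewrite -opprD normrN; exact: h.
Qed.

Lemma ode_dependence2 F v T : 0 <= T ->
  (forall t, is_derive t 1 v (F (v t))) -> (forall t, lip_at F (v t)) ->
  exists C rho, [/\ 0 <= C, 0 < rho & forall u,
    (forall t, is_derive t 1 u (F (u t))) -> `|u 0 - v 0| <= rho ->
    forall t, `|t| <= T -> `|u t - v t| <= C * `|u 0 - v 0|].
Proof.
move=> T0 hv lip.
have [C1 [r1 [C10 r10 h1]]] := ode_dependence T0 (fun t _ => hv t) (fun t _ => lip t).
have [C2 [r2 [C20 r20 h2]]] := @ode_dependence (fun p => - F p) (fun t => v (- t)) T T0
  (fun t _ => is_derive_reflect (hv (- t))) (fun t _ => lip_at_opp (lip (- t))).
exists (C1 + C2), (Num.min r1 r2); rewrite lt_min r10 addr_ge0//; split=> // u hu.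
rewrite le_min => /andP[d1 d2] t; rewrite ler_norml => /andP[tT1 tT2].
have [t0|/ltW t0] := leP 0 t.
  apply: le_trans (h1 u (fun t _ => hu t) d1 t _) _; first by rewrite t0.
  by rewrite ler_wpM2r// lerDl.
have := h2 (fun t => u (- t)) (fun t _ => is_derive_reflect (hu (- t))).
rewrite oppr0 => /(_ d2 (- t)); rewrite opprK oppr_ge0 t0 lerNl tT1 => /(_ isT).
by move=> h; apply: le_trans h _; rewrite ler_wpM2r// lerDr.
Qed.

Lemma ode_unique2 F u v : (forall t, is_derive t 1 u (F (u t))) ->
  (forall t, is_derive t 1 v (F (v t))) -> (forall t, lip_at F (v t)) ->
  u 0 = v 0 -> u = v.
Proof.
move=> hu hv lip e; apply/funext => t.
have [C [r [C0 r0 h]]] := ode_dependence2 (normr_ge0 t) hv lip.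
have := h u hu; rewrite e subrr normr0 mulr0 => /(_ (ltW r0) t (lexx _)).
by rewrite normr_le0 subr_eq0 => /eqP.
Qed.

(** The flow is complete on [A], since all its orbits are periodic or at rest. The later arguments
    on orbits rest on these properties; the values of [phi] at points off [A] are arbitrary. *)
Record center_flow (A : set (R * R)) X (c : R * R) (phi : R -> R * R -> R * R) : Prop := CenterFlow {
  cf_open : open A;
  cf_center : A c;
  cf_cont : forall q, A q -> {for q, continuous X};
  cf_stable : forall q t, A q -> A (phi t q);
  cf0 : forall q, A q -> phi 0 q = q;
  cfD : forall q s t, A q -> phi s (phi t q) = phi (s + t) q;
  cf_derive : forall q t, A q -> is_derive t 1 (phi^~ q) (X (phi t q));
  cf_dep : forall q T, A q -> exists C rho, [/\ 0 <= C, 0 < rho &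
    forall p, `|p - q| <= rho -> A p /\
      forall t, `|t| <= T -> `|phi t p - phi t q| <= C * `|p - q|];
  cf_period : forall q, A q -> exists2 T, 0 < T & phi T q = q;
  cf_rest : forall t, phi t c = c;
  cf_neq0 : forall q, A q -> q <> c -> X q <> 0;
  cf_inside : forall q, A q -> q <> c -> inside (range (phi^~ q)) c }.

Lemma center_flow_exists (D : set (R * R)) X c A :
  center_with_annulus D X c A -> (forall q, A q -> lip_at X q) ->
  exists2 phi, center_flow A X c phi &
    forall q, A q -> q <> c -> periodic_orbit D X (range (phi^~ q)).
Proof.
move=> [Xc oA _ Ac ann] lip.
have /choice[gam hg] : forall q, exists g : R -> R * R, A q ->
    [/\ g 0 = q, forall t, A (g t), forall t, is_derive t 1 g (X (g t)),
        exists2 T, 0 < T & g T = q &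
      [/\ q = c -> g = cst c, q <> c -> X q <> 0, q <> c -> inside (range g) c &
        q <> c -> periodic_orbit D X (range g)]].
  move=> q; have [Aq|nAq] := pselect (A q); last by exists (cst q).
  have [->|/eqP qc] := eqVneq q c.
    exists (cst c) => _; split=> //; last by exists 1.
    by move=> t; rewrite /cst Xc; exact: is_derive_cst.
  have [G [pG Gq GA iG]] := ann q Aq qc.
  have [g [T [hs T0 gT gn0 eG]]] := pG.
  (* The periodic solution given by the annulus passes through [q] at some time [t1]; shifting time
     makes it start at [q]. *)
  have [t1 _ gt1] : range g q by rewrite -eG.
  have Ag t : A (g t) by apply: GA; rewrite eG; exists t.
  have er : range (fun t => g (t + t1)) = G.
    rewrite eG; apply/seteqP; split=> _ [t _ <-]; first by exists (t + t1).
    by exists (t - t1) => //; rewrite subrK.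
  exists (fun t => g (t + t1)) => _; split=> //.
  - by rewrite add0r.
  - by move=> t; apply: is_derive_shiftr; case: (hs (t + t1)).
  - by exists T => //; rewrite addrC gT.
  (* The field is known to be nonzero at [g 0] only. Were it zero at [q], uniqueness would make the
     whole solution constant equal to [q], and the field zero at [g 0] as well. *)
  - rewrite er; split=> // _ Xq; move: gn0.
    suff -> : g = cst q by rewrite /cst Xq eqxx.
    have d0 t : is_derive t 1 (fun t => g (t + t1)) (X (g (t + t1))).
      by apply: is_derive_shiftr; case: (hs (t + t1)).
    have dc t : is_derive t 1 (cst q) (X q) by rewrite Xq; exact: is_derive_cst.
    have e0 : g (0 + t1) = q by rewrite add0r.
    have E := ode_unique2 d0 dc (fun t => lip q Aq) e0.
    apply/funext => t; have := congr1 (fun f => f (t - t1)) E.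
    by rewrite /= subrK.
exists (fun t q => gam q t); last by move=> q Aq qc; have [_ _ _ _ [_ _ _]] := hg q Aq; apply.
split=> //.
- by move=> q /lip /lip_at_continuous.
- by move=> q t /hg[].
- by move=> q /hg[].
- move=> q s t Aq; have [e0 Ag d _ _] := hg q Aq.
  have [e0' Ag' d' _ _] := hg _ (Ag t).
  have dd (x : R) : is_derive x 1 (fun x => gam q (x + t)) (X (gam q (x + t))).
    exact: is_derive_shiftr.
  have e : gam (gam q t) 0 = gam q (0 + t) by rewrite e0' add0r.
  by rewrite (ode_unique2 d' dd (fun x => lip _ (Ag (x + t))) e).
- by move=> q t /hg[].
- move=> q T Aq; have [e0 Ag d _ _] := hg q Aq.
  have [C [r [C0 r0 h]]] := ode_dependence2 (normr_ge0 T) d (fun t => lip _ (Ag t)).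
  have [r' r'0 hr'] : exists2 r' : R, 0 < r' & forall a, `|a - q| <= r' -> A a.
    by apply: near_norm_le; exact: open_nbhs_nbhs.
  exists C, (Num.min r r'); rewrite lt_min r0; split=> // p.
  rewrite le_min => /andP[pr /hr' Ap]; split=> // t tT.
  have [f0 _ f' _ _] := hg p Ap.
  have := h _ f'; rewrite e0 f0 => /(_ pr t); apply.
  exact: le_trans tT (ler_norm _).
- by move=> q /hg[].
- by move=> t; have [_ _ _ _ [-> //]] := hg c Ac.
- by move=> q /hg[_ _ _ _ []].
- by move=> q /hg[_ _ _ _ []].
Qed.

End Flow.

(** * Components of the complement of a closed set *)

Section PlaneTopology.
Variable R : realType.
Implicit Types (p q a b v : R * R) (G C W : set (R * R)) (t s r : R).

Definition segm p q : set (R * R) := (fun t : R => p + t *: (q - p)) @` `[0, 1].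

Lemma line_continuous p v : continuous (fun t : R => p + t *: v).
Proof.
by move=> t; apply: cvgD; [exact: cvg_cst|apply: cvgZr_tmp; exact: cvg_id].
Qed.

Lemma segm_connected p q : connected (segm p q).
Proof.
apply: connected_continuous_connected; first exact: segment_connected.
by apply: continuous_subspaceT => t; exact: line_continuous.
Qed.

Lemma segm_compact p q : compact (segm p q).
Proof.
apply: continuous_compact; last exact: segment_compact.
by apply: continuous_subspaceT => t; exact: line_continuous.
Qed.

Arguments segm_connected : clear implicits.
Arguments segm_compact : clear implicits.
Arguments line_continuous : clear implicits.

Lemma segm_left p q : segm p q p.
Proof. by exists 0; rewrite ?scale0r ?addr0// /= in_itv/= lexx ler01. Qed.

Lemma segm_right p q : segm p q q.
Proof.
exists 1; first by rewrite /= in_itv/= ler01 lexx.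
by rewrite scale1r addrC subrK.
Qed.

Lemma segm_ball p q w : segm p q w -> `|w - p| <= `|q - p|.
Proof.
move=> [t + <-]; rewrite /= in_itv/= => /andP[t0 t1].
by rewrite addrC addKr normrZ ger0_norm// ler_piMl.
Qed.

Lemma cc_connected G C a b : connected C -> C `<=` ~` G -> C a -> C b ->
  connected_component (~` G) a b.
Proof. by move=> hC CG Ca Cb; exact: (connected_component_max Ca CG hC). Qed.

Lemma inside_connected G C a b : connected C -> C `<=` ~` G -> C a -> C b ->
  inside G a -> inside G b.
Proof.
move=> hC CG Ca Cb [nGa bd]; split; first exact: CG.
by rewrite -(same_connected_component (cc_connected hC CG Ca Cb)).
Qed.

Lemma outside_connected G C a b : connected C -> C `<=` ~` G -> C a -> C b ->
  outside G a -> outside G b.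
Proof.
move=> hC CG Ca Cb [nGa bd]; split; first exact: CG.
by rewrite -(same_connected_component (cc_connected hC CG Ca Cb)).
Qed.

Lemma inside_not_outside G a : inside G a -> ~ outside G a.
Proof. by move=> [_ h] [_]. Qed.

Lemma inside_or_outside G a : ~ G a -> inside G a \/ outside G a.
Proof.
by move=> nG; have [?|?] := pselect (bounded_set (connected_component (~` G) a)); [left|right].
Qed.

Lemma closedC_ball G a : closed G -> ~ G a ->
  exists2 r : R, 0 < r & forall b, `|b - a| <= r -> segm a b `<=` ~` G.
Proof.
move=> cG nG; have [r r0 h] : exists2 r : R, 0 < r & forall b, `|b - a| <= r -> (~` G) b.
  by apply: near_norm_le; apply: open_nbhs_nbhs; split=> //; exact: closed_openC.
by exists r => // b ba w /segm_ball wb; apply: h; exact: le_trans wb ba.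
Qed.

Lemma near_inside G a : closed G -> inside G a -> \forall b \near a, inside G b.
Proof.
move=> cG ia; have [r r0 h] := closedC_ball cG ia.1.
have := near_dist_le a r0; apply: filterS => b /h hb.
exact: (inside_connected (segm_connected a b) hb (segm_left _ _) (segm_right _ _) ia).
Qed.

Lemma near_outside G a : closed G -> outside G a -> \forall b \near a, outside G b.
Proof.
move=> cG ia; have [r r0 h] := closedC_ball cG ia.1.
have := near_dist_le a r0; apply: filterS => b /h hb.
exact: (outside_connected (segm_connected a b) hb (segm_left _ _) (segm_right _ _) ia).
Qed.

Lemma outside_ray G a v : v <> 0 -> (forall t, 0 <= t -> ~ G (a + t *: v)) ->
  outside G a.
Proof.
move=> /eqP v0 h; have nv : 0 < `|v| by rewrite normr_gt0.
split; first by have := h 0 (lexx _); rewrite scale0r addr0.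
move=> [M [Mr hM]]; pose M' := `|M| + 1.
have : M < M' by rewrite (le_lt_trans (ler_norm M))// ltrDl.
move=> /hM bd; pose t := (M' + `|a| + 1) / `|v|.
have t0 : 0 <= t by rewrite divr_ge0// ?addr_ge0 ?ler01.
have : connected_component (~` G) a (a + t *: v).
  apply: (@cc_connected _ (segm a (a + t *: v)));
    [exact: segm_connected| |exact: segm_left|exact: segm_right].
  move=> _ [s + <-]; rewrite /= in_itv/= => /andP[s0 s1].
  by rewrite [a + t *: v]addrC addrK scalerA; apply: h; exact: mulr_ge0.
move=> /bd /=; apply/negP; rewrite -ltNge.
have := ler_normB (a + t *: v) a; rewrite [a + _]addrC addrK normrZ ger0_norm// divfK ?gt_eqF//.
lra.
Qed.

Lemma closed_inf (S : set R) : closed S -> S !=set0 -> has_lbound S -> S (inf S).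
Proof.
move=> cS S0 lS; apply: contrapT => nS.
have [r r0 h] : exists2 r : R, 0 < r & forall b : R, `|b - inf S| <= r -> (~` S) b.
  by apply: near_norm_le; apply: open_nbhs_nbhs; split=> //; exact: closed_openC.
have [x Sx xr] := inf_adherent r0 (conj S0 lS).
apply: (h x) => //; rewrite ger0_norm ?subr_ge0 ?ge_inf//.
by rewrite lerBlDl ltW.
Qed.

(** On a segment from [a] to a point of [G], the first hit of [G] is a limit of points of the
    component of [a]. *)
Lemma component_boundary G a : closed G -> G !=set0 -> ~ G a ->
  exists2 p, G p & forall U : set (R * R), nbhs p U ->
    exists2 q, U q & connected_component (~` G) a q.
Proof.
move=> cG [g Gg] nGa; pose f t := a + t *: (g - a).
have cf : continuous f by exact: line_continuous.
pose S := [set t | 0 <= t /\ G (f t)].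
have S0 : S !=set0 by exists 1; split=> //; rewrite /f scale1r addrC subrK.
have lbS : has_lbound S by exists 0 => t [].
have cS : closed S.
  apply: closedI; first exact: closed_ge.
  by apply: closed_comp => // t _; exact: cf.
have [s0 Gs] : S (inf S) by exact: closed_inf.
have sn0 : inf S != 0.
  by apply/eqP => e; apply: nGa; move: Gs; rewrite e /f scale0r addr0.
have {sn0}sp : 0 < inf S by rewrite lt_neqAle eq_sym sn0.
exists (f (inf S)) => // U hU.
have : \forall t \near inf S, U (f t) by exact: (cf (inf S)).
move=> /near_norm_le[d d0 hd].
pose t := Num.max (inf S / 2) (inf S - d).
have t0 : 0 < t by rewrite lt_max divr_gt0.
have tS : t < inf S by rewrite gt_max ltr_pdivrMr// ltr_pMr// ltr1n gtrBl d0.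
exists (f t).
  apply: hd; rewrite ler0_norm ?subr_le0 ?(ltW tS)// opprB lerBlDr -lerBlDl.
  by rewrite le_max lexx orbT.
have C : connected (f @` `[0, t]).
  apply: connected_continuous_connected; first exact: segment_connected.
  by apply: continuous_subspaceT => x; exact: cf.
apply: (cc_connected C).
- move=> _ [s + <-] Gfs; rewrite /= in_itv/= => /andP[s0' st].
  have : inf S <= s by apply: ge_inf.
  by apply/negP; rewrite -ltNge (le_lt_trans st).
- by exists 0; rewrite /f ?scale0r ?addr0//= in_itv/= lexx ltW.
- by exists t => //=; rewrite in_itv/= lexx ltW.
Qed.

(** Finite chains of segments reach a set of points that is open and closed in [W]. Compactness of
    [K] lets it avoid not only a given orbit but also all nearby ones. *)
Lemma open_connected_join W a b : open W -> connected W -> W a -> W b ->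
  exists K, [/\ compact K, connected K, K `<=` W, K a & K b].
Proof.
move=> oW cW Wa.
pose B := [set b | exists K, [/\ compact K, connected K, K `<=` W, K a & K b]].
have ext w : W w -> exists2 r : R, 0 < r & forall w', `|w' - w| <= r ->
    segm w w' `<=` W.
  move=> Ww; have [r r0 h] : exists2 r : R, 0 < r & forall b, `|b - w| <= r -> W b.
    by apply: near_norm_le; exact: open_nbhs_nbhs.
  by exists r => // w' ww' x /segm_ball xw; apply: h; exact: le_trans xw ww'.
have add w w' : B w -> segm w w' `<=` W -> B w'.
  move=> [K [cK kK KW Ka Kw]] sW; exists (K `|` segm w w'); split.
  - by apply: compactU => //; exact: segm_compact.
  - by apply: connectedU => //; [exists w; split=> //; exact: segm_left|exact: segm_connected].
  - by move=> x [/KW|/sW].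
  - by left.
  - by right; exact: segm_right.
have segC w w' : segm w w' = segm w' w.
  by apply/seteqP; split=> _ [t + <-]; rewrite /= in_itv/= => /andP[t0 t1];
    (exists (1 - t); first (by rewrite /= in_itv/= subr_ge0 t1 gerBl t0));
    rewrite scalerBl scale1r addrA [_ + (_ - _)]addrC subrK -scalerN opprB.
have oB : open B.
  rewrite openE => w Bw; have Ww : W w by have [K [_ _ KW _ Kw]] := Bw; exact: KW.
  have [r r0 h] := ext w Ww; have := near_dist_le w r0.
  by apply: filterS => w' /h; exact: add.
have oWB : open (W `\` B).
  rewrite openE => w [Ww nBw]; have [r r0 h] := ext w Ww; have := near_dist_le w r0.
  apply: filterS => w' /h sW; split; first by apply: sW; exact: segm_right.
  by move=> Bw'; apply: nBw; apply: (add w') => //; rewrite segC.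
suff e : W = B by move=> Wb; suff : B b by []; rewrite -e.
apply/esym/cW.
- by exists a, [set a]; split=> //; [exact: compact_set1|exact: connected1|move=> _ ->].
- by exists B => //; apply/seteqP; split=> [x|x []//]; split=> //; case: H => K [_ _ + _]; apply.
- exists (~` (W `\` B)); first exact: open_closedC.
  apply/seteqP; split=> x.
    by move=> Bx; split; [have [K [_ _ KW _ Kx]] := Bx; exact: KW|move=> [_]].
  by move=> [Wx h]; apply: contrapT => nB; apply: h.
Qed.

End PlaneTopology.

Arguments segm_connected {R} p q.
Arguments segm_compact {R} p q.
Arguments line_continuous {R} p v.

(** * Determinants and orientation *)

Section Det.
Variable R : realType.
Implicit Types (u v w p q : R * R) (t : R).

(** Positivity of [det u v] means that [v] points to the left of [u]. *)
Definition det u v : R := u.1 * v.2 - u.2 * v.1.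
Definition perp u : R * R := (- u.2, u.1).

Lemma scale_pairE t u : t *: u = (t * u.1, t * u.2).
Proof. by []. Qed.

Lemma detZl t u v : det (t *: u) v = t * det u v.
Proof. by rewrite /det /= /GRing.scale /=; ring. Qed.
Lemma detZr t u v : det u (t *: v) = t * det u v.
Proof. by rewrite /det /= /GRing.scale /=; ring. Qed.
Lemma detDl u w v : det (u + w) v = det u v + det w v.
Proof. by rewrite /det /= /GRing.scale /=; ring. Qed.
Lemma detDr u v w : det u (v + w) = det u v + det u w.
Proof. by rewrite /det /= /GRing.scale /=; ring. Qed.
Lemma detNr u v : det u (- v) = - det u v.
Proof. by rewrite /det /= /GRing.scale /=; ring. Qed.
Lemma detNl u v : det (- u) v = - det u v.
Proof. by rewrite /det /= /GRing.scale /=; ring. Qed.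
Lemma detxx u : det u u = 0.
Proof. by rewrite /det mulrC subrr. Qed.

Lemma det_le u v : `|det u v| <= 2 * (`|u| * `|v|).
Proof.
rewrite /det mulrDl mul1r; apply: le_trans (ler_normB _ _) _.
by rewrite !normrM lerD// ler_pM// ?norm_fst_le ?norm_snd_le.
Qed.

Lemma det_perp u : u <> 0 -> 0 < det u (perp u).
Proof.
move=> u0; rewrite /det /perp/= mulrN opprK -!expr2 -/(sqn u) lt_neqAle sqn_ge0 andbT.
by apply/eqP => e; apply: u0; apply: sqn_eq0; rewrite -e.
Qed.

Lemma det_gt0_neq0 u v : 0 < det u v -> u <> 0 /\ v <> 0.
Proof.
by move=> h; split=> e; move: h; rewrite e /det/= ?mul0r ?mulr0 subrr ltxx.
Qed.

Lemma det_eq0_colinear u v : v <> 0 -> det u v = 0 -> exists t, u = t *: v.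
Proof.
move=> v0; rewrite /det => e; have s0 : sqn v != 0.
  by apply/eqP => h; apply: v0; apply: sqn_eq0; rewrite h.
exists ((u.1 * v.1 + u.2 * v.2) / sqn v); rewrite [u]surjective_pairing scale_pairE/=.
congr pair; rewrite mulrAC; apply: (mulIf s0); rewrite divfK//; apply/eqP;
  rewrite -subr_eq0; apply/eqP.
  by transitivity (v.2 * (u.1 * v.2 - u.2 * v.1)); [rewrite /sqn; ring|rewrite e mulr0].
by transitivity (- v.1 * (u.1 * v.2 - u.2 * v.1)); [rewrite /sqn; ring|rewrite e mulr0].
Qed.

Lemma det_continuous (T : topologicalType) (f g : T -> R * R) x :
  {for x, continuous f} -> {for x, continuous g} ->
  {for x, continuous (fun y => det (f y) (g y))}.
Proof.
move=> cf cg.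
have c1 (h : T -> R * R) : {for x, continuous h} -> {for x, continuous (fun y => (h y).1)}.
  by move=> ch; apply: cvg_comp ch _ => /=; case: (h x) => a b; exact: cvg_fst.
have c2 (h : T -> R * R) : {for x, continuous h} -> {for x, continuous (fun y => (h y).2)}.
  by move=> ch; apply: cvg_comp ch _ => /=; case: (h x) => a b; exact: cvg_snd.
by apply: cvgB; apply: cvgM; [exact: c1|exact: c2|exact: c2|exact: c1].
Qed.

End Det.

Lemma near_continuous_lt (R : realType) (T : topologicalType) (V : normedModType R)
    (f : T -> V) (x : T) (e : R) :
  {for x, continuous f} -> 0 < e -> \forall y \near x, `|f y - f x| < e.
Proof. by move=> cf e0; exact: (cf _ (near_dist_lt (f x) e0)). Qed.

(** * Orbits of the center flow: compactness, continuity, return, linearization *)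

Section Orbits.
Variables (R : realType) (A : set (R * R)) (X : R * R -> R * R) (c : R * R).
Variable phi : R -> R * R -> R * R.
Hypothesis cf : center_flow A X c phi.
Implicit Types (p q u v z : R * R) (t s r a b e : R).

Definition orb q : set (R * R) := range (phi^~ q).

Lemma phi_continuous q : A q -> continuous (phi^~ q : R -> R * R).
Proof. by move=> Aq t; exact: is_derive_continuous (cf_derive cf t Aq). Qed.

Arguments phi_continuous : clear implicits.

Lemma orb_refl q : A q -> orb q q.
Proof. by move=> Aq; exists 0; rewrite // (cf0 cf). Qed.

Lemma orb_sub q : A q -> orb q `<=` A.
Proof. by move=> Aq _ [t _ <-]; exact: (cf_stable cf). Qed.

Lemma orb_phi q t : orb q (phi t q).
Proof. by exists t. Qed.

Lemma orb_eq p q : A q -> orb q p -> orb p = orb q.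
Proof.
move=> Aq [t _ <-]; apply/seteqP; split=> _ [s _ <-].
  by rewrite (cfD cf)//; exact: orb_phi.
by exists (s - t) => //; rewrite (cfD cf)// subrK.
Qed.

Lemma orb_sym p q : A q -> orb q p -> orb p q.
Proof. by move=> Aq /(orb_eq Aq) ->; exact: orb_refl. Qed.

Lemma orb_disjoint p q t : A p -> A q -> ~ orb p q -> ~ orb p (phi t q).
Proof.
move=> Ap Aq npq h; apply: npq; rewrite -(orb_eq Ap h) (orb_eq Aq (orb_phi q t)).
exact: orb_refl.
Qed.

Lemma orb_connected q : A q -> connected (orb q).
Proof.
move=> Aq; apply: connected_continuous_connected.
  by apply/connected_intervalP => x y _ _ z _.
by apply: continuous_subspaceT => t; exact: phi_continuous.
Qed.

Lemma orb_itv q T : A q -> 0 < T -> phi T q = q ->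
  orb q = (phi^~ q) @` `[0, T].
Proof.
move=> Aq T0 pT; have pn (n : nat) : phi (n%:R * T) q = q.
  elim: n => [|n ih]; first by rewrite mul0r (cf0 cf).
  by rewrite -addn1 natrD mulrDl mul1r -(cfD cf)// pT.
have pz (k : int) : phi (k%:~R * T) q = q.
  case: k => n; first exact: pn.
  by rewrite NegzE mulrNz mulNr -{1}(pn n.+1) (cfD cf)// addNr (cf0 cf).
apply/seteqP; split=> [_ [t _ <-]|_ [t _ <-]]; last exact: orb_phi.
pose k := Num.floor (t / T); exists (t - k%:~R * T).
  rewrite /= in_itv/= subr_ge0 lerBlDr -ler_pdivlMr// floor_le_tmp/=.
  rewrite -[X in X + _]mul1r -mulrDl -ler_pdivrMr// addrC.
  by rewrite ltW// -[1]/(1%:~R) -intrD floorD1_gt.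
by rewrite -{1}(pz k) (cfD cf)// subrK.
Qed.

Lemma orb_compact q : A q -> compact (orb q).
Proof.
move=> Aq; have [T T0 pT] := cf_period cf Aq; rewrite (orb_itv Aq T0 pT).
apply: continuous_compact; last exact: segment_compact.
by apply: continuous_subspaceT => t; exact: phi_continuous.
Qed.

Lemma orb_closed q : A q -> closed (orb q).
Proof. by move=> Aq; apply: compact_closed; [exact: norm_hausdorff|exact: orb_compact]. Qed.

Lemma flow_cont q t0 e : A q -> 0 < e -> exists2 d, 0 < d &
  forall p t, `|p - q| <= d -> `|t - t0| <= d -> A p /\ `|phi t p - phi t0 q| <= e.
Proof.
move=> Aq e0; have [C [r [C0 r0 h]]] := cf_dep cf (`|t0| + 1) Aq.
have : \forall t \near t0, `|phi t q - phi t0 q| <= e / 2.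
  have := near_continuous_lt (phi_continuous _ Aq t0) (divr_gt0 e0 (ltr0n R 2)).
  by apply: filterS => t /ltW.
move=> /near_norm_le[d1 d10 hd1].
have C1 : 0 < C + 1 by rewrite ltr_wpDl.
pose d := Num.min (Num.min d1 1) (Num.min r (e / 2 / (C + 1))).
have d0 : 0 < d by rewrite !lt_min d10 ltr01 r0 !divr_gt0.
exists d => // p t; rewrite !le_min => /andP[_ /andP[pr pe]] /andP[/andP[td1 t1] _].
have [Ap hp] := h p pr; split=> //; rewrite -(subrKA (phi t q)).
apply: le_trans (ler_normD _ _) _; rewrite (splitr e) lerD ?hd1//.
apply: le_trans (hp t _) _.
  rewrite -(subrK t0 t) (le_trans (ler_normD _ _))// addrC lerD2l//.
apply: (@le_trans _ _ ((C + 1) * `|p - q|)); first by rewrite ler_wpM2r// lerDl.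
by rewrite mulrC -ler_pdivlMr.
Qed.

Lemma flow_cont_nbhs q t0 (U : set (R * R)) : A q -> nbhs (phi t0 q) U ->
  exists2 d, 0 < d &
  forall p t, `|p - q| <= d -> `|t - t0| <= d -> A p /\ U (phi t p).
Proof.
move=> Aq /near_norm_le[e e0 he]; have [d d0 hd] := flow_cont t0 Aq e0.
by exists d => // p t pd td; have [Ap h] := hd p t pd td; split=> //; exact: he.
Qed.

Lemma phi_neq0 q t : A q -> q <> c -> phi t q <> c.
Proof.
move=> Aq qc e; apply: qc.
by rewrite -(cf0 cf Aq) -(addNr t) -(cfD cf)// e (cf_rest cf).
Qed.

Lemma orb_neq q p : A q -> q <> c -> orb q p -> p <> c.
Proof. by move=> Aq qc [t _ <-]; exact: phi_neq0. Qed.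

(** On the compact interval [[0, T]], times near a return time to [p] differ from it by at most [e],
    and near any other time the orbit keeps a positive distance from [p]. *)
Lemma local_return p e : A p -> 0 < e -> exists2 r, 0 < r &
  forall q, orb p q -> `|q - p| <= r -> exists2 b, `|b| <= e & q = phi b p.
Proof.
move=> Ap e0; have [T T0 pT] := cf_period cf Ap; rewrite (orb_itv Ap T0 pT).
have /compact_near_coveringP cK := @segment_compact R 0 T.
have : \forall i \near (0 : R)^'+, `[0, T] `<=` (fun t => `|phi t p - p| <= i ->
    exists2 b, `|b| <= e & phi t p = phi b p).
  apply: (cK R (0^'+)%classic) => t _.
  have [e1|/eqP ne] := eqVneq (phi t p) p.
    have nt : \forall t' \near t, `|t' - t| <= e by exact: near_dist_le.
    near=> t' i => /= _; exists (t' - t); first by near: t'.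
    by rewrite -{2}e1 (cfD cf)// subrK.
  pose d := `|phi t p - p|; have d0 : 0 < d by rewrite normr_gt0 subr_eq0; exact/eqP.
  have near1 : \forall t' \near t, `|phi t' p - phi t p| < d / 2.
    exact: near_continuous_lt (phi_continuous _ Ap t) (divr_gt0 d0 (ltr0n R 2)).
  near=> t' i => /= le; exfalso.
  have h1 : `|phi t' p - phi t p| < d / 2 by near: t'.
  have h2 : i < d / 2 by near: i; apply: nbhs_right_lt; exact: divr_gt0.
  have : d <= `|phi t p - phi t' p| + `|phi t' p - p|.
    by rewrite /d -(subrKA (phi t' p)); exact: ler_normD.
  rewrite distrC; lra.
move=> h; near (0 : R)^'+ => i; exists i => //.
move=> _ [t tT <-] hi; apply: (near h i) => //.
Unshelve. all: by end_near. Qed.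

(** This is strict differentiability: it controls all short chords of the orbit near [p], not only
    those starting at [p]. The mean value theorem is applied to each coordinate. *)
Lemma flow_lin p e : A p -> 0 < e -> exists2 tau, 0 < tau & forall a b,
  `|a| <= tau -> `|b| <= tau ->
  `|phi b p - phi a p - (b - a) *: X p| <= e * `|b - a|.
Proof.
move=> Ap e0; have cXp : {for 0, continuous (X \o phi^~ p)}.
  by apply: continuous_comp; [exact: phi_continuous|rewrite /= (cf0 cf Ap); exact: (cf_cont cf)].
have : \forall t \near 0, `|X (phi t p) - X p| <= e.
  have := near_continuous_lt cXp e0; rewrite /= (cf0 cf Ap).
  by apply: filterS => t /ltW.
move=> /near_norm_le[tau tau0 htau]; exists tau => // a b.
wlog ab : a b / a <= b => [hw|] ha hb.
  have [/hw|/ltW/hw] := leP a b; first exact.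
  move=> /(_ hb ha); rewrite [`|a - b|]distrC -normrN.
  by rewrite opprB [- (_ - _)]opprB -[a - b]opprB scaleNr addrC.
have itv t : a <= t <= b -> `|t| <= tau.
  by move: ha hb; rewrite !ler_norml; lra.
have one (f g : R -> R) (y : R) : (forall t, is_derive t 1 f (g t)) ->
    (forall t, a <= t <= b -> `|g t - y| <= e) ->
    `|f b - f a - (b - a) * y| <= e * `|b - a|.
  move=> hf hg.
  have [t] := @MVT_segment R f g a b ab (fun t _ => hf t) (is_derive_continuous_itv (fun t _ => hf t)).
  rewrite in_itv/= => /hg hgt ->.
  by rewrite [(b - a) * y]mulrC -mulrBl normrM ler_wpM2r.
have d1 t := is_derive_fst (cf_derive cf t Ap).
have d2 t := is_derive_snd (cf_derive cf t Ap).
rewrite normE ge_max; apply/andP; split.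
  apply: (one _ _ (X p).1 d1) => t /itv tt.
  apply: le_trans (htau t _); first exact: (norm_fst_le (X (phi t p) - X p)).
  by rewrite subr0.
apply: (one _ _ (X p).2 d2) => t /itv tt.
apply: le_trans (htau t _); first exact: (norm_snd_le (X (phi t p) - X p)).
by rewrite subr0.
Qed.

End Orbits.

Arguments phi_continuous {R A X c phi} cf q.

(** * The two sides of a periodic orbit *)

Section Sides.
Variables (R : realType) (A : set (R * R)) (X : R * R -> R * R) (c : R * R).
Variable phi : R -> R * R -> R * R.
Hypothesis cf : center_flow A X c phi.
Implicit Types (p q u v z : R * R) (t s r a b e : R).
Local Notation orb := (orb phi).

(** Two orbit points close to [p] are reached at short times, so their difference is almost parallel
    to [X p]; a vector close to the transversal [v] is not. *)
Lemma transversal_cone p v : A p -> 0 < det (X p) v -> exists2 r, 0 < r &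
  forall p' v' e, orb p p' -> `|p' - p| <= r -> `|v' - v| <= r ->
    0 < `|e| -> `|e| <= r -> ~ orb p (p' + e *: v').
Proof.
move=> Ap d0; have [/eqP x0 /eqP v0] := det_gt0_neq0 d0.
set d := det (X p) v in d0; pose M := `|X p|; pose V := `|v| + 1.
have M0 : 0 < M by rewrite normr_gt0.
have V0 : 0 < V by rewrite ltr_wpDl.
(* The bound [M / 2] lets the linearization error be absorbed, giving [h1]. The 16 makes the final
   estimate contradictory: half of [d] would be at most a quarter of it. In [r] below, [d / (4 * M)]
   keeps [det (X p) v'] above [d / 2]. *)
pose eps := Num.min (M / 2) (d / (16 * V)).
have eps0 : 0 < eps by rewrite lt_min !divr_gt0// mulr_gt0.
have [tau tau0 lin] := flow_lin cf Ap eps0.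
have [r0 r00 ret] := local_return cf Ap tau0.
pose r := Num.min (Num.min 1 (r0 / (1 + V))) (d / (4 * M)).
have V1 : 0 < 1 + V by rewrite addr_gt0.
have rp : 0 < r by rewrite !lt_min ltr01 !divr_gt0// mulr_gt0.
exists r => // p' v' e op' p'r v'r e0 er oq.
have r1 : r <= 1 by rewrite !ge_min lexx.
have rr0 : r * (1 + V) <= r0.
  by rewrite -ler_pdivlMr// !ge_min lexx orbT.
have rd : r * (4 * M) <= d.
  by rewrite -ler_pdivlMr ?mulr_gt0// ge_min lexx orbT.
have v'V : `|v'| <= V.
  rewrite -(subrK v v') (le_trans (ler_normD _ _))// /V addrC lerD2l.
  exact: le_trans v'r r1.
have q'r : `|p' + e *: v' - p| <= r0.
  rewrite addrAC; apply: le_trans (ler_normD _ _) _; apply: le_trans rr0.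
  by rewrite mulrDr mulr1 lerD// normrZ ler_pM.
have p'r0 : `|p' - p| <= r0.
  apply: le_trans p'r _; apply: le_trans rr0; rewrite ler_peMr ?ltW//.
  by rewrite ltrDl.
have [a ha ea] := ret _ op' p'r0.
have [b hb eb] := ret _ oq q'r.
have := lin a b ha hb; rewrite -eb -ea [p' + _]addrC addrK.
set w := e *: v' - _ => hw.
have ew : e *: v' = (b - a) *: X p + w by rewrite addrC subrK.
have h1 : `|b - a| * M <= 2 * (`|e| * V).
  have : `|b - a| * M <= `|e| * V + eps * `|b - a|.
    rewrite -normrZ (_ : (b - a) *: X p = e *: v' - w); last by rewrite ew addrK.
    apply: le_trans (ler_normB _ _) _; by rewrite lerD// normrZ ler_wpM2l.
  have : eps * `|b - a| <= M / 2 * `|b - a| by rewrite ler_wpM2r// ge_min lexx.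
  by lra.
have hd : e * det (X p) v' = det (X p) w.
  by rewrite -detZr ew detDr detZr detxx mulr0 add0r.
have dv : d / 2 <= det (X p) v'.
  rewrite -(subrK v v') detDr -/d.
  have := det_le (X p) (v' - v); rewrite ler_norml => /andP[+ _].
  have : `|X p| * `|v' - v| <= M * r by rewrite ler_wpM2l// ltW.
  by rewrite -/M; lra.
have : `|e| * (d / 2) <= 2 * (M * (eps * `|b - a|)).
  apply: (@le_trans _ _ `|e * det (X p) v'|).
    by rewrite normrM ler_wpM2l// (le_trans dv)// ler_norm.
  rewrite hd; apply: le_trans (det_le _ _) _.
  by rewrite ler_wpM2l// ler_wpM2l// ltW.
have h2 : M * (eps * `|b - a|) <= eps * (2 * (`|e| * V)).
  by rewrite mulrCA ler_wpM2l ?(ltW eps0)// mulrC.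
have h3 : eps * (2 * (`|e| * V)) <= `|e| * (d / 8).
  have : eps * (16 * V) <= d by rewrite -ler_pdivlMr ?mulr_gt0// ge_min lexx orbT.
  move=> /(ler_wpM2l (normr_ge0 e)); lra.
have : 0 < `|e| * d by rewrite mulr_gt0.
by lra.
Qed.

(** The determinant of [phi t q - p] with [v] is close to [t * D], so it changes sign between the
    times [- T] and [T]; at a zero the point lies on the line through [p] directed by [v]. *)
Lemma section_point p v e : A p -> 0 < det (X p) v -> 0 < e ->
  exists2 d, 0 < d & forall q, `|q - p| <= d ->
    exists t s, [/\ `|t| <= e, `|s| <= e & phi t q = p + s *: v].
Proof.
move=> Ap d0 e0; have [/eqP x0 vn0] := det_gt0_neq0 d0; have /eqP v0 := vn0.
set D := det (X p) v in d0.
have V0 : 0 < `|v| by rewrite normr_gt0.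
pose eps := D / (4 * `|v|); have eps0 : 0 < eps by rewrite divr_gt0// mulr_gt0.
have [tau tau0 lin] := flow_lin cf Ap eps0.
have ev0 : 0 < e * `|v| by rewrite mulr_gt0.
have [d1 d10 hd1] := flow_cont cf 0 Ap ev0.
pose T := Num.min (Num.min tau e) d1.
have T0 : 0 < T by rewrite !lt_min tau0 e0.
have Ttau : T <= tau by rewrite !ge_min lexx.
have Te : T <= e by rewrite !ge_min lexx orbT.
have Td : T <= d1 by rewrite ge_min lexx orbT.
have bd t : `|t| = T -> `|det (phi t p - p) v - t * D| <= T * D / 2.
  move=> tT; have := lin 0 t; rewrite normr0 tT (cf0 cf Ap) !subr0 => /(_ (ltW tau0) Ttau) h.
  rewrite -detZl (_ : det _ _ - det _ _ = det (phi t p - p - t *: X p) v); last first.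
    by rewrite [RHS]detDl detNl.
  apply: le_trans (det_le _ _) _; rewrite tT in h.
  apply: (@le_trans _ _ (2 * (eps * T * `|v|))).
    by rewrite ler_wpM2l// ler_wpM2r// ltW.
  rewrite (_ : 2 * (eps * T * `|v|) = T * D / 2)// /eps; field.
  by rewrite gt_eqF.
have TD : 0 < T * D / 2 by rewrite divr_gt0// mulr_gt0.
have sgn t : `|t| = T -> exists2 d, 0 < d & forall q, `|q - p| <= d ->
    `|det (phi t q - p) v - t * D| < T * D.
  move=> tT; have e1 : 0 < T * D / 2 / (4 * `|v|) by rewrite divr_gt0// mulr_gt0.
  have [d d0' hd] := flow_cont cf t Ap e1.
  exists d => // q /(hd q t); rewrite subrr normr0 (ltW d0') => /(_ isT)[_ h].
  rewrite (_ : det _ _ - _ = det (phi t q - phi t p) v + (det (phi t p - p) v - t * D)); last first.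
    by rewrite addrA -detDl subrKA.
  apply: le_lt_trans (ler_normD _ _) _.
  have h1 := bd t tT; have h2 := det_le (phi t q - phi t p) v.
  have h3 : `|phi t q - phi t p| * `|v| <= T * D / 8.
    apply: (@le_trans _ _ (T * D / 2 / (4 * `|v|) * `|v|)); first by rewrite ler_wpM2r// ltW.
    rewrite (_ : T * D / 2 / (4 * `|v|) * `|v| = T * D / 8)//; field.
    by rewrite gt_eqF.
  lra.
have nT : `|T| = T by rewrite gtr0_norm.
have nNT : `|- T| = T by rewrite normrN.
have [da da0 hda] := sgn _ nT.
have [db db0 hdb] := sgn _ nNT.
exists (Num.min (Num.min da db) d1); first by rewrite !lt_min da0 db0.
move=> q; rewrite !le_min => /andP[/andP[/hda pos /hdb neg] qd1].
have Aq : A q by have := hd1 q 0 qd1; rewrite subrr normr0 => /(_ (ltW d10))[].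
pose f t := det (phi t q - p) v.
have cf' : continuous f.
  move=> t; apply: (@det_continuous R R (fun t => phi t q - p) (fun=> v)).
    by apply: cvgB; [exact: (phi_continuous cf q Aq)|exact: cvg_cst].
  exact: cvg_cst.
have fp : 0 < f T by move: pos; rewrite -/(f T) ltr_norml => /andP[+ _]; lra.
have fn : f (- T) < 0 by move: neg; rewrite -/(f (- T)) ltr_norml => /andP[_ +]; lra.
have NT : - T <= T by rewrite lerNl; lra.
have [|t] := @IVT R f (- T) T 0 NT (continuous_subspaceT cf').
  by rewrite ge_min le_max (ltW fp) (ltW fn) orbT.
rewrite in_itv/= => /andP[t1 t2] ft.
have tT : `|t| <= T by rewrite ler_norml t1.
have [s es] := det_eq0_colinear vn0 ft.
exists t, s; split; [exact: le_trans tT Te| |by rewrite -es addrC subrK].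
have := hd1 q t qd1; rewrite subr0 => /(_ (le_trans tT Td))[_].
by rewrite (cf0 cf Ap) es normrZ ler_pM2r.
Qed.

(** The component of [u] accumulates at some point of the orbit, and the flow carries that point to
    [p]. Points of the component stay in it on the way because distinct orbits are disjoint. *)
Lemma component_meets p u (U : set (R * R)) : A p -> ~ orb p u -> nbhs p U ->
  exists q, [/\ U q, A q, ~ orb p q & connected_component (~` orb p) u q].
Proof.
move=> Ap npu hU; have Op0 : orb p !=set0 by exists p; exact: (orb_refl cf Ap).
have [p0 [s _ es] hp0] := component_boundary (orb_closed cf Ap) Op0 npu.
have Ap0 : A p0 by rewrite -es; exact: (cf_stable cf).
have ep : phi (- s) p0 = p by rewrite -es (cfD cf)// addNr (cf0 cf).
rewrite -ep in hU; have [d d0 hd] := flow_cont_nbhs cf Ap0 hU.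
have [q qd ccq] := hp0 _ (near_dist_le p0 d0).
have [|Aq Uq] := hd q (- s) qd; first by rewrite subrr normr0 ltW.
have nq : ~ orb p q by apply: (connected_component_sub (A := ~` orb p)) ccq.
exists (phi (- s) q); split=> //; first exact: (cf_stable cf).
  exact: (orb_disjoint cf Ap Aq nq).
apply: connected_component_trans ccq _; apply: (cc_connected (orb_connected cf Aq)).
- move=> _ [t _ <-]; exact: (orb_disjoint cf Ap Aq nq).
- exact: (orb_refl cf Aq).
- exact: orb_phi.
Qed.

(** [Q] stands for any property of points off [G] that is constant on connected sets: being inside,
    being outside, or lying in a given component. *)
Lemma ray_connected p v (K : R -> Prop) (Q : set (R * R) -> set (R * R)) (G : set (R * R)) a b :
  (forall C x y, connected C -> C `<=` ~` G -> C x -> C y -> Q G x -> Q G y) ->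
  (forall x y z : R, K x -> K y -> x <= z <= y -> K z) ->
  (forall s, K s -> ~ G (p + s *: v)) -> K a -> K b ->
  Q G (p + a *: v) -> Q G (p + b *: v).
Proof.
move=> hQ itvK hK Ka Kb.
apply: (hQ ((fun s => p + s *: v) @` [set s | K s])).
- apply: connected_continuous_connected.
    by apply/connected_intervalP => x y Kx Ky z; exact: itvK.
  by apply: continuous_subspaceT => t; exact: line_continuous.
- by move=> _ [s Ks <-]; exact: hK.
- by exists a.
- by exists b.
Qed.

(* [Q (orb p)] holds just off [p] in the direction [v]. *)
Definition germ (Q : set (R * R) -> set (R * R)) p v :=
  exists2 r, 0 < r & forall s, 0 < s <= r -> Q (orb p) (p + s *: v).

(** A point of the component near [p] flows onto the transversal. Each half of the latter is
    connected and free of the orbit by [transversal_cone], so the half that is hit lies entirely in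
    the component. *)
Lemma component_side p v u : A p -> 0 < det (X p) v -> ~ orb p u ->
  germ (fun G => connected_component (~` G) u) p v \/
  germ (fun G => connected_component (~` G) u) p (- v).
Proof.
move=> Ap d0 npu; have [r r0 cone] := transversal_cone Ap d0.
have nin s : 0 < `|s| -> `|s| <= r -> ~ orb p (p + s *: v).
  by apply: cone; rewrite ?subrr ?normr0 ?ltW//; exact: (orb_refl cf Ap).
have [d dp sec] := section_point Ap d0 r0.
have [q [qd Aq nq ccq]] := component_meets Ap npu (near_dist_le p dp).
have [t [s [_ sr es]]] := sec q qd.
have ccs : connected_component (~` orb p) u (p + s *: v).
  apply: connected_component_trans ccq _; apply: (cc_connected (orb_connected cf Aq)).
  - move=> _ [t' _ <-]; exact: (orb_disjoint cf Ap Aq nq).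
  - exact: (orb_refl cf Aq).
  - by rewrite -es; exact: orb_phi.
have conn C x y : connected C -> C `<=` ~` orb p -> C x -> C y ->
    connected_component (~` orb p) u x -> connected_component (~` orb p) u y.
  by move=> cC CG Cx Cy; move=> /connected_component_trans; apply; exact: (cc_connected cC).
have [s0|s0|s0] := ltgtP 0 s.
- left; exists r => // s' /andP[s'0 s'r].
  apply: (ray_connected (K := fun x => 0 < x <= r)
    (Q := fun G => connected_component (~` G) u) conn _ _ _ _ ccs).
  + by move=> x y z; lra.
  + by move=> x /andP[x0 xr]; apply: nin; rewrite gtr0_norm.
  + by rewrite s0 (le_trans (ler_norm s)).
  + by rewrite s'0.
- right; exists r => // s' /andP[s'0 s'r]; rewrite scalerN -scaleNr.
  apply: (ray_connected (K := fun x => - r <= x < 0)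
    (Q := fun G => connected_component (~` G) u) conn _ _ _ _ ccs).
  + by move=> x y z; lra.
  + by move=> x /andP[xr x0]; apply: nin; rewrite ltr0_norm ?oppr_gt0// lerNl.
  + by rewrite s0 andbT lerNl; move: sr; rewrite ltr0_norm.
  + by rewrite oppr_lt0 s'0 lerN2 s'r.
- exfalso; have := connected_component_sub ccs; rewrite -s0 scale0r addr0.
  by apply; exact: (orb_refl cf Ap).
Qed.

Lemma germ_impl (Q Q' : set (R * R) -> set (R * R)) p v :
  (forall x, Q (orb p) x -> Q' (orb p) x) -> germ Q p v -> germ Q' p v.
Proof. by move=> h [r r0 hr]; exists r => // s /hr /h. Qed.

Lemma germ_and (Q Q' : set (R * R) -> set (R * R)) p v :
  germ Q p v -> germ Q' p v -> exists s, Q (orb p) (p + s *: v) /\ Q' (orb p) (p + s *: v).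
Proof.
move=> [r r0 hr] [r' r'0 hr']; pose s := Num.min r r'; exists s.
by split; [apply: hr|apply: hr']; rewrite /s lt_min r0 r'0 ge_min lexx ?orbT.
Qed.

Lemma far_outside p : A p -> exists u, outside (orb p) u.
Proof.
move=> Ap; have /compact_bounded[M [Mr hM]] := orb_compact cf Ap.
pose a := `|M| + 1; have /hM bd : M < a by rewrite (le_lt_trans (ler_norm M))// ltrDl.
exists (a + 1, 0); apply: (@outside_ray _ _ _ (1, 0)).
  by move=> [/eqP]; rewrite oner_eq0.
move=> t t0 /bd /=; apply/negP; rewrite -ltNge.
apply: lt_le_trans (norm_fst_le _); rewrite /= /GRing.scale/= mulr1.
apply: lt_le_trans (ler_norm _); have : 0 <= `|M| by []; rewrite /a; lra.
Qed.

Lemma inside_component G (a u : R * R) : inside G u -> connected_component (~` G) u a -> inside G a.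
Proof.
move=> [nu bd] h; split; first exact: (connected_component_sub h).
by rewrite -(same_connected_component h).
Qed.

Lemma outside_component G (a u : R * R) : outside G u -> connected_component (~` G) u a -> outside G a.
Proof.
move=> [nu bd] h; split; first exact: (connected_component_sub h).
by rewrite -(same_connected_component h).
Qed.

(* The component of [c] and an unbounded one must lie on different sides: this
   replaces the Jordan curve theorem. *)
Lemma sides p v : A p -> p <> c -> 0 < det (X p) v ->
  (germ (@inside R) p v /\ germ (@outside R) p (- v)) \/
  (germ (@outside R) p v /\ germ (@inside R) p (- v)).
Proof.
move=> Ap pc d0; have ic : inside (orb p) c := cf_inside cf Ap pc.
have [u ou] := far_outside Ap.
have excl w : germ (@inside R) p w -> germ (@outside R) p w -> False.
  by move=> gi go; have [s []] := germ_and gi go; exact: inside_not_outside.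
have hi w := @germ_impl (fun G => connected_component (~` G) c) (@inside R) p w
  (fun x => @inside_component (orb p) x c ic).
have ho w := @germ_impl (fun G => connected_component (~` G) u) (@outside R) p w
  (fun x => @outside_component (orb p) x u ou).
have [/hi gi|/hi gi] := component_side Ap d0 ic.1;
  have [/ho go|/ho go] := component_side Ap d0 ou.1.
- by have := excl _ gi go.
- by left.
- by right.
- by have := excl _ gi go.
Qed.

(** Both the component of [c] and that of [a] must occupy a half of the transversal at [p]. By
    [sides] only one half is inside, so they share points. *)
Lemma inside_same_component p (a : R * R) : A p -> p <> c -> inside (orb p) a ->
  connected_component (~` orb p) c a.
Proof.
move=> Ap pc ia; have ic : inside (orb p) c := cf_inside cf Ap pc.
have d0 := det_perp (cf_neq0 cf Ap pc); set v := perp _ in d0.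
have excl w : germ (@inside R) p w -> germ (@outside R) p w -> False.
  by move=> gi go; have [s []] := germ_and gi go; exact: inside_not_outside.
have hi (b : R * R) (ib : inside (orb p) b) w :=
  @germ_impl (fun G => connected_component (~` G) b) (@inside R) p w
  (fun x => @inside_component (orb p) x b ib).
have join w : germ (fun G => connected_component (~` G) c) p w ->
    germ (fun G => connected_component (~` G) a) p w -> connected_component (~` orb p) c a.
  move=> g1 g2; have [s [h1 h2]] := germ_and g1 g2.
  apply: connected_component_trans h1 _; exact: connected_component_sym.
have [gc|gc] := component_side Ap d0 ic.1;
  have [ga|ga] := component_side Ap d0 ia.1; have [[g1 g2]|[g1 g2]] := sides Ap pc d0;
  by [exact: join gc ga|have := excl _ (hi _ ic _ gc) g1|have := excl _ (hi _ ic _ gc) g2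
     |have := excl _ (hi _ ia _ ga) g1|have := excl _ (hi _ ia _ ga) g2].
Qed.

End Sides.

Lemma perp_continuous (R : realType) : continuous (@perp R).
Proof.
move=> u; apply: lip_at_continuous; exists 1, 1; split=> // a b _ _.
by rewrite mul1r !normE /perp/= -opprD normrN maxC.
Qed.

(** * Transversal segments *)

Section Crossing.
Variables (R : realType) (A : set (R * R)) (X : R * R -> R * R) (c : R * R).
Variable phi : R -> R * R -> R * R.
Hypothesis cf : center_flow A X c phi.
Implicit Types (p q u v z : R * R) (t s r e : R).
Local Notation orb := (orb phi).
Local Notation germ := (germ phi).

(** The tip [p + e *: v] is off the orbit, so [Q] persists around it; the cone estimate then allows
    sliding from a nearby tip down to any smaller [s] without meeting the orbit. *)
Lemma germ_uniform (Q : set (R * R) -> set (R * R)) p v :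
  (forall G C x y, connected C -> C `<=` ~` G -> C x -> C y -> Q G x -> Q G y) ->
  (forall G x, closed G -> Q G x -> \forall y \near x, Q G y) ->
  A p -> 0 < det (X p) v -> germ Q p v ->
  exists2 r, 0 < r & forall p' v' s, orb p p' -> `|p' - p| <= r -> `|v' - v| <= r ->
    0 < s <= r -> Q (orb p) (p' + s *: v').
Proof.
move=> QC QN Ap d0 [r1 r10 g]; have [r r0 cone] := transversal_cone cf Ap d0.
pose e := Num.min r r1; have e0 : 0 < e by rewrite lt_min r0.
have er : e <= r by rewrite ge_min lexx.
have Qe : Q (orb p) (p + e *: v) by apply: g; rewrite e0 ge_min lexx orbT.
have [d d0' hd] := near_norm_le (QN _ _ (orb_closed cf Ap) Qe).
have e1 : 0 < 1 + e by rewrite addr_gt0.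
exists (Num.min e (d / (1 + e))); first by rewrite lt_min e0 divr_gt0.
move=> p' v' s op'; rewrite !le_min => /andP[pe pd] /andP[ve vd] /and3P[s0 se _].
have /andP[pr _] := pe; have /andP[vr _] := ve.
have Q' : Q (orb p) (p' + e *: v').
  apply: hd; rewrite opprD addrACA -scalerBr.
  apply: le_trans (ler_normD _ _) _; rewrite normrZ gtr0_norm//.
  have : d / (1 + e) * (1 + e) = d by rewrite divfK// gt_eqF.
  by move=> <-; rewrite mulrDr mulr1 lerD// mulrC ler_wpM2r// ltW.
apply: (ray_connected (K := fun x => 0 < x <= e) (QC (orb p)) _ _ _ _ Q').
- by move=> x y z; lra.
- move=> x /andP[x0 xe]; apply: cone => //; rewrite gtr0_norm//.
  exact: le_trans xe er.
- by rewrite e0 lexx.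
- by rewrite s0 le_min.
Qed.

Lemma germ_near (Q : set (R * R) -> set (R * R)) p v :
  (forall G C x y, connected C -> C `<=` ~` G -> C x -> C y -> Q G x -> Q G y) ->
  (forall G x, closed G -> Q G x -> \forall y \near x, Q G y) ->
  A p -> 0 < det (X p) v -> germ Q p v ->
  exists2 r, 0 < r & forall p' v', orb p p' -> `|p' - p| <= r -> `|v' - v| <= r ->
    germ Q p' v'.
Proof.
move=> QC QN Ap d0 g; have [r r0 h] := germ_uniform QC QN Ap d0 g.
exists r => // p' v' op' pr vr; exists r => // s sr.
by rewrite (orb_eq cf Ap op'); exact: h.
Qed.

(** The parameters where the left side is inside and those where it is outside form two open sets,
    complementary by [sides]; the line is connected. *)
Lemma germ_path (P V : R -> R * R) p : A p -> p <> c -> continuous P -> continuous V ->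
  (forall t, orb p (P t)) -> (forall t, 0 < det (X (P t)) (V t)) ->
  germ (@inside R) (P 0) (V 0) -> germ (@inside R) (P 1) (V 1).
Proof.
move=> Ap pc cP cV oP dP g0.
have AP t : A (P t) := orb_sub cf Ap (oP t).
have Pc t : P t <> c := orb_neq cf Ap pc (oP t).
pose B (Q : set (R * R) -> set (R * R)) := [set t | germ Q (P t) (V t)].
have oB Q : (forall G C x y, connected C -> C `<=` ~` G -> C x -> C y -> Q G x -> Q G y) ->
    (forall G x, closed G -> Q G x -> \forall y \near x, Q G y) -> open (B Q).
  move=> QC QN; rewrite openE => t Bt.
  have [r r0 hr] := germ_near QC QN (AP t) (dP t) Bt.
  have n1 := near_continuous_lt (cP t) r0; have n2 := near_continuous_lt (cV t) r0.
  apply: filterS2 n1 n2 => x /ltW h1 /ltW h2; apply: hr => //.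
  by rewrite (orb_eq cf Ap (oP t)); exact: oP.
have oI : open (B (@inside R)).
  by apply: oB; [move=> G C x y; exact: inside_connected|move=> G x; exact: near_inside].
have oO : open (B (@outside R)).
  by apply: oB; [move=> G C x y; exact: outside_connected|move=> G x; exact: near_outside].
have eC : B (@inside R) = ~` B (@outside R).
  apply/seteqP; split=> t.
    by move=> gi go; have [s []] := germ_and gi go; exact: inside_not_outside.
  by move=> ngo; have [[]|[]] := sides cf (AP t) (Pc t) (dP t).
have cR : connected [set: R] by apply/connected_intervalP => x y _ _ z _.
have e : B (@inside R) = setT.
  apply: cR; first by exists 0.
    by exists (B (@inside R)); rewrite ?setTI.
  by exists (B (@inside R)); rewrite ?setTI// eC; exact: open_closedC.
by have : B (@inside R) 1 by rewrite e.
Qed.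

(** The transversal is first turned to the normal of the field, then carried along the orbit as the
    normal, then turned to [v']. Hence the side of the interior, left or right, belongs to the orbit
    and not to the point. *)
Lemma germ_transport p p' v v' : A p -> p <> c -> orb p p' ->
  0 < det (X p) v -> 0 < det (X p') v' ->
  germ (@inside R) p v -> germ (@inside R) p' v'.
Proof.
move=> Ap pc op' dv dv'.
have rot q w w' : A q -> q <> c -> 0 < det (X q) w -> 0 < det (X q) w' ->
    germ (@inside R) q w -> germ (@inside R) q w'.
  move=> Aq qc h h' g.
  (* a convex combination up to scaling, defined for all real [t] *)
  pose V t := t ^+ 2 *: w' + (1 - t) ^+ 2 *: w.
  have := @germ_path (cst q) V q Aq qc; rewrite /V subrr subr0 !expr0n/= !expr1n.
  rewrite !scale0r !scale1r add0r addr0; apply=> //.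
  - by move=> t; exact: cvg_cst.
  - move=> t; apply: cvgD; apply: cvgZr_tmp; first exact: exprn_continuous.
    apply: (@continuous_comp _ _ _ (fun t : R => 1 - t) (fun x : R => x ^+ 2)).
      by apply: cvgB; [exact: cvg_cst|exact: cvg_id].
    exact: exprn_continuous.
  - by move=> t; exact: (orb_refl cf Aq).
  - move=> t; rewrite /cst detDr !detZr.
    have [->|t0] := eqVneq t 0; first by rewrite subr0 expr0n expr1n mul0r add0r mul1r.
    rewrite ltr_wpDr//; first by rewrite mulr_ge0 ?sqr_ge0// ltW.
    by rewrite mulr_gt0// exprn_even_gt0.
have Ap' := orb_sub cf Ap op'; have p'c := orb_neq cf Ap pc op'.
have dp := det_perp (cf_neq0 cf Ap pc); have dp' := det_perp (cf_neq0 cf Ap' p'c).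
move=> /(rot _ _ _ Ap pc dv dp) g; apply: (rot _ _ _ Ap' p'c dp' dv').
have [s _ es] := op'; pose P t := phi (t * s) p.
have cP : continuous P.
  move=> t; apply: (@continuous_comp _ _ _ (fun t : R => t * s) (phi^~ p)).
    by apply: cvgMr_tmp; exact: cvg_id.
  exact: (phi_continuous cf p Ap).
have AP t : A (P t) := cf_stable cf _ Ap.
have := @germ_path P (fun t => perp (X (P t))) p Ap pc cP; rewrite /P /= mul1r mul0r es (cf0 cf Ap).
apply=> //.
- move=> t; apply: (@continuous_comp _ _ _ P (fun q => perp (X q))); first exact: cP.
  apply: (@continuous_comp _ _ _ X (@perp R)); first exact: (cf_cont cf (AP t)).
  exact: perp_continuous.
- by move=> t; exact: orb_phi.
- by move=> t; apply: det_perp; apply: (cf_neq0 cf (AP t)); exact: (phi_neq0 cf).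
Qed.

(* Between two consecutive crossings the segment would stay on one side of the
   orbit, yet it leaves to the left and arrives from the right. *)
Lemma single_crossing p n : A p ->
  (forall s, 0 <= s <= 1 -> A (p + s *: n) /\ 0 < det (X (p + s *: n)) n) ->
  ~ orb p (p + n).
Proof.
move=> Ap seg o1; have [_ d0] := seg 0 ltac:(by rewrite lexx ler01).
rewrite scale0r addr0 in d0.
have pc : p <> c.
  move=> pc; move: o1; rewrite pc => -[t _]; rewrite (cf_rest cf).
  move=> /eqP; rewrite -subr_eq0 opprD addNKr oppr_eq0.
  by move/eqP => n0; move: d0; rewrite n0 /det /= !mulr0 subrr ltxx.
have [r r0 cone] := transversal_cone cf Ap d0.
have nin s : 0 < `|s| -> `|s| <= r -> ~ orb p (p + s *: n).
  by apply: cone; rewrite ?subrr ?normr0 ?ltW//; exact: (orb_refl cf Ap).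
pose S := [set s | r <= s /\ orb p (p + s *: n)].
have r1 : r <= 1.
  by rewrite leNgt; apply/negP => r1; apply: (nin 1); rewrite ?normr1 ?ltr01 ?ltW// scale1r.
have S1 : S 1 by split=> //; rewrite scale1r.
have cS : closed S.
  apply: closedI; first exact: closed_ge.
  apply: closed_comp => [t _|]; first exact: line_continuous.
  exact: (orb_closed cf Ap).
have lS : has_lbound S by exists r => s [].
have [rs os] : S (inf S) by apply: closed_inf => //; exists 1.
set s2 := inf S in rs os.
have s21 : s2 <= 1 by exact: ge_inf.
have s20 : 0 < s2 by exact: lt_le_trans r0 rs.
have [As2 ds2] := seg s2 ltac:(by rewrite (ltW s20)).
have s2c := orb_neq cf Ap pc os.
have free s : 0 < s < s2 -> ~ orb p (p + s *: n).
  move=> /andP[sp ss2] os'; have [sr|rs'] := leP s r.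
    by apply: (nin s) os'; rewrite gtr0_norm.
  have : S s by split=> //; exact: ltW.
  by move=> /(ge_inf lS); rewrite leNgt ss2.
have move_ (Q : set (R * R) -> set (R * R)) x y :
    (forall G C a b, connected C -> C `<=` ~` G -> C a -> C b -> Q G a -> Q G b) ->
    0 < x < s2 -> 0 < y < s2 -> Q (orb p) (p + x *: n) -> Q (orb p) (p + y *: n).
  move=> QC hx hy; apply: (ray_connected (K := fun x => 0 < x < s2) (QC (orb p))) => //.
  by move=> a b z; lra.
have eo := orb_eq cf Ap os.
have conflict (Q Q' : set (R * R) -> set (R * R)) :
    (forall G C a b, connected C -> C `<=` ~` G -> C a -> C b -> Q G a -> Q G b) ->
    (forall G a, Q G a -> Q' G a -> False) ->
    germ Q p n -> germ Q' (p + s2 *: n) (- n) -> False.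
  move=> QC QQ' [a a0 ga] [b b0 gb].
  pose x := Num.min a (s2 / 2); pose y := Num.min b (s2 / 2).
  have x0 : 0 < x by rewrite lt_min a0 divr_gt0.
  have y0 : 0 < y by rewrite lt_min b0 divr_gt0.
  have xs : x <= s2 / 2 by rewrite ge_min lexx orbT.
  have ys : y <= s2 / 2 by rewrite ge_min lexx orbT.
  have Qx : Q (orb p) (p + x *: n) by apply: ga; rewrite x0 ge_min lexx.
  have Qy : Q' (orb p) (p + (s2 - y) *: n).
    have := gb y; rewrite y0 ge_min lexx => /(_ isT).
    by rewrite eo scalerBl scalerN addrA.
  apply: QQ' Qy; apply: (move_ Q x) => //; lra.
(* Opposite orientations at the two crossings contradict [germ_transport]. With equal ones, the open
   piece between the crossings would start on one side and end on the other. *)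
have [[gi go]|[go gi]] := sides cf Ap pc d0;
  have [[gi' go']|[go' gi']] := sides cf As2 s2c ds2.
- apply: (conflict (@inside R) (@outside R)) gi go'; last exact: inside_not_outside.
  by move=> G C a b; exact: inside_connected.
- have gi2 := germ_transport Ap pc os d0 ds2 gi.
  by have [s []] := germ_and gi2 go'; exact: inside_not_outside.
- have op : orb (p + s2 *: n) p by rewrite eo; exact: (orb_refl cf Ap).
  have gi2 := germ_transport As2 s2c op ds2 d0 gi'.
  by have [s []] := germ_and gi2 go; exact: inside_not_outside.
- apply: (conflict (@outside R) (@inside R)) go gi'.
    by move=> G C a b; exact: outside_connected.
  by move=> G a h1 h2; exact: inside_not_outside h2 h1.
Qed.

Lemma near_transversal p v e : A p -> 0 < det (X p) v -> 0 < e ->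
  exists2 d, 0 < d & forall s, `|s| <= d ->
    [/\ A (p + s *: v), `|p + s *: v - p| <= e & 0 < det (X (p + s *: v)) v].
Proof.
move=> Ap d0 e0.
have cl := line_continuous p v 0.
have e00 : p + 0 *: v = p by rewrite scale0r addr0.
have n1 : \forall s \near 0, A (p + s *: v).
  by apply: cl; rewrite e00; apply: open_nbhs_nbhs; split=> //; exact: (cf_open cf).
have n2 : \forall s \near 0, `|p + s *: v - p| < e.
  by have := near_continuous_lt cl e0; rewrite e00.
have n3 : \forall s \near 0, 0 < det (X (p + s *: v)) v.
  have h : {for 0, continuous (fun s : R => det (X (p + s *: v)) v)}.
    apply: (@det_continuous R R (fun s : R => X (p + s *: v)) (fun=> v)); last exact: cvg_cst.
    apply: (@continuous_comp _ _ _ (fun s : R => p + s *: v) X) => //.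
    by rewrite e00; exact: (cf_cont cf).
  by have := cvgr_gt _ h; rewrite e00; apply.
have [d dp hd] := near_norm_le (filterI n1 (filterI n2 n3)).
exists d => // s sd; have [|h1 [/ltW h2 h3]] := hd s; first by rewrite subr0.
by split.
Qed.

(** A piece of a transversal segment is again transversal in the sense of [single_crossing], taken
    from the lower of the two points. *)
Lemma section_disjoint p v : A p -> 0 < det (X p) v ->
  exists2 d, 0 < d & forall s t, `|s| <= d -> `|t| <= d ->
    orb (p + s *: v) (p + t *: v) -> s = t.
Proof.
move=> Ap d0; have [d dp hd] := near_transversal Ap d0 ltr01; exists d => // s t.
wlog st : s t / s < t => [hw|] hs ht o.
  have [||//] := ltgtP s t; first by move=> h; exact: hw.
  move=> h; apply/esym/(hw t s) => //; have [As _ _] := hd s hs.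
  exact: (orb_sym cf As o).
exfalso; have [As _ _] := hd s hs.
apply: (@single_crossing (p + s *: v) ((t - s) *: v)) => //; last first.
  by rewrite -addrA -scalerDl [s + _]addrC subrK.
move=> x /andP[x0 x1]; rewrite scalerA -addrA -scalerDl.
have [|h1 _ h2] := hd (s + x * (t - s)).
  have ts0 : 0 <= t - s by rewrite subr_ge0 ltW.
  have : 0 <= x * (t - s) <= t - s by rewrite mulr_ge0// ler_piMl.
  by move: hs ht; rewrite !ler_norml; lra.
by split=> //; rewrite detZr mulr_gt0// subr_gt0.
Qed.

(* Nearby orbits close up after about one period, because their return point
   must be their starting point. *)
Lemma period_bound p v : A p -> 0 < det (X p) v -> exists T d, [/\ 0 < T, 0 < d &
  forall s, `|s| <= d -> A (p + s *: v) /\ orb (p + s *: v) = (phi^~ (p + s *: v)) @` `[0, T]].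
Proof.
move=> Ap d0; have [T T0 pT] := cf_period cf Ap.
have [d1 d10 dis] := section_disjoint Ap d0.
(* The first bound puts the return point in the section, where it must be the starting point; the
   second keeps the period [t + T] positive and at most [T + T / 2]. *)
pose e := Num.min d1 (T / 2); have e0 : 0 < e by rewrite lt_min d10 divr_gt0.
have [d2 d20 sec] := section_point cf Ap d0 e0.
have [d3 d30 hd3] := flow_cont cf T Ap d20.
have [d4 d40 hd4] := near_transversal Ap d0 d30.
exists (T + T / 2), (Num.min d1 d4); split; first by rewrite addr_gt0// divr_gt0.
  by rewrite lt_min d10.
move=> s; rewrite le_min => /andP[sd1 /hd4[As sd3 _]]; split=> //.
have [|_] := hd3 _ T sd3; first by rewrite subrr normr0 ltW.
rewrite pT => /sec[t [s' [te s'e eq]]].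
have es : s = s'.
  apply: dis => //; first by apply: le_trans s'e _; rewrite ge_min lexx.
  by rewrite -eq (cfD cf)//; exact: orb_phi.
rewrite -{}es (cfD cf)// in eq.
have tT : `|t| <= T / 2 by apply: le_trans te _; rewrite ge_min lexx orbT.
have P0 : 0 < t + T by move: tT; rewrite ler_norml; lra.
rewrite (orb_itv cf As P0 eq); apply/seteqP; split.
  move=> _ [x + <-]; rewrite /= in_itv/= => /andP[x0 x1]; exists x => //=.
  by rewrite in_itv/= x0; move: tT; rewrite ler_norml; lra.
rewrite -(orb_itv cf As P0 eq) => _ [x _ <-]; exact: orb_phi.
Qed.

(** By [period_bound] the orbits through a short transversal are covered by one common time
    interval, over which continuous dependence is uniform; a nearby [z'] first flows onto the
    transversal. *)
Lemma orbit_stability z (V : set (R * R)) : A z -> z <> c ->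
  (forall q, orb z q -> nbhs q V) ->
  exists2 d, 0 < d & forall z', `|z' - z| <= d -> A z' /\ orb z' `<=` V.
Proof.
move=> Az zc hV; have d0 := det_perp (cf_neq0 cf Az zc); set v := perp _ in d0.
have [T [d1 [T0 d10 per]]] := period_bound Az d0.
have /compact_near_coveringP cK := @segment_compact R 0 T.
have : \forall s \near (0 : R), `[0, T] `<=` (fun t => V (phi t (z + s *: v))).
  apply: (cK R (nbhs (0 : R))) => t _.
  have [d dp hd] := flow_cont_nbhs cf Az (hV _ (orb_phi phi z t)).
  have [d2 d20 hd2] := near_transversal Az d0 dp.
  have nt : \forall t' \near t, `|t' - t| <= d by exact: near_dist_le.
  have ns : \forall s \near (0 : R), `|s - 0| <= d2 by exact: near_dist_le.
  near=> t' s => /=; have [|_ h _] := hd2 s; first by rewrite -[s]subr0; near: s.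
  by have [|] := hd _ t' h; first by near: t'.
move=> /near_norm_le[d2 d20 hd2].
pose e := Num.min d1 d2; have e0 : 0 < e by rewrite lt_min d10.
have [d dp sec] := section_point cf Az d0 e0.
have [d3 d30 hd3] := flow_cont cf 0 Az ltr01.
exists (Num.min d d3); first by rewrite lt_min dp.
move=> z'; rewrite le_min => /andP[/sec[t [s [_ se eq]]] z'3].
have [|Az' _] := hd3 z' 0 z'3; first by rewrite subrr normr0 ltW.
split=> //; rewrite -(orb_eq cf Az' (orb_phi phi z' t)) eq.
have [|_ ->] := per s; first by apply: le_trans se _; rewrite ge_min lexx.
move=> _ [x hx <-]; apply: (hd2 s _ x) => //.
by rewrite subr0; apply: le_trans se _; rewrite ge_min lexx orbT.
Unshelve. all: by end_near. Qed.

End Crossing.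

(** * Stability of the center and interiors of orbits *)

Section Center.
Variables (R : realType) (A : set (R * R)) (X : R * R -> R * R) (c : R * R).
Variable phi : R -> R * R -> R * R.
Hypothesis cf : center_flow A X c phi.
Implicit Types (p q u v z : R * R) (t s r e : R).
Local Notation orb := (orb phi).

Lemma box_compact p (r : R) : compact [set q : R * R | `|q - p| <= r].
Proof.
rewrite (_ : [set q | _] = `[p.1 - r, p.1 + r] `*` `[p.2 - r, p.2 + r]).
  by apply: compact_setX; exact: segment_compact.
apply/seteqP; split=> q; rewrite /= norm_le_pair !in_itv/= !ler_distl.
  by case/andP.
by move=> [-> ->].
Qed.

Lemma ivt_between (f : R -> R) a b y : continuous f -> f a <= y <= f b ->
  exists t, f t = y.
Proof.
move=> cf' /andP[fa fb]; have cw (x z : R) := @continuous_subspaceT _ _ `[x, z] f cf'.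
have [ab|/ltW ba] := leP a b.
  have [|t _ ft] := @IVT R f a b y ab (cw _ _); last by exists t.
  by rewrite ge_min fa le_max fb orbT.
have [|t _ ft] := @IVT R f b a y ba (cw _ _); last by exists t.
by rewrite ge_min fa le_max fb orbT.
Qed.

Lemma orb_center : orb c = [set c].
Proof.
apply/seteqP; split=> [_ [t _ <-]|_ ->] /=; first exact: (cf_rest cf).
by exists 0; rewrite // (cf_rest cf).
Qed.

(** There is no transversal at [c]. Instead, the orbits through a small sphere around [c] keep a
    common distance [i] from [c], by compactness and [orbit_stability]; an orbit starting within [i]
    therefore cannot reach the sphere. *)
Lemma center_stability e : 0 < e -> exists2 r, 0 < r &
  forall z, `|z - c| <= r -> A z /\ forall q, orb z q -> `|q - c| < e.
Proof.
move=> e0; have Ac := cf_center cf.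
have [r0 r00 hr0] : exists2 r : R, 0 < r & forall z, `|z - c| <= r -> A z.
  by apply: near_norm_le; apply: open_nbhs_nbhs; split=> //; exact: (cf_open cf).
pose rho := Num.min e r0; have rho0 : 0 < rho by rewrite lt_min e0.
pose S := [set q : R * R | `|q - c| = rho].
have cS : compact S.
  apply: (subclosed_compact _ (@box_compact c rho)); last by move=> q /= ->.
  apply: (@closed_comp _ _ (fun q : R * R => `|q - c|) [set rho]); last exact: closed_eq.
  by move=> q _; apply: cvg_norm; apply: cvgB; [exact: cvg_id|exact: cvg_cst].
have SA q : S q -> A q by move=> Sq; apply: hr0; rewrite Sq ge_min lexx orbT.
have Sc q : S q -> q <> c.
  by move=> Sq e1; move: rho0; rewrite -Sq e1 subrr normr0 ltxx.
move: cS => /compact_near_coveringP cS.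
have : \forall i \near (0 : R)^'+, S `<=` (fun w => forall q, orb w q -> i < `|q - c|).
  apply: (cS R (0^'+)%classic) => w Sw.
  have Aw := SA w Sw; have wc := Sc w Sw.
  have nc : ~ orb w c by move=> /(orb_neq cf Aw wc).
  have [d d0 hd] := closedC_ball (orb_closed cf Aw) nc.
  have far q : orb w q -> d < `|q - c|.
    move=> oq; rewrite ltNge; apply/negP => /hd h.
    exact: h (segm_right _ _) oq.
  have [|d2 d20 hd2] := @orbit_stability _ _ _ _ _ cf w [set q | d < `|q - c|] Aw wc.
    move=> q /far dq; have h : {for q, continuous (fun q : R * R => `|q - c|)}.
      by apply: cvg_norm; apply: cvgB; [exact: cvg_id|exact: cvg_cst].
    exact: (cvgr_gt _ h _ dq).
  have nw : \forall w' \near w, `|w' - w| <= d2 by exact: near_dist_le.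
  near=> w' i => /= q oq; have [|_ h] := hd2 w'; first by near: w'.
  apply: lt_trans (h q oq); near: i; exact: nbhs_right_lt.
move=> hi; near (0 : R)^'+ => i.
have i0 : 0 < i by [].
have hS : S `<=` (fun w => forall q, orb w q -> i < `|q - c|) by near: i.
exists (Num.min i (rho / 2)); first by rewrite lt_min i0 divr_gt0.
move=> z; rewrite le_min => /andP[zi zr].
have zrho : `|z - c| < rho by apply: le_lt_trans zr _; rewrite ltr_pdivrMr// ltr_pMr// ltr1n.
have Az : A z by apply: hr0; rewrite (le_trans (ltW zrho))// ge_min lexx orbT.
split=> // q oq; apply: (@lt_le_trans _ _ rho); last by rewrite ge_min lexx.
rewrite ltNge; apply/negP => qrho; case: oq qrho => t _ <- qrho.
have [||s es] := @ivt_between (fun t => `|phi t z - c|) 0 t rho.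
- move=> x; apply: cvg_norm; apply: cvgB; last exact: cvg_cst.
  exact: (phi_continuous cf z Az).
- by rewrite (cf0 cf Az) (ltW zrho).
have := hS _ es z; rewrite (orb_eq cf Az (orb_phi phi z s)) => /(_ (orb_refl cf Az)).
by rewrite ltNge zi.
Unshelve. all: by end_near. Qed.

Lemma component_open G u : closed G -> open (connected_component (~` G) u).
Proof.
move=> cG; rewrite openE => w ccw.
have nw := connected_component_sub ccw.
have [r r0 h] := closedC_ball cG nw.
have := near_dist_le w r0; apply: filterS => x /h hx.
apply: connected_component_trans ccw _.
exact: (cc_connected (segm_connected w x) hx (segm_left _ _) (segm_right _ _)).
Qed.

(* The set of the [z] whose orbit surrounds a given point outside [A] is open
   and closed in [A], and does not contain [c]. *)
Lemma inside_sub z : connected A -> A z -> z <> c -> inside (orb z) `<=` A.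
Proof.
move=> cA Az zc q iq; apply: contrapT => nAq.
pose I := [set w | [/\ A w, w <> c & inside (orb w) q]].
have Ac := cf_center cf; have oA := cf_open cf.
have qc : q - c <> 0 by move=> /eqP; rewrite subr_eq0 => /eqP e; apply: nAq; rewrite e.
have closedK (K : set (R * R)) : compact K -> closed K.
  by apply: compact_closed; exact: norm_hausdorff.
have nA w : A w -> \forall w' \near w, A w' by move=> Aw; exact: open_nbhs_nbhs.
have oI : open I.
  rewrite openE => w [Aw wc iqw].
  have cG := orb_closed cf Aw.
  have ccq := inside_same_component cf Aw wc iqw.
  have ncw := (cf_inside cf Aw wc).1.
  have [K [cK kK KW Kc Kq]] := open_connected_join (component_open (u := c) cG)
    (@component_connected _ _ _) (connected_component_refl ncw) ccq.
  have [|d d0 hd] := @orbit_stability _ _ _ _ _ cf w (~` K) Aw wc.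
    move=> p op; apply: open_nbhs_nbhs; split; first exact: closed_openC (closedK _ cK).
    by move=> /KW /connected_component_sub.
  have n1 := near_dist_le w d0.
  have n2 : \forall w' \near w, `|w' - w| < `|w - c|.
    by apply: near_dist_lt; rewrite normr_gt0 subr_eq0; exact/eqP.
  apply: filterS2 n1 n2 => w' /hd[Aw' hw'] w'w.
  have w'c : w' <> c by move=> e; move: w'w; rewrite e distrC ltxx.
  split=> //; apply: (inside_connected kK _ Kc Kq); last exact: (cf_inside cf Aw' w'c).
  by move=> x Kx /hw'.
have oAI : open (A `\` I).
  rewrite openE => w [Aw nIw].
  have [->|/eqP wc] := eqVneq w c.
    (* Orbits starting close to [c] stay nearer to [c] than [q] does, so the ray from [q] away from
       [c] avoids them. *)
    have [|r r0 hr] := @center_stability `|q - c|; first by rewrite normr_gt0; exact/eqP.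
    have := near_dist_le c r0; apply: filterS => w' /hr[Aw' hw']; split=> // -[_ _].
    move=> /inside_not_outside; apply; apply: (outside_ray qc) => t t0 /hw'.
    rewrite addrAC -[X in X + _]scale1r -scalerDl normrZ ger0_norm ?addr_ge0//.
    by apply/negP; rewrite -leNgt ler_peMl// lerDl.
  have nqw : ~ orb w q by move=> /(orb_sub cf Aw).
  have oq : outside (orb w) q.
    by have [iqw|//] := inside_or_outside nqw; exfalso; apply: nIw.
  have cG := orb_closed cf Aw.
  have /compact_bounded[M [Mr hM]] := orb_compact cf Aw.
  pose M' := `|M| + 1; have /hM bd : M < M' by rewrite (le_lt_trans (ler_norm M))// ltrDl.
  (* The unbounded component of [q] contains a point [u] farther out than the orbit and its
     neighbours: the ray from the origin through [u] shows that [u] is outside the latter, and [q]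
     is joined to [u] off them. *)
  have [u ccu uM] : exists2 u, connected_component (~` orb w) q u & M' + 1 < `|u|.
    apply: contrapT => h; apply: oq.2; exists (M' + 1); split; first exact: num_real.
    move=> x Mx u ccu /=; rewrite leNgt; apply/negP => ux; apply: h; exists u => //.
    exact: lt_trans Mx ux.
  have [K [cK kK KW Kq Ku]] := open_connected_join (component_open (u := q) cG)
    (@component_connected _ _ _) (connected_component_refl nqw) ccu.
  have [|d d0 hd] := @orbit_stability _ _ _ _ _ cf w (~` K `&` [set p | `|p| < M' + 1]) Aw wc.
    move=> p op; apply: filterI.
      apply: open_nbhs_nbhs; split; first exact: closed_openC (closedK _ cK).
      by move=> /KW /connected_component_sub.
    have h : {for p, continuous (fun q : R * R => `|q|)} by exact: norm_continuous.
    by apply: (cvgr_lt _ h); rewrite (le_lt_trans (bd p op))// ltrDl.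
  have := near_dist_le w d0; apply: filterS => w' /hd[Aw' hw']; split=> // -[_ _].
  move=> /inside_not_outside; apply.
  apply: (outside_connected kK _ Ku Kq); first by move=> x Kx /hw'[].
  have u0 : u <> 0 by move=> u0; move: uM; rewrite u0 normr0 ltNge !addr_ge0.
  apply: (outside_ray u0) => t t0 /hw'[_ /=]; apply/negP; rewrite -leNgt.
  rewrite -{1}[u]scale1r -scalerDl normrZ ger0_norm ?addr_ge0//.
  by rewrite (le_trans (ltW uM))// ler_peMl// lerDl.
have e : I = A.
  apply: cA.
  - by exists z.
  - by exists I => //; apply/seteqP; split=> [w|w []//]; split=> //; case: H.
  - exists (~` (A `\` I)); first exact: open_closedC.
    apply/seteqP; split=> w; first by move=> Iw; split; [case: Iw|move=> []].
    by move=> [Aw h]; apply: contrapT => nI; apply: h.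
by have : I c; [rewrite e|case].
Qed.

End Center.

(** * The orbit tangent to the switching line *)

Section TangentOrbit.
Variables (R : realType) (A : set (R * R)) (X : R * R -> R * R) (c : R * R).
Variable phi : R -> R * R -> R * R.
Hypothesis cf : center_flow A X c phi.
Implicit Types (p q u v z : R * R) (t s r e x y : R).
Local Notation orb := (orb phi).

Lemma orbit_min_tangent z q : A z -> orb z q ->
  (forall q', orb z q' -> q.2 <= q'.2) -> (X q).2 = 0.
Proof.
move=> Az [t _ <-] hmin; have d s := is_derive_snd (cf_derive cf s Az).
have := @derive1_at_min R (snd \o phi^~ z) (t - 1) (t + 1) t.
have t1 : t \in `]t - 1, t + 1[ by rewrite in_itv/= gtrBl ltrDl ltr01.
have t2 : t - 1 <= t + 1 by lra.
move=> /(_ t2 (fun s _ => @ex_derive _ _ _ _ _ _ _ (d s)) t1 _)[].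
  by move=> s _; apply: hmin; exact: orb_phi.
by move=> _ <-; case: (d t).
Qed.

Lemma snd_continuous : continuous (@snd R R).
Proof. by move=> [a b]; exact: cvg_snd. Qed.

Lemma fst_continuous : continuous (@fst R R).
Proof. by move=> [a b]; exact: cvg_fst. Qed.

Lemma near_snd_gt q y : y < q.2 -> \forall p \near q, y < p.2.
Proof. by move=> h; exact: (cvgr_gt _ (snd_continuous (x := q)) _ h). Qed.

Lemma near_snd_lt q y : q.2 < y -> \forall p \near q, p.2 < y.
Proof. by move=> h; exact: (cvgr_lt _ (snd_continuous (x := q)) _ h). Qed.

(** Orbits in [y > 0] and orbits that dip below [y = 0] form two open sets. The first contains [c]
    but not [(x0, 0)], so they do not cover [A]. An orbit in neither set attains its minimum at
    height 0, which is a tangency and hence the fold. *)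
Lemma tangent_orbit : connected A -> 0 < c.2 -> (exists x, A (x, 0)) ->
  (forall x, A (x, 0) -> (X (x, 0)).2 = 0 -> x = 0) ->
  A (0, 0) /\ forall q, orb (0, 0) q -> 0 <= q.2 /\ (q.2 = 0 -> q = (0, 0)).
Proof.
move=> cA hc [x0 Ax0] htan; have oA := cf_open cf.
pose S1 := [set z | A z /\ forall q, orb z q -> 0 < q.2].
have [z [Az nS1 nS2]] : exists z, [/\ A z, ~ S1 z & forall q, orb z q -> 0 <= q.2].
  apply: contrapT => hno.
  have alt z : A z -> ~ S1 z -> exists2 q, orb z q & q.2 < 0.
    move=> Az nS1; apply: contrapT => hq; apply: hno; exists z; split=> // q oq.
    by rewrite leNgt; apply/negP => q0; apply: hq; exists q.
  have oS1 : open S1.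
    rewrite openE => z [Az hz]; have [->|/eqP zc] := eqVneq z c.
      have [r r0 hr] := center_stability cf hc.
      have := near_dist_le c r0; apply: filterS => z' /hr[Az' h]; split=> // q /h qc.
      have := le_lt_trans (norm_snd_le (q - c)) qc.
      by rewrite ltr_norml => /andP[h1 _]; move: h1 => /=; lra.
    have [|d d0 hd] := @orbit_stability _ _ _ _ _ cf z [set q | 0 < q.2] Az zc.
      by move=> q /hz; exact: near_snd_gt.
    by have := near_dist_le z d0; apply: filterS => z' /hd.
  have oS2 : open (A `\` S1).
    rewrite openE => z [Az /(alt _ Az)[_ [t _ <-] q0]].
    have [d d0 hd] := flow_cont_nbhs cf Az (near_snd_lt q0).
    have := near_dist_le z d0; apply: filterS => z' /hd h.
    have [|Az' h0] := h t; first by rewrite subrr normr0 ltW.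
    by split=> // -[_ /(_ _ (orb_phi phi z' t))]; rewrite ltNge (ltW h0).
  have e : S1 = A.
    apply: cA.
    - exists c; split; first exact: (cf_center cf).
      by move=> q; rewrite (orb_center cf) => ->.
    - by exists S1 => //; apply/seteqP; split=> [w|w []//]; split=> //; case: H.
    - exists (~` (A `\` S1)); first exact: open_closedC.
      apply/seteqP; split=> w; first by move=> Iw; split; [case: Iw|move=> []].
      by move=> [Aw h]; apply: contrapT => nI; apply: h.
  have : S1 (x0, 0) by rewrite e.
  by move=> [_ /(_ _ (orb_refl cf Ax0))]; rewrite ltxx.
have flat q : orb z q -> q.2 = 0 -> q = (0, 0).
  move=> oq q0; have Xq : (X q).2 = 0.
    by apply: (orbit_min_tangent Az oq) => q' /nS2; rewrite q0.
  move: oq q0 Xq; case: q => a b /= oq b0; rewrite b0 in oq *.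
  by move=> /(htan _ (orb_sub cf Az oq)) ->.
have [q oq q0] : exists2 q, orb z q & q.2 = 0.
  apply: contrapT => h; apply: nS1; split=> // q oq.
  by rewrite lt_neqAle nS2// andbT; apply/eqP => e; apply: h; exists q.
have oo : orb z (0, 0) by rewrite -(flat q oq q0).
split; first exact: (orb_sub cf Az oo).
by move=> q'; rewrite (orb_eq cf Az oo) => oq'; split; [exact: nS2|exact: flat].
Qed.

End TangentOrbit.

(** * The tangency curve near the fold *)

Section Fold.
Variable R : realType.
Implicit Types (f : R * R -> R) (U : set (R * R)) (p q : R * R) (x y e s t : R).

Lemma derive_ge0_right (f : R -> R) (d : R) : is_derive (0 : R) 1 f d -> f 0 = 0 ->
  (\forall x \near (0 : R), 0 < x -> 0 < f x) -> 0 <= d.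
Proof.
move=> /is_derive_cvgP hf f0 /near_norm_le[r r0 hr]; rewrite leNgt; apply/negP => d0.
have hn : \forall x \near (0 : R)^', x^-1 *: (f (x *: 1 + 0) - f 0) < 0.
  exact: (cvgr_lt _ hf _ d0).
move: hn; rewrite near_withinE => /near_norm_le[r' r'0 hr'].
pose x := Num.min r r'; have x0 : 0 < x by rewrite lt_min r0.
have xr : `|x - 0| <= r by rewrite subr0 gtr0_norm// ge_min lexx.
have xr' : `|x - 0| <= r' by rewrite subr0 gtr0_norm// ge_min lexx orbT.
have := hr' x xr'; rewrite gt_eqF// => /(_ isT).
rewrite f0 subr0 addr0 /GRing.scale/= mulr1 pmulr_rlt0 ?invr_gt0//.
by rewrite ltNge (ltW (hr x xr x0)).
Qed.

(* With [f] the second component of a field whose first component exceeds [b],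
   [fb_slope] bounds the slope of the tangency curve [f = 0] and [fb_small]
   makes the field transversal to the chords of this curve. *)
Record fold_box f (b r K : R) : Prop := FoldBox {
  fb_mono : forall x x' y, `|x| <= r -> `|x'| <= r -> `|y| <= r -> x < x' ->
    f (x, y) < f (x', y);
  fb_slope : forall p q, `|p| <= r -> `|q| <= r -> f p = 0 -> f q = 0 ->
    `|p.1 - q.1| <= K * `|p.2 - q.2|;
  fb_small : forall p, `|p| <= r -> `|f p| * K < b;
  fb_zero : forall e, 0 < e -> e <= r -> K * e < r ->
    exists2 x, `|x| <= K * e & f (x, e) = 0 }.

(** On a small square the [x]-derivative exceeds [kap] and the [y]-derivative is below [M], so zeros
    form a graph over the [y]-axis of slope at most [K = M / kap], and [f] has opposite signs at the
    abscissas [- (K * e)] and [K * e]. [K] is fixed first, so the square may be shrunk later. *)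
Lemma fold_box_exists k U f (b : R) : open U -> Ck_on k.+1 U f -> U (0, 0) ->
  f (0, 0) = 0 -> 0 < 'D_(1, 0) f (0, 0) -> 0 < b ->
  exists r K, [/\ 0 < r, 0 < K & forall r', r' <= r -> fold_box f b r' K].
Proof.
move=> oU h U0 f0 d0 b0; have [_ _ c1 c2] := Ck_onS h U0.
pose kap := 'D_(1, 0) f (0, 0) / 2; have k0 : 0 < kap by rewrite divr_gt0.
pose M := `|'D_(0, 1) f (0, 0)| + 1; have M0 : 0 < M by rewrite ltr_wpDl.
pose K := M / kap; have K0 : 0 < K by rewrite divr_gt0.
have n0 : \forall q \near (0, 0) : R * R, U q by exact: open_nbhs_nbhs.
have n1 : \forall q \near (0, 0) : R * R, kap < 'D_(1, 0) f q.
  by apply: (cvgr_gt _ c1); rewrite ltr_pdivrMr// ltr_pMr// ltr1n.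
have n2 : \forall q \near (0, 0) : R * R, `|'D_(0, 1) f q| < M.
  by apply: (cvgr_lt _ (cvg_norm c2)); rewrite ltrDl.
have n3 : \forall q \near (0, 0) : R * R, `|f q| < b / K.
  have cf : {for (0, 0), continuous f} by case: h => + _; apply.
  by apply: (cvgr_lt _ (cvg_norm cf)); rewrite f0 normr0 divr_gt0.
have [r r0 hr] := near_norm_le (filterI (filterI n0 n1) (filterI n2 n3)).
have {}hr q : `|q| <= r -> [/\ U q, kap < 'D_(1, 0) f q, `|'D_(0, 1) f q| < M & `|f q| < b / K].
  by move=> qr; have [|[h1 h2] [h3 h4]] := hr q; first by rewrite (_ : q - (0, 0) = q)// subr0.
exists r, K; split=> // r' r'r.
have hx x x' y : `|x| <= r' -> `|x'| <= r' -> `|y| <= r' -> x <= x' ->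
    kap * (x' - x) <= f (x', y) - f (x, y).
  move=> xr x'r yr xx'.
  have B s : x <= s <= x' -> `|(s, y)| <= r.
    move=> sx; rewrite normE ge_max/= (le_trans yr)// andbT (le_trans _ r'r)//.
    by have := @dist_itv R r' s x x' 0 sx; rewrite !subr0; apply.
  have [s /B/hr[]//|s /B/hr[_ hk _ _] ->] := mvt_row h xx' (y := y).
  by rewrite ler_wpM2r ?subr_ge0// ltW.
have hy x y y' : `|x| <= r' -> `|y| <= r' -> `|y'| <= r' ->
    `|f (x, y') - f (x, y)| <= M * `|y' - y|.
  wlog yy' : y y' / y <= y' => [hw|] xr yr y'r.
    have [/hw|/ltW/hw] := leP y y'; first exact.
    by move=> /(_ xr y'r yr); rewrite distrC [`|y - y'|]distrC.
  have B s : y <= s <= y' -> `|(x, s)| <= r.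
    move=> sx; rewrite normE ge_max/= (le_trans xr)//= (le_trans _ r'r)//.
    by have := @dist_itv R r' s y y' 0 sx; rewrite !subr0; apply.
  have [s /B/hr[]//|s /B/hr[_ _ hk _] ->] := mvt_col h yy' (x := x).
  by rewrite normrM ler_wpM2r// ltW.
split.
- move=> x x' y xr x'r yr xx'; rewrite -subr_gt0.
  by apply: lt_le_trans (hx _ _ _ xr x'r yr (ltW xx')); rewrite mulr_gt0// subr_gt0.
- move=> [x y] [x' y'] /= pr qr fp fq.
  wlog xx' : x y x' y' pr qr fp fq / x <= x' => [hw|].
    have [xx'|/ltW xx'] := leP x x'; first exact: hw.
    by rewrite distrC [`|y - y'|]distrC; exact: hw.
  have [xr yr] : `|x| <= r' /\ `|y| <= r' by apply/andP; rewrite -ge_max.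
  have [x'r y'r] : `|x'| <= r' /\ `|y'| <= r' by apply/andP; rewrite -ge_max.
  have h1 := hx x x' y xr x'r yr xx'; have h2 := hy x' y y' x'r yr y'r.
  rewrite distrC ger0_norm ?subr_ge0// /K mulrAC ler_pdivlMr// mulrC.
  apply: le_trans h1 _; rewrite fp subr0 (le_trans (ler_norm _))//.
  by rewrite distrC -[`|f (x', y)|]normrN -[- f _]add0r -{1}fq.
- by move=> p /le_trans/(_ r'r)/hr[_ _ _]; rewrite ltr_pdivlMr.
- move=> e e0 er Ker; have Ke0 : 0 <= K * e by rewrite mulr_ge0 ?ltW.
  have er' : `|e| <= r' by rewrite gtr0_norm.
  have r'0 : 0 <= r' by exact: le_trans (ltW e0) er.
  have K1 : `|K * e| <= r' by rewrite ger0_norm// ltW.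
  have K2 : `|- (K * e)| <= r' by rewrite normrN.
  have z0 : `|(0 : R)| <= r' by rewrite normr0.
  have := hy 0 0 e z0 z0 er'; rewrite f0 !subr0 (gtr0_norm e0) ler_norml => /andP[b1 b2].
  have e1 : kap * (K * e) = M * e by rewrite mulrA /K [kap * _]mulrC divfK// gt_eqF.
  have := hx 0 (K * e) e z0 K1 er' Ke0; rewrite subr0 e1 => h1.
  have := hx (- (K * e)) 0 e K2 z0 er'; rewrite oppr_le0 sub0r opprK e1 => /(_ Ke0) h2.
  have NK : - (K * e) <= K * e by clear -Ke0; lra.
  have cw : {within `[- (K * e), K * e], continuous (fun x => f (x, e))}.
    apply: is_derive_continuous_itv => x hx'; apply: is_derive_row.
    have [Uq _ _ _] : [/\ U (x, e), kap < 'D_(1, 0) f (x, e),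
        `|'D_(0, 1) f (x, e)| < M & `|f (x, e)| < b / K].
      apply: hr; rewrite normE ge_max/= (le_trans er')// andbT.
      apply: le_trans r'r; apply: le_trans (ltW Ker).
      by rewrite ler_norml.
    by have [] := Ck_onS h Uq.
  have [|x] := @IVT R (fun x => f (x, e)) _ _ 0 NK cw.
    by rewrite ge_min le_max; apply/andP; split; apply/orP; [left|right]; clear -b1 b2 h1 h2; lra.
  by rewrite in_itv/= -ler_norml; exists x.
Qed.

End Fold.

(** * Labels of the orbits near the tangent one *)

Section Strip.
Variables (R : realType) (A : set (R * R)) (X : R * R -> R * R) (c : R * R).
Variable phi : R -> R * R -> R * R.
Hypothesis cf : center_flow A X c phi.
Implicit Types (p q u v z w : R * R) (t s r e x y : R).
Local Notation orb := (orb phi).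

(** The section is vertical, of half-length [d], through the fold. [fs_good] confines every visit of
    these orbits below height [eps] to the box of radius [r0], the place where the lower field is
    under control. [fs_out] orders the orbits, and the common time of [fs_period] makes bands of
    them compact. *)
Record fold_strip (r0 eps d : R) : Prop := FoldStrip {
  fs_pos : 0 < d;
  fs_A : forall s, `|s| <= d -> A (0, s);
  fs_det : forall s, `|s| <= d -> 0 < det (X (0, s)) (0, 1);
  fs_uniq : forall s t, `|s| <= d -> `|t| <= d -> orb (0, s) (0, t) -> s = t;
  fs_good : forall s q, `|s| <= d -> orb (0, s) q -> eps < q.2 \/ `|q| < r0;
  fs_out : forall s t, `|t| <= d -> s < t -> outside (orb (0, t)) (0, s);
  fs_period : exists T, forall s, `|s| <= d -> orb (0, s) = (phi^~ (0, s)) @` `[0, T] }.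

Lemma vertical_pt s : (0, 0) + s *: (0, 1) = (0, s) :> R * R.
Proof. by rewrite scale_pairE /= mulr0 mulr1 /GRing.add/= /add_pair/= !add0r. Qed.

Lemma vertical_ptD t s : (0, t) + s *: (0, 1) = (0, t + s) :> R * R.
Proof. by rewrite scale_pairE /= mulr0 mulr1 /GRing.add/= /add_pair/= add0r. Qed.

Lemma norm_vertical s : `|(0, s) : R * R| = `|s|.
Proof. by rewrite normE/= normr0 max_r. Qed.

Lemma outside_below (G : set (R * R)) q y : (forall p, G p -> y <= p.2) -> q.2 < y ->
  outside G q.
Proof.
move=> hG qy; apply: (@outside_ray _ _ _ (0, -1)).
  by move=> [/eqP]; rewrite oppr_eq0 oner_eq0.
move=> t t0 /hG; rewrite /= /GRing.scale/=; lra.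
Qed.

Lemma fold_strip_exists r0 : 0 < r0 -> A (0, 0) -> 0 < (X (0, 0)).1 ->
  (forall q, orb (0, 0) q -> 0 <= q.2 /\ (q.2 = 0 -> q = (0, 0))) ->
  exists eps d, [/\ 0 < eps & fold_strip r0 eps d].
Proof.
move=> r00 Ao X1 tan.
have d0 : 0 < det (X (0, 0)) (0, 1) by rewrite /det/= mulr1 mulr0 subr0.
have oc : (0, 0) <> c.
  move=> oc; have := cf_derive cf 0 Ao; rewrite (cf0 cf Ao) => d.
  move: d0; suff -> : X (0, 0) = 0 by rewrite /det /= !mul0r subrr ltxx.
  have dc : is_derive (0 : R) 1 (phi^~ (0, 0)) 0.
    rewrite (_ : phi^~ (0, 0) = cst c); first exact: is_derive_cst.
    by apply/funext => t; rewrite oc (cf_rest cf).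
  by case: d => _ <-; case: dc => _ <-.
(* The tangent orbit has height 0 only at the fold, so by compactness its part outside the box has
   height bounded below. *)
have [e1 e10 he1] : exists2 e : R, 0 < e & forall q, orb (0, 0) q -> q.2 <= e -> `|q| < r0.
  have /compact_near_coveringP cK := orb_compact cf Ao.
  have : \forall i \near (0 : R)^'+, orb (0, 0) `<=` (fun q => q.2 <= i -> `|q| < r0).
    apply: (cK R (0^'+)%classic) => q /tan[q0 qo].
    have [/qo ->|/eqP qn] := eqVneq q.2 0.
      have n : \forall q' \near (0, 0) : R * R, `|q'| < r0.
        by apply: (cvgr_lt _ (@norm_continuous _ _ ((0, 0) : R * R))); rewrite normE/= normr0 maxxx.
      by near=> q' i => /= _; near: q'.
    have qp : 0 < q.2 / 2 by rewrite divr_gt0// lt_neqAle eq_sym q0 andbT; exact/eqP.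
    have qlt : q.2 / 2 < q.2 by lra.
    have n := near_snd_gt qlt.
    near=> q' i => /= le; exfalso.
    have h1 : q.2 / 2 < q'.2 by near: q'.
    have h2 : i < q.2 / 2 by near: i; exact: nbhs_right_lt.
    lra.
  move=> h; near (0 : R)^'+ => i; exists i => // q oq.
  exact: (near h i).
have [d1 d10 uniq] := section_disjoint cf Ao d0.
have [T [d2 [T0 d20 per]]] := period_bound cf Ao d0.
have [d3 d30 tr] := near_transversal cf Ao d0 ltr01.
pose eps := e1 / 2; have eps0 : 0 < eps by rewrite divr_gt0.
(* The condition [- d1 < q.2] serves [fs_out]: a vertical ray going down from the section can meet a
   nearby orbit only within the section, where a second meeting is excluded by [uniq]. *)
pose V := [set q : R * R | - d1 < q.2 /\ (eps < q.2 \/ `|q| < r0)].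
have [|d4 d40 stab] := @orbit_stability _ _ _ _ _ cf (0, 0) V Ao oc.
  move=> q oq; have [q0 _] := tan q oq.
  have dq : - d1 < q.2 by lra.
  have n1 := near_snd_gt dq.
  suff n2 : \forall p \near q, eps < p.2 \/ `|p| < r0 by exact: (filterI n1 n2).
  have [qe|qe] := ltP eps q.2.
    by have := near_snd_gt qe; apply: filterS => p; left.
  have qr : `|q| < r0 by apply: he1 => //; rewrite (le_trans qe)// /eps; lra.
  have n3 : \forall p \near q, `|p| < r0 by exact: (cvgr_lt _ (@norm_continuous _ _ q) _ qr).
  by move: n3; apply: filterS => p; right.
pose d := Num.min (Num.min d1 d2) (Num.min d3 d4).
have dd : [/\ d <= d1, d <= d2, d <= d3 & d <= d4].
  by rewrite !ge_min !lexx !orbT.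
case: dd => dd1 dd2 dd3 dd4.
have V_ s : `|s| <= d -> orb (0, s) `<=` V.
  move=> sd; have [|//] := stab (0, s).
  rewrite (_ : (0, s) - (0, 0) = (0, s) :> R * R); last exact: subr0.
  by rewrite norm_vertical (le_trans sd).
have Ad s : `|s| <= d -> A (0, s).
  by move=> sd; have [|+ _] := per s; [exact: le_trans sd dd2|rewrite vertical_pt].
exists eps, d; split=> //; split=> //.
- by rewrite !lt_min d10 d20 d30.
- by move=> s sd; have [|_ _] := tr s; [exact: le_trans sd dd3|rewrite vertical_pt].
- move=> s t sd td o; apply: uniq; rewrite ?vertical_pt//; [exact: le_trans sd dd1|exact: le_trans td dd1].
- by move=> s q sd /(V_ s sd)[].
- move=> s t td st; apply: (@outside_ray _ _ _ (0, -1)).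
    by move=> [/eqP]; rewrite oppr_eq0 oner_eq0.
  move=> x x0; rewrite (_ : (0, s) + x *: (0, -1) = (0, s - x) :> R * R); last first.
    by rewrite scale_pairE /= mulr0 mulrN1 /GRing.add/= /add_pair/= add0r.
  move=> o; have [hV _] := V_ t td _ o; rewrite /= in hV.
  have xt : s - x < t by rewrite (le_lt_trans _ st)// gerBl.
  have td1 : `|t| <= d1 := le_trans td dd1.
  have : t = s - x.
    apply: uniq; rewrite ?vertical_pt//; move: td1; rewrite !ler_norml; lra.
  by move=> e; move: xt; rewrite -e ltxx.
- by exists T => s sd; have [|_] := per s; [exact: le_trans sd dd2|rewrite vertical_pt].
Unshelve. all: by end_near. Qed.

Section Labels.
Variables r0 eps d : R.
Hypothesis fs : fold_strip r0 eps d.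

(* The label of [q] is the height at which its orbit crosses the segment
   [{0} * [-d, d]]. *)
Definition lab q s := A q /\ orb q (0, s).

Lemma lab_vertical s : `|s| <= d -> lab (0, s) s.
Proof. by move=> sd; split; [|apply: (orb_refl cf)]; exact: fs_A fs _ sd. Qed.

Lemma lab_orb q s : lab q s -> orb q = orb (0, s).
Proof. by move=> [Aq o]; rewrite (orb_eq cf Aq o). Qed.

Lemma lab_uniq q s t : `|s| <= d -> `|t| <= d -> lab q s -> lab q t -> s = t.
Proof.
move=> sd td ls [_ ot]; apply: (fs_uniq fs) => //; by rewrite -(lab_orb ls).
Qed.

Lemma lab_phi q s t : lab q s -> lab (phi t q) s.
Proof.
move=> [Aq o]; split; first exact: (cf_stable cf).
by rewrite (orb_eq cf Aq (orb_phi phi q t)).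
Qed.

Lemma lab_neq q s : `|s| <= d -> lab q s -> q <> c.
Proof.
move=> sd [Aq o] qc; move: o; rewrite qc (orb_center cf) => /= e.
have [h _] := det_gt0_neq0 (fs_det fs sd).
move: h; rewrite e; have := cf_derive cf 0 (cf_center cf).
rewrite (cf_rest cf) => dX; apply.
have dc : is_derive (0 : R) 1 (phi^~ c) 0.
  rewrite (_ : phi^~ c = cst c); first exact: is_derive_cst.
  by apply/funext => t; rewrite (cf_rest cf).
by case: dX => _ <-; case: dc => _ <-.
Qed.

Lemma lab_good q s : `|s| <= d -> lab q s -> eps < q.2 \/ `|q| < r0.
Proof.
move=> sd l; apply: (fs_good fs sd); rewrite -(lab_orb l).
by case: l => Aq _; exact: (orb_refl cf Aq).
Qed.

(** Below [(0, s)] lies the outside, by [fs_out]; [sides] then leaves the inside above. *)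
Lemma germ_up s : `|s| <= d -> germ phi (@inside R) (0, s) (0, 1).
Proof.
move=> sd; have As := fs_A fs sd; have sc := lab_neq sd (lab_vertical sd).
have [[]//|[_ [r r_0 h]]] := sides cf As sc (fs_det fs sd).
have : inside (orb (0, s)) ((0, s) + r *: - (0, 1)) by apply: h; rewrite r_0 lexx.
rewrite scalerN -scaleNr vertical_ptD => /inside_not_outside; case.
by apply: (fs_out fs) => //; rewrite gtrBl.
Qed.

Lemma lab_in q s t : `|s| <= d -> `|t| <= d -> lab q s -> t < s -> inside (orb (0, t)) q.
Proof.
move=> sd td l ts; have At := fs_A fs td.
have i1 : inside (orb (0, t)) (0, s).
  have [r r_0 h] := germ_up td; pose x := Num.min r (s - t).
  have x0 : 0 < x by rewrite lt_min r_0 subr_gt0.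
  have := h x; rewrite x0 ge_min lexx => /(_ isT).
  rewrite (_ : (0, s) = (0, t) + (s - t) *: (0, 1) :> R * R); last by rewrite vertical_ptD addrC subrK.
  apply: (ray_connected (K := fun x => 0 < x <= s - t)).
  - by move=> C a b; exact: inside_connected.
  - by move=> a b z; lra.
  - move=> y /andP[y0 yst]; rewrite vertical_ptD => o.
    have : t = t + y by apply: (fs_uniq fs) => //; move: sd td; rewrite !ler_norml; lra.
    lra.
  - by rewrite x0 ge_min lexx orbT.
  - by rewrite subr_gt0 ts lexx.
apply: (inside_connected (orb_connected cf l.1)) i1; last 2 first.
- exact: l.2.
- exact: (orb_refl cf l.1).
move=> p op o; have : t = s; last by move=> e; move: ts; rewrite e ltxx.
apply: (fs_uniq fs) => //; rewrite -(orb_eq cf At o) (orb_eq cf l.1 op); exact: l.2.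
Qed.

Lemma lab_out q s t : `|s| <= d -> `|t| <= d -> lab q s -> s < t -> outside (orb (0, t)) q.
Proof.
move=> sd td l ts; have At := fs_A fs td.
apply: (outside_connected (orb_connected cf l.1)) (fs_out fs td ts); last 2 first.
- exact: l.2.
- exact: (orb_refl cf l.1).
move=> p op o; have : t = s; last by move=> e; move: ts; rewrite e ltxx.
apply: (fs_uniq fs) => //; rewrite -(orb_eq cf At o) (orb_eq cf l.1 op); exact: l.2.
Qed.

(** The flow carries a neighbourhood of [q] close to [(0, s)], where [section_point] brings it onto
    the section. *)
Lemma lab_near q s e : lab q s -> `|s| <= d -> 0 < e -> exists2 r, 0 < r &
  forall q', `|q' - q| <= r -> exists2 s', `|s' - s| <= e & lab q' s'.
Proof.
move=> [Aq [t _ et]] sd e0.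
have [r1 r10 sec] := section_point cf (fs_A fs sd) (fs_det fs sd) e0.
have [r r_0 hr] := flow_cont cf t Aq r10.
exists r => // q' /hr h; have [|Aq' h1] := h t; first by rewrite subrr normr0 ltW.
rewrite et in h1; have [t' [s' [_ s'e eq]]] := sec _ h1.
exists (s + s'); first by rewrite addrC addKr.
by split=> //; rewrite -vertical_ptD -eq (cfD cf)//; exact: orb_phi.
Qed.

Definition band a b : set (R * R) := [set q | exists2 s, a <= s <= b & lab q s].

(** The band is the image under the flow of a rectangle of labels and times. *)
Lemma band_compact a b : - d <= a -> b <= d -> compact (band a b).
Proof.
move=> da bd; have [T per] := fs_period fs.
have ad s : a <= s <= b -> `|s| <= d by rewrite ler_norml; lra.
rewrite (_ : band a b = (fun w : R * R => phi w.2 (0, w.1)) @` (`[a, b] `*` `[0, T])).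
  apply: continuous_compact; last by apply: compact_setX; exact: segment_compact.
  apply: continuous_in_subspaceT => -[s t] /set_mem[/= + _]; rewrite in_itv/= => /ad sd.
  apply/cvgrPdist_le => e e0; have [r r_0 hr] := flow_cont cf t (fs_A fs sd) e0.
  have := near_dist_le (s, t) r_0; apply: filterS => -[s' t'].
  rewrite norm_le_pair/= => /andP[h1 h2]; rewrite distrC.
  have h3 : `|((0, s') : R * R) - (0, s)| <= r by rewrite norm_le_pair/= subrr normr0 h1 andbT ltW.
  by have [] := hr _ _ h3 h2.
apply/seteqP; split=> [q [s sab l]|_ [[s t] [/= + _] <-]].
  have : orb (0, s) q by rewrite -(lab_orb l); exact: (orb_refl cf l.1).
  rewrite (per s (ad s sab)) => -[t tT <-]; exists (s, t) => //=; split=> //=.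
rewrite in_itv/= => sab; exists s => //; apply: lab_phi; exact: lab_vertical (ad s sab).
Qed.

End Labels.
End Strip.

Lemma derive_lt0_right (R : realType) (f : R -> R) (t d : R) :
  is_derive t 1 f d -> d < 0 ->
  exists2 tau, 0 < tau & forall x, 0 < x <= tau -> f (t + x) < f t.
Proof.
move=> /is_derive_cvgP hf d0.
have hn : \forall x \near (0 : R)^', x^-1 *: (f (x *: 1 + t) - f t) < 0.
  exact: (cvgr_lt _ hf _ d0).
move: hn; rewrite near_withinE => /near_norm_le[r r0 hr]; exists r => // x /andP[x0 xr].
have := hr x; rewrite subr0 gtr0_norm// gt_eqF// => /(_ xr isT).
by rewrite /GRing.scale/= mulr1 pmulr_rlt0 ?invr_gt0// subr_lt0 addrC.
Qed.

Lemma derive_gt0_right (R : realType) (f : R -> R) (t d : R) :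
  is_derive t 1 f d -> 0 < d ->
  exists2 tau, 0 < tau & forall x, 0 < x <= tau -> f t < f (t + x).
Proof.
move=> hf d0; have hN : is_derive t 1 (- f) (- d) by exact: is_deriveN.
have [|tau tau0 h] := derive_lt0_right hN; first by rewrite oppr_lt0.
by exists tau => // x /h; rewrite fctE ltrN2.
Qed.

(** * The label as a Lyapunov function *)

Section Climb.
Variables (R : realType) (A : set (R * R)) (X : R * R -> R * R) (c : R * R).
Variable phi : R -> R * R -> R * R.
Hypothesis cf : center_flow A X c phi.
Variables r0 eps d e he : R.
Variable ze : R * R.
Hypothesis fs : fold_strip A X phi r0 eps d.
Hypothesis e_eps : e < eps.
Hypothesis he_d : - d < he < d.
Hypothesis lab_top : forall q, lab A phi q he -> e <= q.2.
Hypothesis lab_ze : lab A phi ze he.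
Hypothesis tangency : forall q, `|q| < r0 -> q.2 = e -> (X q).2 = 0 -> q = ze.
Variable Y : R * R -> R * R.
Local Notation lab := (lab A phi).
Local Notation band := (band A phi).
Hypothesis Y_above : forall q, band (- d) d q -> e <= q.2 -> Y q = X q.
Hypothesis Y_below : forall q, band (- d) d q -> q.2 < e -> 0 < det (X q) (Y q).
Hypothesis Y_lip : forall q, band (- d) d q -> lip_at Y q.
Implicit Types (p q u v z w : R * R) (t s r x y tau : R) (g : R -> R * R).
Local Notation orb := (orb phi).

Definition solution (F : R * R -> R * R) g := forall t, 0 <= t -> is_derive t 1 g (F (g t)).

Lemma lab_bandT q s : `|s| <= d -> lab q s -> band (- d) d q.
Proof. by rewrite ler_norml => sd l; exists s. Qed.

Lemma solution_shift F g t : 0 <= t -> solution F g -> solution F (fun x => g (x + t)).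
Proof. by move=> t0 hg x x0; apply: is_derive_shiftr; apply: hg; rewrite addr_ge0. Qed.

Lemma solution_continuous F g t : solution F g -> 0 <= t -> {for t, continuous g}.
Proof. by move=> hg t0; exact: is_derive_continuous (hg t t0). Qed.

(** Uniqueness is applied to [Y], which is Lipschitz on the band: the [X]-orbit also solves the
    equation of [Y] while it stays in [y >= e]. *)
Lemma solution_agree g t0 tau : solution Y g -> 0 <= t0 -> band (- d) d (g t0) ->
  (forall t, 0 <= t <= tau -> e <= (phi t (g t0)).2) ->
  forall t, 0 <= t <= tau -> g (t0 + t) = phi t (g t0).
Proof.
move=> hg t00 [s sd l] habove t tt; rewrite addrC.
have B x : band (- d) d (phi x (g t0)) by exists s => //; exact: (lab_phi cf).
apply: (@ode_unique R Y (fun x => g (x + t0)) (phi^~ (g t0)) tau) => //.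
- by move=> x /andP[x0 _]; exact: solution_shift.
- by move=> x xt; rewrite (Y_above (B x) (habove x xt)); exact: (cf_derive cf x l.1).
- by move=> x _; apply: Y_lip; exact: B.
- by rewrite add0r (cf0 cf l.1).
Qed.

(** [Y w] points to the left of [X w], where the interior lies. The difference quotients of [g] tend
    to [Y w], so the solution enters the interior of the orbit of [w], that is, larger labels. *)
Lemma label_increases g t0 s b : solution Y g -> 0 <= t0 -> lab (g t0) s -> `|s| < d ->
  (g t0).2 < e -> 0 < b -> exists2 tau, 0 < tau &
  forall t, 0 < t <= tau -> exists2 s', s < s' <= s + b & lab (g (t0 + t)) s'.
Proof.
move=> hg t00 l sd below b0; set w := g t0 in l below *.
have sd' := ltW sd; have Aw := l.1; have wc := lab_neq cf fs sd' l.
have dw := Y_below (lab_bandT sd' l) below.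
pose b' := Num.min b (d - `|s|); have b'0 : 0 < b' by rewrite lt_min b0 subr_gt0.
have As := fs_A fs sd'.
have gi : germ phi (@inside R) w (Y w).
  have os : orb (0, s) w by rewrite -(lab_orb cf l); exact: (orb_refl cf Aw).
  have sc := lab_neq cf fs sd' (lab_vertical cf fs sd').
  exact: (germ_transport cf As sc os (fs_det fs sd') dw (germ_up cf fs sd')).
have QC (G C : set (R * R)) (x y : R * R) : connected C -> C `<=` ~` G -> C x -> C y ->
  inside G x -> inside G y by exact: inside_connected.
have QN (G : set (R * R)) (x : R * R) : closed G -> inside G x -> \forall y \near x, inside G y.
  exact: near_inside.
have [r r_0 hr] := germ_uniform cf QC QN Aw dw gi.
have [r1 r10 hr1] := lab_near cf fs l sd' b'0.
have hn : \forall x \near (0 : R)^', `|x^-1 *: (g (x *: 1 + t0) - g t0) - Y w| < r.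
  have /is_derive_cvgP hd := hg t0 t00.
  by move/cvgrPdist_lt: hd => /(_ r r_0); apply: filterS => x; rewrite distrC.
move: hn; rewrite near_withinE => /near_norm_le[r2 r20 hr2].
have [r3 r30 hr3] := near_norm_le (near_continuous_lt (solution_continuous hg t00) r10).
pose tau := Num.min r (Num.min r2 r3).
exists tau; first by rewrite !lt_min r_0 r20.
move=> t /andP[tp]; rewrite !le_min => /and3P[tr t2 t3].
have [|s' ss' l'] := hr1 (g (t0 + t)).
  by apply: ltW; apply: hr3; rewrite addrC addKr gtr0_norm.
exists s' => //; have s'd : `|s'| <= d.
  rewrite -(subrK s s') (le_trans (ler_normD _ _))// -lerBrDr (le_trans ss')//.
  by rewrite ge_min lexx orbT.
have s'b : s' <= s + b.
  move: ss'; rewrite ler_norml => /andP[_]; rewrite lerBlDl => /le_trans; apply.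
  by rewrite lerD2l ge_min lexx.
rewrite s'b andbT.
have ins : inside (orb w) (g (t0 + t)).
  pose v' := t^-1 *: (g (t0 + t) - w).
  have -> : g (t0 + t) = w + t *: v'.
    by rewrite /v' scalerA mulfV ?gt_eqF// scale1r [w + _]addrC subrK.
  apply: hr; rewrite ?subrr ?normr0 ?(ltW r_0)//; last by rewrite tp.
    exact: (orb_refl cf Aw).
  have := hr2 t; rewrite subr0 gtr0_norm// gt_eqF// => /(_ t2 isT).
  by rewrite /GRing.scale/= mulr1 [t + t0]addrC => /ltW.
rewrite (lab_orb cf l) in ins.
rewrite ltNge; apply/negP; rewrite le_eqVlt => /orP[/eqP es|lt].
  case: ins => + _; apply; rewrite -es -(lab_orb cf l'); exact: (orb_refl cf l'.1).
exact: inside_not_outside ins (lab_out cf fs s'd sd' l' lt).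
Qed.

(** The band is closed, which settles the limit step of real induction; there remains the behaviour
    just after each time. *)
Lemma climb g a b s0 U : a <= b -> - d <= s0 -> U <= d ->
  (forall t, a <= t <= b -> {for t, continuous g}) -> band s0 U (g a) ->
  (forall t s, a <= t < b -> s0 <= s <= U -> lab (g t) s ->
     exists2 tau, 0 < tau & forall t', t < t' < t + tau ->
       exists2 s', s <= s' <= U & lab (g t') s') ->
  forall t, a <= t <= b -> band s0 U (g t).
Proof.
move=> ab ds Ud cg ga step; apply: real_induction => //.
  move=> t tab ih; have [s sU l] := ih t ltac:(by move: tab => /andP[-> _]; rewrite lexx).
  have [tau tau0 h] := step t s tab sU l; exists tau => // t' /h[s' s'U l'].
  by exists s' => //; lra.
move=> t /andP[at_ tb] ih; apply: contrapT => nb.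
have cB : closed (band s0 U).
  by apply: compact_closed; [exact: norm_hausdorff|exact: (band_compact cf fs)].
have ct := cg t ltac:(by rewrite (ltW at_)).
have : \forall x \near t, (~` band s0 U) (g x).
  by apply: ct; apply: open_nbhs_nbhs; split=> //; exact: closed_openC.
move=> /near_norm_le[r r_0 hr]; pose x := Num.max a (t - r).
have xt : x < t by rewrite gt_max at_ gtrBl.
apply: (hr x); last by apply: ih; rewrite le_max lexx.
rewrite ltr0_norm ?subr_lt0// opprB lerBlDl -lerBlDr le_max lexx orbT//.
Qed.

Lemma lab_below_lt q s : - d <= s <= he -> lab q s -> q.2 < e -> s < he.
Proof.
move=> /andP[_]; rewrite le_eqVlt => /orP[/eqP ->|//] /lab_top h.
by rewrite ltNge h.
Qed.

(* Just after a time [t], either the solution follows its [X]-orbit in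
   [y >= e] and the label is constant, or it is in [y < e] and the label
   increases; on the line [y = e] the sign of the second component of [X]
   decides, the tangency [ze] being on the orbit of label [he]. *)
Lemma band_invariant g t1 s1 : solution Y g -> 0 <= t1 -> lab (g t1) s1 -> - d < s1 <= he ->
  forall t, t1 <= t -> band s1 he (g t).
Proof.
move=> hg t10 l1 /andP[ds1 s1he] b t1b; have [dhe hed] := andP he_d.
have abs s : s1 <= s <= he -> `|s| < d by rewrite ltr_norml; lra.
have cg t : t1 <= t -> {for t, continuous g}.
  by move=> h; apply: solution_continuous hg _; exact: le_trans h.
have strict t s : t1 <= t -> - d < s <= he -> lab (g t) s -> (g t).2 < e ->
    exists2 tau, 0 < tau & forall t', t < t' < t + tau ->
      exists2 s', s <= s' <= he & lab (g t') s'.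
  move=> tt sU l below; have she : s < he by apply: (lab_below_lt _ l below); lra.
  have sd : `|s| < d by rewrite ltr_norml; lra.
  have gap : 0 < he - s by rewrite subr_gt0.
  have [tau tau0 h] := label_increases hg (le_trans t10 tt) l sd below gap.
  exists tau => // t' tt'; have [|s' ss'] := h (t' - t); first by lra.
  by rewrite [t + _]addrC subrK => l'; exists s' => //; lra.
apply: (@climb g t1 b s1 he t1b (ltW ds1) (ltW hed)) => //; last by rewrite t1b lexx.
- by move=> t /andP[/cg].
- by exists s1 => //; rewrite lexx.
move=> t s /andP[t1t tb] sU l; set w := g t.
have t0 : 0 <= t := le_trans t10 t1t.
have sd := abs s sU; have sd' := ltW sd; have Kw : band (- d) d w := lab_bandT sd' l.
have stay tau : 0 < tau -> (forall x, 0 <= x <= tau -> e <= (phi x w).2) ->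
    exists2 tau, 0 < tau & forall t', t < t' < t + tau ->
      exists2 s', s <= s' <= he & lab (g t') s'.
  move=> tau0 h; exists tau => // t' tt'; exists s; first by rewrite lexx; case/andP: sU.
  rewrite (_ : t' = t + (t' - t)); last by rewrite addrC subrK.
  rewrite (solution_agree hg t0 Kw h); last by lra.
  exact: (lab_phi cf).
have [below|above] := ltP w.2 e; first by apply: strict => //; lra.
have phi2 := is_derive_snd (cf_derive cf 0 l.1); rewrite (cf0 cf l.1) -/w in phi2.
have [eq_e|ne] := eqVneq w.2 e; last first.
  have gt : e < w.2 by rewrite lt_neqAle eq_sym ne.
  have [|r r_0 hr] := flow_cont_nbhs cf l.1 (t0 := 0) (U := [set q | e < q.2]).
    by rewrite (cf0 cf l.1); exact: near_snd_gt.
  apply: (stay r) => // x /andP[x0 xr]; apply: ltW.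
  by have [||] := hr w x; rewrite ?subrr ?normr0 ?subr0 ?ger0_norm// ltW.
have [X0|X0|X0] := ltgtP (X w).2 0.
(* The orbit of label [he] stays in [y >= e], so it cannot cross the line downwards. *)
- have she : s < he.
    case/andP: sU => _; rewrite le_eqVlt => /orP[/eqP es|//]; exfalso.
    have [tau tau0 h] := derive_lt0_right phi2 X0.
    have := h tau; rewrite tau0 lexx => /(_ isT); rewrite /= add0r (cf0 cf l.1) -/w eq_e.
    by rewrite ltNge lab_top//; apply: (lab_phi cf); rewrite -es.
  have g2 := is_derive_snd (hg t t0); rewrite -/w (Y_above Kw above) in g2.
  have [tau tau0 hbelow] := derive_lt0_right g2 X0.
  have gap : 0 < Num.min (he - s) (d - `|s|) by rewrite lt_min !subr_gt0 she.
  have [r1 r10 hr1] := lab_near cf fs l sd' gap.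
  have labd s' : `|s' - s| <= Num.min (he - s) (d - `|s|) -> `|s'| <= d.
    move=> h; rewrite -(subrK s s') (le_trans (ler_normD _ _))// -lerBrDr.
    by rewrite (le_trans h)// ge_min lexx orbT.
  have [r2 r20 hr2] := near_norm_le (near_continuous_lt (cg t t1t) r10).
  exists (Num.min tau r2); first by rewrite lt_min tau0.
  move=> t' /andP[tt' t't].
  have t'tau : t' - t <= tau.
    by rewrite lerBlDl; apply: ltW; apply: lt_le_trans t't _; rewrite lerD2l ge_min lexx.
  have t'r : t' - t <= r2.
    by rewrite lerBlDl; apply: ltW; apply: lt_le_trans t't _; rewrite lerD2l ge_min lexx orbT.
  have bel x : t < x <= t' -> (g x).2 < e.
    move=> tx; have := hbelow (x - t); rewrite /= [t + _]addrC subrK -/w eq_e; apply; lra.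
  have near_lab x : t < x <= t' -> exists s', [/\ s' <= he, `|s'| <= d & lab (g x) s'].
    move=> tx; have [|s' ss' l'] := hr1 (g x).
      apply: ltW; apply: hr2; rewrite ger0_norm ?subr_ge0; lra.
    exists s'; split; [|exact: labd ss'|exact: l'].
    have : `|s' - s| <= he - s by rewrite (le_trans ss')// ge_min lexx.
    by rewrite ler_norml; lra.
  have [s' [s'he s'd l']] := near_lab t' ltac:(by rewrite tt' lexx).
  (* [label_increases] does not apply at time [t], on the line itself. If the label [s'] at [t']
     were below [s], continuity at [t] would give a slightly later time [a] with label above [s'];
     from [a] on the solution is in [y < e] and the label cannot come down to [s']. *)
  exists s' => //; rewrite s'he andbT leNgt; apply/negP => s's.
  have gap2 : 0 < Num.min ((s - s') / 2) (Num.min (he - s) (d - `|s|)).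
    by rewrite lt_min gap divr_gt0// subr_gt0.
  have [r3 r30 hr3] := lab_near cf fs l sd' gap2.
  have [r4 r40 hr4] := near_norm_le (near_continuous_lt (cg t t1t) r30).
  pose a := Num.min t' (t + r4).
  have ta : t < a by rewrite lt_min tt' ltrDl.
  have at' : a <= t' by rewrite ge_min lexx.
  have ar : a - t <= r4 by rewrite lerBlDl ge_min lexx orbT.
  have [|sa ssa la] := hr3 (g a).
    by apply: ltW; apply: hr4; rewrite ger0_norm// subr_ge0 ltW.
  have sa1 : s' < sa.
    have : `|sa - s| <= (s - s') / 2 by rewrite (le_trans ssa)// ge_min lexx.
    by rewrite ler_norml; lra.
  have [s'a [s'ahe l'ad l'a]] := near_lab a ltac:(by rewrite ta at').
  have sad : `|sa| <= d.
    by apply: labd; rewrite (le_trans ssa)// ge_min lexx orbT.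
  have esa := lab_uniq cf fs sad l'ad la l'a.
  have : band sa he (g t').
    have at1 x : a <= x <= t' -> t1 <= x by move=> /andP[ax _]; rewrite (le_trans t1t)// (le_trans (ltW ta)).
    apply: (@climb g a t' sa he at') => //.
    - by move: sad; rewrite ler_norml => /andP[].
    - exact: ltW.
    - by move=> x /at1; exact: cg.
    - by exists sa => //; rewrite lexx esa.
    - move=> x sx /andP[ax xt'] /andP[sax sxhe] lx; apply: strict => //.
      + by apply: at1; rewrite ax ltW.
      + by move: s'd; rewrite ler_norml sxhe andbT; lra.
      + by apply: bel; rewrite (lt_le_trans ta ax) ltW.
    - by rewrite at' lexx.
  move=> [s'' s''U l'']; have es : s' = s''.
    apply: (lab_uniq cf fs s'd _ l' l''); move: s'd; rewrite !ler_norml; lra.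
  by move: s''U; rewrite -es; lra.
- have [tau tau0 h] := derive_gt0_right phi2 X0.
  apply: (stay tau) => // x /andP[x0 xt].
  have [->|xn0] := eqVneq x 0; first by rewrite (cf0 cf l.1).
  have := h x; rewrite lt_neqAle eq_sym xn0 x0 xt => /(_ isT).
  by rewrite /= add0r (cf0 cf l.1) -/w eq_e => /ltW.
- have wr : `|w| < r0.
    have [h|//] := lab_good cf fs sd' l; move: h; rewrite eq_e => h.
    by have := lt_trans h e_eps; rewrite ltxx.
  have wze := tangency wr eq_e X0.
  apply: (stay 1) => // x _; apply: lab_top; apply: (lab_phi cf).
  by rewrite wze.
Qed.

Lemma label_monotone g s1 s2 t1 t2 : solution Y g -> 0 <= t1 <= t2 ->
  - d < s1 <= he -> - d < s2 <= he -> lab (g t1) s1 -> lab (g t2) s2 -> s1 <= s2.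
Proof.
move=> hg /andP[t10 t12] s1U s2U l1 l2; have [dhe hed] := andP he_d.
have [s sU l] := band_invariant hg t10 l1 s1U t12.
have -> : s2 = s by apply: (lab_uniq cf fs _ _ l2 l); rewrite ler_norml; lra.
by case/andP: sU.
Qed.

End Climb.

(** * Existence and convergence of the outer solutions *)

Section Attract.
Variables (R : realType) (A : set (R * R)) (X : R * R -> R * R) (c : R * R).
Variable phi : R -> R * R -> R * R.
Hypothesis cf : center_flow A X c phi.
Variables r0 eps d e he : R.
Variable ze : R * R.
Hypothesis fs : fold_strip A X phi r0 eps d.
Hypothesis e_eps : e < eps.
Hypothesis he_d : - d < he < d.
Hypothesis lab_top : forall q, lab A phi q he -> e <= q.2.
Hypothesis lab_ze : lab A phi ze he.
Hypothesis ze_e : ze.2 = e.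
Hypothesis tangency : forall q, `|q| < r0 -> q.2 = e -> (X q).2 = 0 -> q = ze.
Variable Z : R * R -> R * R.
Local Notation lab := (lab A phi).
Local Notation band := (band A phi).
Hypothesis X_lip : forall q, A q -> lip_at X q.
Hypothesis Z_above : forall q, band (- d) d q -> e <= q.2 -> Z q = X q.
Hypothesis Z_below : forall q, band (- d) d q -> q.2 < e -> 0 < det (X q) (Z q).
Hypothesis Z_lip : forall q, band (- d) d q -> lip_at Z q.
Implicit Types (p q u v z w : R * R) (t s r x y tau : R) (g : R -> R * R).
Local Notation orb := (orb phi).

(* The field is extended from the compact band to a Lipschitz field on the
   plane, whose solutions do not leave the band. *)
Lemma forward_exists w s1 : lab w s1 -> - d < s1 <= he ->
  exists g, [/\ g 0 = w, solution Z g & forall t, 0 <= t -> band s1 he (g t)].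
Proof.
move=> l s1U; have [dhe hed] := andP he_d; pose K := band (- d) d.
have cK : compact K by exact: (band_compact cf fs).
have Kw : K w by exists s1 => //; lra.
have [L L0 lipL] := lip_compact cK Z_lip.
have K0 : K !=set0 by exists w.
have [F lF FE] := mcshane_pair K0 L0 lipL.
have L1 : 0 < L + 1 by rewrite ltr_wpDl.
have [a b|g g0 hg] := @picard R F (L + 1) w L1.
  by apply: le_trans (lF a b) _; rewrite ler_wpM2r// lerDl.
have inv t : 0 <= t -> band s1 he (g t).
  apply: (band_invariant cf fs e_eps he_d lab_top lab_ze tangency (Y := F)) => //.
  - by move=> q Kq; rewrite FE//; exact: Z_above.
  - by move=> q Kq; rewrite FE//; exact: Z_below.
  - by move=> q Kq; exists L, 1; split.
  - by rewrite g0.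
exists g; split=> // t t0; rewrite -FE; first exact: hg.
by have [s sU ls] := inv t t0; exists s => //; lra.
Qed.

(* The interior of an orbit in [y >= e] is contained in [y >= e], whereas it
   would contain a neighborhood of [ze]. *)
Lemma low_orbit_dips w s : lab w s -> - d < s < he -> exists2 q, orb w q & q.2 < e.
Proof.
move=> l sU; have [dhe hed] := andP he_d; apply: contrapT => hno.
have above q : orb w q -> e <= q.2.
  by move=> oq; rewrite leNgt; apply/negP => h; apply: hno; exists q.
have hd : `|he| <= d by rewrite ler_norml; lra.
have sd : `|s| <= d by rewrite ler_norml; lra.
have she : s < he by lra.
have izw : inside (orb w) ze by rewrite (lab_orb cf l); exact: (lab_in cf fs hd sd lab_ze she).
have [r r_0 hr] := near_norm_le (near_inside (orb_closed cf l.1) izw).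
have : inside (orb w) (ze - (0, r)).
  apply: hr; rewrite addrAC subrr add0r normrN norm_vertical.
  by rewrite gtr0_norm.
move=> /inside_not_outside; apply; apply: (outside_below above).
by rewrite /= ze_e gtrBl.
Qed.

(** A visit to [y < e] would raise the label strictly. So the solution stays where [Z] is [X], and
    therefore runs through the whole periodic orbit of [w]. *)
Lemma constant_label_above g w s : solution Z g -> g 0 = w -> - d < s <= he ->
  (forall t, 0 <= t -> lab (g t) s) -> forall q, orb w q -> e <= q.2.
Proof.
move=> hg g0 sU const; have [dhe hed] := andP he_d.
have sd : `|s| < d by rewrite ltr_norml; lra.
have B t : 0 <= t -> band (- d) d (g t) by move=> t0; exact: (lab_bandT (ltW sd) (const t t0)).
have above t : 0 <= t -> e <= (g t).2.
  move=> t0; rewrite leNgt; apply/negP => below.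
  have db : 0 < Num.min 1 (d - s) by rewrite lt_min ltr01 subr_gt0; move: sd; rewrite ltr_norml; lra.
  have [tau tau0 h] := label_increases cf fs Z_below hg t0 (const t t0) sd below db.
  have [|s' /andP[ss' s'b] l'] := h tau; first by rewrite tau0 lexx.
  have tt : 0 <= t + tau by rewrite addr_ge0// ltW.
  have s'd : `|s'| <= d.
    have : Num.min 1 (d - s) <= d - s by rewrite ge_min lexx orbT.
    by move: sd; rewrite ltr_norml ler_norml; lra.
  have es := lab_uniq cf fs s'd (ltW sd) l' (const _ tt).
  by move: ss'; rewrite es ltxx.
have Aw : A w by rewrite -g0; exact: (const 0 (lexx _)).1.
have agree t : 0 <= t -> g t = phi t w.
  move=> t0; apply: (@ode_unique R X g (phi^~ w) t) => //.
  - by move=> x /andP[x0 _]; rewrite -(Z_above (B x x0) (above x x0)); exact: hg.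
  - by move=> x _; exact: (cf_derive cf x Aw).
  - by move=> x _; apply: X_lip; exact: (cf_stable cf).
  - by rewrite g0 (cf0 cf Aw).
  - by rewrite t0 lexx.
have [T T0 pT] := cf_period cf Aw.
move=> q; rewrite (orb_itv cf Aw T0 pT) => -[t + <-].
by rewrite /= in_itv/= => /andP[t0 _]; rewrite -agree//; exact: above.
Qed.

(* LaSalle: if the label tends to [sig < he], then it is constant on the solution
   through a limit point, which is therefore an orbit of [X] in [y >= e]. *)
Lemma solution_converges g s0 : solution Z g -> lab (g 0) s0 -> - d < s0 <= he ->
  tends_to_set g (orb (0, he)).
Proof.
move=> hg l0 s0U; have [dhe hed] := andP he_d.
have hed' : `|he| <= d by rewrite ler_norml; lra.
have inv t : 0 <= t -> band s0 he (g t).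
  exact: (band_invariant cf fs e_eps he_d lab_top lab_ze tangency Z_above Z_below Z_lip hg (lexx _) l0 s0U).
have /choice[h hh] : forall t, exists s, 0 <= t -> s0 <= s <= he /\ lab (g t) s.
  move=> t; have [t0|t0] := leP 0 t; last by exists 0.
  by have [s sU l] := inv t t0; exists s.
have hU t : 0 <= t -> - d < h t <= he by move=> /hh[]; lra.
have mono t t' : 0 <= t <= t' -> h t <= h t'.
  move=> /andP[t0 tt']; have t'0 := le_trans t0 tt'.
  apply: (label_monotone cf fs e_eps he_d lab_top lab_ze tangency Z_above Z_below Z_lip
    hg _ _ _ (hh t t0).2 (hh t' t'0).2).
  - by rewrite t0.
  - exact: hU.
  - exact: hU.
pose S := [set h t | t in [set t : R | 0 <= t]].
have S0 : S !=set0 by exists (h 0), 0 => //=.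
have Sb : has_ubound S by exists he => _ [t /= t0 <-]; have := hU t t0; lra.
pose sig := sup S.
have h_sig t : 0 <= t -> h t <= sig by move=> t0; apply: ub_le_sup => //; exists t.
have sig_he : sig <= he by apply: ge_sup => // _ [t /= t0 <-]; have := hU t t0; lra.
have sig_d : - d < sig by have := h_sig 0 (lexx _); have := hU 0 (lexx _); lra.
have tail x : 0 < x -> exists2 T, 0 <= T & forall t, T <= t -> sig - x < h t.
  move=> x0; have [_ [T /= T0 <-] lt] := sup_adherent x0 (conj S0 Sb).
  by exists T => // t Tt; apply: lt_le_trans lt _; apply: mono; rewrite T0.
have [esig|nsig] := eqVneq sig he; last first.
  exfalso; have sig_lt : sig < he by rewrite lt_neqAle nsig.
  have cB : compact (band s0 he) by apply: (band_compact cf fs); lra.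
  have FB : \forall t \near +oo%R, band s0 he (g t).
    by near=> t; apply: inv.
  have [w [[sw swU lw] clw]] := cB (g @ +oo%R) _ FB.
  have often r T : 0 < r -> 0 <= T -> exists2 t, T <= t & `|g t - w| <= r.
    move=> r_0 T0; have FT : \forall t \near +oo%R, (g @` [set t | T <= t]) (g t).
      by near=> t; exists t => //=.
    have [_ [[t Tt <-] h']] := clw _ _ FT (near_dist_le w r_0).
    by exists t.
  have sig_abs s r : `|s - sig| <= r -> `|s| <= `|sig| + r.
    by move=> h'; rewrite -(subrK sig s) (le_trans (ler_normD _ _))// addrC lerD2l.
  have sig_lt_d : `|sig| < d by rewrite ltr_norml; lra.
  (* Every point approached at arbitrarily late times has label [sig], by continuity of the label.
     This is used for the limit point [w] and then for the whole solution [xi] through it. *)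
  have limit q : (exists2 sq, `|sq| < d & lab q sq) ->
      (forall r T, 0 < r -> 0 <= T -> exists2 t, T <= t & `|g t - q| <= r) -> lab q sig.
    move=> [sq sqd lq] near_q; suff : sq = sig by move=> <-.
    apply/eqP; rewrite -subr_eq0 -normr_le0 leNgt; apply/negP => gap.
    pose x := Num.min (`|sq - sig| / 3) (d - `|sq|).
    have x0 : 0 < x by rewrite lt_min divr_gt0// subr_gt0.
    have [r r_0 hr] := lab_near cf fs lq (ltW sqd) x0.
    have x3 : 0 < `|sq - sig| / 3 by rewrite divr_gt0.
    have [T T0 hT] := tail _ x3.
    have [t Tt gt] := near_q r T r_0 T0; have t0 := le_trans T0 Tt.
    have [s' s'x l'] := hr _ gt.
    have es : s' = h t.
      apply: (lab_uniq cf fs _ _ l' (hh t t0).2); last by have := hU t t0; rewrite ler_norml; lra.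
      rewrite -(subrK sq s') (le_trans (ler_normD _ _))// -lerBrDr (le_trans s'x)//.
      by rewrite ge_min lexx orbT.
    have h1 : `|sq - h t| <= `|sq - sig| / 3.
      by rewrite -es distrC (le_trans s'x)// ge_min lexx.
    have h2 : `|h t - sig| <= `|sq - sig| / 3.
      by have := hT t Tt; have := h_sig t t0; rewrite ler_norml; lra.
    have := ler_normD (sq - h t) (h t - sig); rewrite subrKA; lra.
  have swd : `|sw| < d by rewrite ltr_norml; lra.
  have lwsig : lab w sig by apply: (limit w) => //; exists sw.
  have [|xi [xi0 hxi xiB]] := forward_exists lwsig; first by rewrite sig_d ltW.
  (* Continuous dependence over time [t] turns late visits of [g] near [w] into late visits near
     [xi t]. *)
  have const t : 0 <= t -> lab (xi t) sig.
    move=> t0; apply: limit.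
      by have [s sU l] := xiB t t0; exists s => //; rewrite ltr_norml; lra.
    move=> r T r_0 T0.
    have [||C [rho [C0 rho0 dep]]] := @ode_dependence R Z xi t t0.
    - by move=> x /andP[x0 _]; exact: hxi.
    - move=> x /andP[x0 _]; apply: Z_lip; have [s sU l] := xiB x x0; exists s => //; lra.
    have C1 : 0 < C + 1 by rewrite ltr_wpDl.
    have r'0 : 0 < Num.min rho (r / (C + 1)) by rewrite lt_min rho0 divr_gt0.
    have [t1 Tt1] := often _ T r'0 T0; rewrite le_min => /andP[d1 d2].
    have t10 := le_trans T0 Tt1; exists (t + t1); first by rewrite (le_trans Tt1)// lerDr.
    have := dep (fun x => g (x + t1)) _ _ t; rewrite add0r xi0 t0 lexx => h1.
    apply: le_trans (h1 _ d1 isT) _; first by move=> x /andP[x0 _]; exact: (solution_shift t10 hg).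
    apply: (@le_trans _ _ ((C + 1) * `|g t1 - w|)); first by rewrite ler_wpM2r// lerDl.
    by rewrite mulrC -ler_pdivlMr.
  have above := constant_label_above hxi xi0 _ const.
  have [|q oq] := low_orbit_dips lwsig; first by rewrite sig_d.
  by rewrite ltNge above// sig_d ltW.
move=> r r_0; have Ahe := fs_A fs hed'; have hc := lab_neq cf fs hed' (lab_vertical cf fs hed').
have [|r1 r10 stab] := @orbit_stability _ _ _ _ _ cf (0, he)
  [set q | exists2 z, orb (0, he) z & `|q - z| < r] Ahe hc.
  by move=> q oq; have := near_dist_lt q r_0; apply: filterS => p; exists q.
have [T T0 hT] := tail r1 r10.
near=> t; have Tt : T <= t by near: t; apply: nbhs_pinfty_ge; exact: num_real.
have t0 := le_trans T0 Tt; have [_ lt] := hh t t0.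
have [|_ sub] := stab (0, h t).
  rewrite norm_le_pair/= subrr normr0 (ltW r10)/= ltW//.
  by have := hT t Tt; have := h_sig t t0; rewrite esig ltr_norml; lra.
apply: (sub (g t)); rewrite -(lab_orb cf lt); exact: (orb_refl cf lt.1).
Unshelve. all: by end_near. Qed.

End Attract.

(** * The regularized field *)

Section Regularization.
Variable R : realType.
Implicit Types (p q : R * R) (e v x y : R).

Lemma lip_at_near (V W : normedModType R) (F F' : V -> W) (q : V) :
  (\forall a \near q, F a = F' a) -> lip_at F' q -> lip_at F q.
Proof.
move=> /near_norm_le[r r0 hr] [L [r' [L0 r'0 h]]].
exists L, (Num.min r r'); rewrite lt_min r0; split=> // a b.
rewrite !le_min => /andP[ar ar'] /andP[br br'].
by rewrite (hr a ar) (hr b br); exact: h.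
Qed.

Lemma lip_atD (V W : normedModType R) (F F' : V -> W) (q : V) :
  lip_at F q -> lip_at F' q -> lip_at (fun a => F a + F' a) q.
Proof.
move=> [L [r [L0 r0 h]]] [L' [r' [L'0 r'0 h']]].
exists (L + L'), (Num.min r r'); rewrite lt_min r0 addr_ge0//; split=> // a b.
rewrite !le_min => /andP[ar ar'] /andP[br br'].
rewrite opprD addrACA (le_trans (ler_normD _ _))// mulrDl.
by apply: lerD; [exact: h|exact: h'].
Qed.

Lemma lip_atZ (V W : normedModType R) (f : V -> R) (F : V -> W) (q : V) :
  lip_at f q -> lip_at F q -> lip_at (fun a => f a *: F a) q.
Proof.
move=> hf hF; have cf := lip_at_continuous hf; have cF := lip_at_continuous hF.
case: hf => L [r [L0 r0 h]]; case: hF => L' [r' [L'0 r'0 h']].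
have n1 := near_continuous_lt cf (@ltr01 R).
have n2 := near_continuous_lt cF (@ltr01 R).
have [s s0 hs] := near_norm_le (filterI n1 n2).
pose M := `|f q| + 1; pose M' := `|F q| + 1.
have M0 : 0 <= M by rewrite addr_ge0.
have M'0 : 0 <= M' by rewrite addr_ge0.
have bf a : `|a - q| <= s -> `|f a| <= M.
  move=> /hs[h1 _]; rewrite -(subrK (f q) (f a)) (le_trans (ler_normD _ _))//.
  by rewrite addrC lerD2l ltW.
have bF a : `|a - q| <= s -> `|F a| <= M'.
  move=> /hs[_ h1]; rewrite -(subrK (F q) (F a)) (le_trans (ler_normD _ _))//.
  by rewrite addrC lerD2l ltW.
exists (M * L' + L * M'), (Num.min s (Num.min r r')).
rewrite !lt_min s0 r0 addr_ge0 ?mulr_ge0//; split=> // a b.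
rewrite !le_min => /and3P[sa ra ra'] /and3P[sb rb rb'].
rewrite (_ : f a *: F a - f b *: F b = f a *: (F a - F b) + (f a - f b) *: F b); last first.
  by rewrite scalerBr scalerBl subrKA.
rewrite (le_trans (ler_normD _ _))// mulrDl !normrZ lerD//.
  by rewrite -mulrA ler_pM// ?bf// h'.
by rewrite mulrAC ler_pM// ?bF// h.
Qed.

Lemma lip_atZl (V W : normedModType R) (k : R) (F : V -> W) (q : V) :
  lip_at F q -> lip_at (fun a => k *: F a) q.
Proof.
by apply: lip_atZ; exists 0, 1; split=> // a b _ _; rewrite subrr normr0 mul0r.
Qed.

Lemma lip_at_snd (f : R -> R) e (q : R * R) : lip_at f (q.2 / e) ->
  lip_at (fun a : R * R => f (a.2 / e)) q.
Proof.
move=> [L [r [L0 r0 h]]]; pose E := `|e^-1| + 1; have E0 : 0 < E by rewrite ltr_wpDl.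
have bd (a b : R * R) : `|a.2 / e - b.2 / e| <= E * `|a - b|.
  rewrite -mulrBl normrM mulrC ler_pM//; last exact: (norm_snd_le (a - b)).
  by rewrite lerDl.
exists (L * E), (r / E); rewrite mulr_ge0 ?(ltW E0)// divr_gt0//; split=> // a b ha hb.
have cl (a' : R * R) : `|a' - q| <= r / E -> `|a'.2 / e - q.2 / e| <= r.
  by move=> h'; apply: le_trans (bd _ _) _; rewrite mulrC -ler_pdivlMr.
apply: le_trans (h _ _ (cl a ha) (cl b hb)) _.
by rewrite -mulrA ler_wpM2l.
Qed.

(** For [k = 1] the function truncates to [[-1, 1]] and does not expand distances; for larger [k] it
    is at least C^1 and the mean value theorem applies. *)
Lemma transition_lip k (phi : R -> R) v : transition_function k phi -> (1 <= k)%N ->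
  lip_at phi v.
Proof.
move=> [_ hm hp h1 h2]; case: k h1 h2 => // -[|k] h1 h2 _.
  exists 1, 1; split=> // a b _ _; rewrite mul1r.
  have mid x : -1 < x -> x < 1 -> phi x = x by move=> x1 x2; apply: h1 => //; rewrite ltr_norml x1.
  have n1 := ler_norm (a - b); have n2 := ler_norm (- (a - b)); rewrite normrN in n2.
  have [am|am] := leP a (-1); have [bm|bm] := leP b (-1);
    have [ap|ap] := leP 1 a; have [bp|bp] := leP 1 b;
    rewrite ?(hm _ am) ?(hm _ bm) ?(hp _ ap) ?(hp _ bp) ?(mid _ am ap) ?(mid _ bm bp);
    rewrite ler_norml; lra.
have [[hd hc] _ _] := h2 isT; rewrite /= in hd hc.
have d0 x : derivable phi x 1 by have := hd 0%N x isT.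
have c1 : continuous (derive1 phi).
  case: k {h1 h2} hd hc => [|k] hd hc; first exact: hc.
  move=> x; apply/differentiable_continuous/derivable1_diffP.
  exact: (hd 1%N x isT).
have d x : is_derive x 1 phi (derive1 phi x).
  by rewrite derive1E; exact: derivableP (d0 x).
have [r r0 hr] := near_norm_le (near_continuous_lt (c1 v) (@ltr01 R)).
pose M := `|derive1 phi v| + 1; exists M, r; split; rewrite ?addr_ge0// => a b.
wlog ab : a b / a <= b => [hw|] ha hb.
  have [/hw|/ltW/hw] := leP a b; first exact.
  by move=> /(_ hb ha); rewrite distrC [`|b - a|]distrC.
have [t] := @MVT_segment R phi _ a b ab (fun t _ => d t) (is_derive_continuous_itv (fun t _ => d t)).
rewrite in_itv/= => tab et.
rewrite distrC et normrM [`|a - b|]distrC ler_wpM2r//.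
rewrite -(subrK (derive1 phi v) (derive1 phi t)) (le_trans (ler_normD _ _))//.
by rewrite addrC lerD2l ltW// hr// (dist_itv tab).
Qed.

Lemma transition_lt1 k (phi : R -> R) v : transition_function k phi -> v < 1 -> phi v < 1.
Proof.
move=> [mono hm hp _ _] v1; have [vm|vm] := leP v (-1); first by rewrite hm// ltrN10.
have <- : phi 1 = 1 by rewrite hp.
by apply: mono => //; rewrite in_itv/= ?lexx ?(ltW vm) ?(ltW v1)//; lra.
Qed.

Lemma regularization_above k (phi : R -> R) (Xp Xm : R * R -> R * R) e q :
  transition_function k phi -> 0 < e -> e <= q.2 -> regularization phi Xp Xm e q = Xp q.
Proof.
move=> [_ _ hp _ _] e0 eq; rewrite /regularization hp; last by rewrite ler_pdivlMr// mul1r.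
rewrite mul1r -scalerDr addrACA subrr addr0 -mulr2n -(scaler_nat 2 (Xp q)) scalerA mulVf//.
exact: scale1r.
Qed.

Lemma regularization_det k (phi : R -> R) (Xp Xm : R * R -> R * R) e q :
  transition_function k phi -> 0 < e -> q.2 < e -> 0 < det (Xp q) (Xm q) ->
  0 < det (Xp q) (regularization phi Xp Xm e q).
Proof.
move=> hphi e0 qe D; have lt1 : phi (q.2 / e) < 1.
  by apply: transition_lt1 hphi _; rewrite ltr_pdivrMr// mul1r.
rewrite /regularization detDr !detZr !detDr detNr detxx.
have -> : 2^-1 * (0 + det (Xp q) (Xm q)) + phi (q.2 / e) / 2 * (0 - det (Xp q) (Xm q)) =
  (1 - phi (q.2 / e)) / 2 * det (Xp q) (Xm q) by field.
by rewrite mulr_gt0// divr_gt0// subr_gt0.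
Qed.

Lemma regularization_lip k (phi : R -> R) (Xp Xm : R * R -> R * R) e q :
  transition_function k phi -> (1 <= k)%N -> lip_at Xp q -> lip_at Xm q ->
  lip_at (regularization phi Xp Xm e) q.
Proof.
move=> hphi k1 lp lm; apply: lip_atD; first by apply: lip_atZl; exact: lip_atD.
apply: lip_atZ.
  rewrite (_ : (fun a : R * R => _) = (fun a : R * R => 2^-1 *: phi (a.2 / e))); last first.
    by apply/funext => a; rewrite mulrC.
  exact: lip_atZl (lip_at_snd (transition_lip (q.2 / e) hphi k1)).
by apply: lip_atD => //; exact: lip_at_opp.
Qed.

Lemma Ck_field_lip k U (X : R * R -> R * R) q : open U -> Ck_field_on k.+1 U X ->
  U q -> lip_at X q.
Proof. by move=> oU [h1 h2] Uq; apply: lip_at_pair; [exact: C1_lip_at h1 Uq|exact: C1_lip_at h2 Uq]. Qed.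

End Regularization.

(** * The orbit through the tangency point and the radius of attraction *)

Section TangentPeriodicOrbit.
Variables (R : realType) (A : set (R * R)) (X : R * R -> R * R) (c : R * R).
Variable fl : R -> R * R -> R * R.
Hypothesis cf : center_flow A X c fl.
Implicit Types (p q : R * R) (s t x y e : R).
Local Notation orb := (orb fl).

(* The minimum of [y] on the orbit is a tangency; the chord joining it to [ze]
   is transversal to the field, so it would be crossed twice. *)
Lemma orbit_above r0 eps e b K ze :
  (forall q, `|q| <= r0 -> A q) -> (forall q, `|q| <= r0 -> b < (X q).1) ->
  fold_box (fun q => (X q).2) b r0 K ->
  (forall q, orb ze q -> eps < q.2 \/ `|q| < r0) -> e < eps ->
  `|ze| <= r0 -> ze.2 = e -> (X ze).2 = 0 -> forall q, orb ze q -> e <= q.2.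
Proof.
move=> box_A box_X box good eeps zer ze2 Xze; have Az := box_A ze zer.
have [T T0 pT] := cf_period cf Az.
have cy : continuous (snd \o fl^~ ze).
  by move=> t; apply: continuous_comp; [exact: (phi_continuous cf ze Az)|exact: snd_continuous].
have [tm _ htm] := EVT_min (ltW T0) (continuous_subspaceT cy).
set w := fl tm ze; have ow : orb ze w by exact: orb_phi.
have wmin q : orb ze q -> w.2 <= q.2.
  by rewrite (orb_itv cf Az T0 pT) => -[t tT <-]; apply: htm.
move=> q oq; apply: le_trans (wmin q oq); rewrite leNgt; apply/negP => we.
have Xw : (X w).2 = 0 := orbit_min_tangent cf Az ow wmin.
have wr : `|w| <= r0.
  have [h|/ltW//] := good w ow; have := lt_trans h (lt_trans we eeps); by rewrite ltxx.
have slope := fb_slope box zer wr Xze Xw.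
have Aw := box_A w wr; pose n := ze - w.
have n2 : 0 < n.2 by rewrite subr_gt0 ze2.
apply: (@single_crossing _ _ _ _ _ cf w n Aw); last first.
  by rewrite addrC subrK (orb_eq cf Az ow); exact: (orb_refl cf Az).
move=> s /andP[s0 s1]; set p := w + s *: n.
have pr : `|p| <= r0.
  have -> : p = (1 - s) *: w + s *: ze by rewrite /p /n scalerBr scalerBl scale1r addrCA addrC.
  apply: le_trans (ler_normD _ _) _; rewrite !normrZ !ger0_norm ?subr_ge0//.
  apply: (@le_trans _ _ ((1 - s) * r0 + s * r0)); last by rewrite -mulrDl subrK mul1r.
  by rewrite lerD// ler_wpM2l// subr_ge0.
split; first exact: box_A.
have small := fb_small box pr; have X1 := box_X p pr.
(* In [det (X p) n = (X p).1 * n.2 - (X p).2 * n.1], the slope bound controls [n.1] by [K * n.2],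
   and [fb_small] makes the second product smaller than [b * n.2]. *)
have h1 : `|(X p).2 * n.1| <= `|(X p).2| * K * n.2.
  rewrite normrM -mulrA ler_wpM2l//; move: slope; rewrite -[ze.2 - w.2]/(n.2) (gtr0_norm n2).
  by [].
have h2 : `|(X p).2| * K * n.2 < b * n.2 by rewrite ltr_pM2r.
have h3 : b * n.2 < (X p).1 * n.2 by rewrite ltr_pM2r.
by have := ler_norm ((X p).2 * n.1); rewrite /det; lra.
Qed.

(** The label of the tangent orbit depends on [e] but stays in [[- (d / 4), d / 4]]; compactness of
    this band gives a radius valid for all [e]. *)
Lemma attraction_radius r0 eps d : fold_strip A X fl r0 eps d ->
  exists2 r, 0 < r & forall q z, band A fl (- (d / 4)) (d / 4) z -> `|q - z| < r ->
    band A fl (- (d / 2)) (d / 2) q.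
Proof.
move=> fs; have d0 := fs_pos fs.
have cB : compact (band A fl (- (d / 4)) (d / 4)) by apply: (band_compact cf fs); lra.
move: cB => /compact_near_coveringP cB.
have : \forall i \near (0 : R)^'+, band A fl (- (d / 4)) (d / 4) `<=`
    (fun z => forall q, `|q - z| < i -> band A fl (- (d / 2)) (d / 2) q).
  apply: (cB R (0^'+)%classic) => z [s sd l].
  have d4 : 0 < d / 4 by rewrite divr_gt0.
  have sdd : `|s| <= d by rewrite ler_norml; lra.
  have [r r_0 hr] := lab_near cf fs l sdd d4.
  have r2 : 0 < r / 2 by rewrite divr_gt0.
  have n1 : \forall z' \near z, `|z' - z| <= r / 2 by exact: near_dist_le.
  near=> z' i => /= q qz.
  have h1 : `|z' - z| <= r / 2 by near: z'.
  have h2 : i < r / 2 by near: i; exact: nbhs_right_lt.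
  have [|s' ss' l'] := hr q.
    by rewrite -(subrKA z') (le_trans (ler_normD _ _))//; lra.
  by exists s' => //; move: ss'; rewrite ler_norml; lra.
move=> h; near (0 : R)^'+ => i; exists i => // q z bz qz.
exact: (near h i) bz _ qz.
Unshelve. all: by end_near. Qed.

End TangentPeriodicOrbit.

Unset Implicit Arguments.

Theorem theorem2p6 (R : realType) (p : nat) (phi : R -> R)
    (Up Um : set (R * R)) (Xp Xm : R * R -> R * R)
    (c : R * R) (A : set (R * R))
    (hp : (1 <= p)%N)
    (hphi : transition_function p phi)
    (hZ : filippov_system Up Um Xp Xm)
    (hfold : visible_fold_regular Xp Xm)
    (hc : 0 < c.2)
    (hA : center_with_annulus Up Xp c A)
    (hmeet : exists x : R, A (x, 0))
    (htangency : forall x : R, A (x, 0) -> (Xp (x, 0)).2 = 0 -> x = 0) :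
  exists r d K e0 : R, [/\ 0 < r, 0 < d, 0 < K, 0 < e0 &
    forall e : R, 0 < e -> e < e0 ->
      let Ze := regularization phi Xp Xm e in
      let De := regularization_domain Up Um e in
      exists xe : R,
        [/\ `|xe| < r, `|xe| <= K * e, (Xp (xe, e)).2 = 0,
            forall x : R, `|x| < r -> (Xp (x, e)).2 = 0 -> x = xe
          & exists G : set (R * R),
              [/\ periodic_orbit Up Xp G /\ G (xe, e),
                  periodic_orbit De Ze G,
                  inside G c,
                  foliated_by_periodic_orbits De Ze (inside G `\ c)
                & attracts_outside De Ze d G]]].
Proof.
have [oUp oUm hUp hUm [CXp CXm]] := hZ.
have [X1 X2 dX2 near_sign Xm2] := hfold.
have [Xc oA cA Ac ann] := hA.
have AUp q : A q -> Up q.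
  move=> Aq; have [->|/eqP qc] := eqVneq q c; first by apply: hUp => /=; exact: ltW.
  have [G [[g [T [hs _ _ _ eG]]] Gq _ _]] := ann q Aq qc.
  by move: Gq; rewrite eG => -[t _ <-]; case: (hs t I).
have lipX q : Up q -> lip_at Xp q := Ck_field_lip oUp CXp.
have lipM q : Um q -> lip_at Xm q := Ck_field_lip oUm CXm.
have lipA q : A q -> lip_at Xp q by move=> /AUp; exact: lipX.
have [fl cf pforb] := center_flow_exists hA lipA.
have [Ao tan] := tangent_orbit cf cA hc hmeet htangency.
have Upo := AUp _ Ao.
have Umo : Um (0, 0) by apply: hUm => /=.
pose f q := (Xp q).2; pose b := (Xp (0, 0)).1 / 2.
have b0 : 0 < b by rewrite divr_gt0.
have [_ CX2] := CXp.
(* The fold condition says only that this is nonzero; visibility, through the sign of [f] for small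
   [x > 0], makes it positive. *)
have D0 : 0 < 'D_(1, 0) f (0, 0).
  rewrite lt_neqAle eq_sym dX2 /=.
  have [d1 _ _ _] := Ck_onS CX2 Upo.
  apply: (derive_ge0_right (is_derive_row d1) X2).
  by apply: filterS near_sign => x [].
have [rb [K [rb0 K0 hbox]]] := fold_box_exists oUp CX2 Upo X2 D0 b0.
have cXp := lip_at_continuous (lipX _ Upo); have cXm := lip_at_continuous (lipM _ Umo).
have n1 : \forall q \near (0, 0) : R * R, A q by exact: open_nbhs_nbhs.
have n2 : \forall q \near (0, 0) : R * R, Um q by exact: open_nbhs_nbhs.
have n3 : \forall q \near (0, 0) : R * R, b < (Xp q).1.
  have h : {for (0, 0), continuous (fun q => (Xp q).1)}.
    by apply: (@continuous_comp _ _ _ Xp fst); [exact: cXp|exact: fst_continuous].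
  by apply: (cvgr_gt _ h); rewrite /b; lra.
have n4 : \forall q \near (0, 0) : R * R, 0 < det (Xp q) (Xm q).
  apply: (cvgr_gt _ (det_continuous cXp cXm)).
  by rewrite /det X2 mul0r subr0 mulr_gt0.
have [r1 r10 hr1] := near_norm_le (filterI (filterI n1 n2) (filterI n3 n4)).
have [r0 [r00 r0b r01]] : exists r0, [/\ 0 < r0, r0 <= rb & r0 <= r1].
  by exists (Num.min rb r1); rewrite lt_min rb0 !ge_min !lexx orbT.
have box : fold_box f b r0 K := hbox r0 r0b.
have inbox q : `|q| <= r0 -> [/\ A q, Um q, b < (Xp q).1 & 0 < det (Xp q) (Xm q)].
  move=> qr; have [|[h1 h2] [h3 h4]] := hr1 q; last by split.
  rewrite (_ : q - (0, 0) = q); last exact: subr0.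
  exact: le_trans qr r01.
have [eps [d [eps0 fs]]] := fold_strip_exists cf r00 Ao X1 tan.
have d0 := fs_pos fs; have d4 : 0 < d / 4 by rewrite divr_gt0.
have [da da0 hda] := attraction_radius cf fs.
have dvo : 0 < det (Xp (0, 0)) (0, 1) by rewrite /det/= mulr1 mulr0 subr0.
have [rho rho0 sec] := section_point cf Ao dvo d4.
(* The condition [e * (K + 1) < m] bounds both [e] and [K * e] by [m]. Thus [(xe, e)] lies in the
   box and close enough to the fold to have a label of size at most [d / 4]. *)
pose m := Num.min eps (Num.min r0 rho); have m0 : 0 < m by rewrite !lt_min eps0 r00.
have K1 : 0 < K + 1 by rewrite addr_gt0.
exists r0, da, K, (m / (K + 1)); split=> //; first exact: divr_gt0.
move=> e e0; rewrite ltr_pdivlMr// => em Ze De.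
have eK : K * e < m by rewrite (le_lt_trans _ em)// mulrDr mulr1 mulrC lerDl ltW.
have em' : e < m by rewrite (le_lt_trans _ em)// mulrDr mulr1 lerDr mulr_ge0 ?ltW.
have [eeps er erho] : [/\ e < eps, e < r0 & e < rho].
  by move: em'; rewrite !lt_min => /and3P[].
have [Ker Kerho] : K * e < r0 /\ K * e < rho.
  by move: eK; rewrite !lt_min => /and3P[].
have [xe xeK Xze] := fb_zero box e0 (ltW er) Ker.
pose ze : R * R := (xe, e).
have zer : `|ze| <= r0 by rewrite normE ge_max/= (gtr0_norm e0) (ltW er) (le_trans xeK (ltW Ker)).
exists xe; split=> //; first exact: le_lt_trans xeK Ker.
  move=> x xr Xx; have xer : `|(x, e) : R * R| <= r0.
    by rewrite normE ge_max/= (gtr0_norm e0) !ltW.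
  have := fb_slope box xer zer Xx Xze; rewrite /= subrr normr0 mulr0 normr_le0.
  by rewrite subr_eq0 => /eqP.
have [Aze _ _ _] := inbox ze zer.
have zerho : `|ze - (0, 0)| <= rho.
  rewrite (_ : ze - (0, 0) = ze); last exact: subr0.
  by rewrite normE ge_max/= (gtr0_norm e0) (ltW erho) (le_trans xeK (ltW Kerho)).
have [th [he [_ hed hfl]]] := sec ze zerho.
have lze : lab A fl ze he by split=> //; exists th => //; rewrite hfl vertical_pt.
have hedd : `|he| <= d by apply: le_trans hed _; clear -d0; lra.
have eorb := lab_orb cf lze.
have top q : orb fl ze q -> e <= q.2.
  apply: (@orbit_above R A Xp c fl cf r0 eps e b K ze) => //.
  - by move=> q' /inbox[].
  - by move=> q' /inbox[].
  - by move=> q'; rewrite eorb; exact: (fs_good fs).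
have lab_top q : lab A fl q he -> e <= q.2.
  by move=> l; apply: top; rewrite eorb -(lab_orb cf l); exact: (orb_refl cf l.1).
have zec : ze <> c := lab_neq cf fs hedd lze.
pose G := orb fl ze.
have cG : closed G := orb_closed cf Aze.
have iGc : inside G c := cf_inside cf Aze zec.
have Z_above q : e <= q.2 -> Ze q = Xp q := regularization_above _ _ hphi e0.
have De_above q : A q -> e <= q.2 -> De q.
  by move=> Aq eq; split=> [_|]; [exact: AUp|rewrite ltNge eq].
have per_above q : A q -> q <> c -> (forall q', orb fl q q' -> e <= q'.2) ->
    periodic_orbit De Ze (orb fl q).
  move=> Aq qc above; have [g [T [hs T0 gT gn eG]]] := pforb q Aq qc.
  have og t : orb fl q (g t) by rewrite /orb eG; exists t.
  exists g, T; split=> //; last by rewrite Z_above// above.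
  move=> t _; split; first by apply: De_above; [exact: (orb_sub cf Aq)|exact: above].
  by rewrite Z_above ?above//; case: (hs t I).
exists G; split=> //.
- by split; [exact: pforb|exact: (orb_refl cf Aze)].
- exact: per_above.
- move=> q [iq qc]; have Aq := inside_sub cf cA Aze zec iq.
  have nG q' : orb fl q q' -> ~ G q'.
    by move=> [t _ <-]; exact: (orb_disjoint cf Aze Aq iq.1).
  have sub q' : orb fl q q' -> inside G q'.
    move=> oq'; apply: (inside_connected (orb_connected cf Aq) nG) iq => //.
    exact: (orb_refl cf Aq).
  exists (orb fl q); split; last 1 first.
  + by move=> q' oq'; split; [exact: sub|exact: (orb_neq cf Aq qc oq')].
  (* Since [G] lies in [y >= e], everything below that line is outside [G]. *)
  + apply: per_above => // q' /sub iq'; rewrite leNgt; apply/negP => h.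
    exact: inside_not_outside iq' (outside_below top h).
  + exact: (orb_refl cf Aq).
have he_d : - d < he < d by move: hed; rewrite ler_norml; clear -d0; lra.
have good q : band A fl (- d) d q -> eps < q.2 \/ `|q| < r0.
  by move=> [s sd l]; apply: (lab_good cf fs _ l); rewrite ler_norml.
have bandA q : band A fl (- d) d q -> A q by move=> [s _ []].
have below_box q : band A fl (- d) d q -> q.2 < e -> `|q| <= r0.
  by move=> /good[h|/ltW//] qe; have := lt_trans (lt_trans h qe) eeps; rewrite ltxx.
have bandDe q : band A fl (- d) d q -> De q.
  move=> Bq; have [qe|] := ltP q.2 e; last exact: De_above (bandA q Bq).
  by split=> [_|_]; [exact: AUp (bandA q Bq)|case: (inbox q (below_box q Bq qe))].
have ZA q : band A fl (- d) d q -> e <= q.2 -> Ze q = Xp q by move=> _; exact: Z_above.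
have ZB q : band A fl (- d) d q -> q.2 < e -> 0 < det (Xp q) (Ze q).
  move=> Bq qe; have [_ _ _ D] := inbox q (below_box q Bq qe).
  exact: regularization_det hphi e0 qe D.
(* Above height [eps] the regularized field is [Xp] in a whole neighbourhood; the other points of
   the band are in the box, where [Xm] is Lipschitz too. *)
have ZL q : band A fl (- d) d q -> lip_at Ze q.
  move=> Bq; have [h|h] := good q Bq.
    have := near_snd_gt (lt_trans eeps h) => n.
    apply: (lip_at_near _ (lipA q (bandA q Bq))).
    by apply: filterS n => q' /ltW; exact: Z_above.
  have [_ Mq _ _] := inbox q (ltW h).
  exact: regularization_lip hphi hp (lipA q (bandA q Bq)) (lipM q Mq).
have tang q : `|q| < r0 -> q.2 = e -> (Xp q).2 = 0 -> q = ze.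
  move=> qr qe Xq; have := fb_slope box (ltW qr) zer Xq Xze.
  rewrite /= qe subrr normr0 mulr0 normr_le0 subr_eq0 => /eqP q1.
  by rewrite [q]surjective_pairing q1 qe.
move=> q oq [z Gz qz].
have lz : lab A fl z he.
  split; first exact: (orb_sub cf Aze).
  by rewrite (orb_eq cf Aze Gz); exact: lze.2.
have [|s sd2 l] := hda q z _ qz.
  by exists he => //; move: hed; rewrite ler_norml.
have sd : `|s| <= d by rewrite ler_norml; clear -sd2 d0; lra.
(* A label equal to [he] would put [q] on [G], a larger one inside it. *)
have she : s < he.
  rewrite ltNge; apply/negP; rewrite le_eqVlt => /orP[/eqP es|lt].
    apply: oq.1; rewrite /G eorb es -(lab_orb cf l); exact: (orb_refl cf l.1).
  have := lab_in cf fs sd hedd l lt; rewrite -eorb => /inside_not_outside; exact.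
have sU : - d < s <= he by rewrite (ltW she) andbT; clear -sd2 d0; lra.
split.
  have [g [g0 hg Bg]] := forward_exists cf fs eeps he_d lab_top lze tang ZA ZB ZL l sU.
  exists g; split=> // t t0; split; last exact: hg.
  by apply: bandDe; have [s' s'U l'] := Bg t t0; exists s' => //; clear -s'U sU he_d; lra.
move=> g hg g0.
have hg' : solution Ze g by move=> t t0; case: (hg t t0).
rewrite /G eorb.
apply: (solution_converges cf fs eeps he_d lab_top lze (erefl _ : ze.2 = e) tang lipA ZA ZB ZL hg' _ sU).
by rewrite g0.
Qed.
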